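(* Let $d\ge1$ and $\tau\ge1$. If $\alpha>0$ and $\max\{d/(d+1),\,1/(\min(\alpha,1)+1)\}< p\leq \infty$, then there is a constant $C_p$ such that $$\|\sigma^\alpha_\Box f\|_{p} \leq C_{p} \|f\|_{H_{p}^\Box} \qquad (f\in H_{p}^\Box(\mathbb{T}^d)).$$
   Context: $\mathbb{T}=[-\pi,\pi]$ is the torus and $\|\cdot\|_p$ is the $L_p(\mathbb{T}^d)$ (quasi-)norm. For a distribution $f$ on $\mathbb{T}^d$, $\widehat f(k)$ $(k\in\mathbb{Z}^d)$ denotes its Fourier coefficients (for integrable $f$, $\widehat f(k)=(2\pi)^{-d}\int_{\mathbb{T}^d} f(x)e^{-\imath k\cdot x}\,dx$, $\imath=\sqrt{-1}$). Fix a real parameter $1\le\gamma<\infty$. The rectangular Riesz means of a distribution $f$, for $n\in\mathbb{N}^d$ with all $n_i\ge1$, are $$\sigma_n^{\alpha}f(x)=\sum_{|k_1|\le n_1}\cdots\sum_{|k_d|\le n_d}\prod_{i=1}^d\Big(1-\Big(\frac{|k_i|}{n_i}\Big)^\gamma\Big)^\alpha\widehat f(k)e^{\imath k\cdot x}.$$ For $\tau\ge1$ the cone is $\mathbb{R}_\tau^d=\{x\in(0,\infty)^d:\tau^{-1}\le x_i/x_j\le\tau,\ i,j=1,\ldots,d\}$, and the restricted maximal operator is $\sigma_\Box^\alpha f=\sup_{n\in\mathbb{R}_\tau^d\cap\mathbb{N}^d}|\sigma_n^\alpha f|$. For $0<p\le\infty$, the Hardy space $H_p^\Box(\mathbb{T}^d)$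 consists of all distributions $f$ on $\mathbb{T}^d$ with $\|f\|_{H_p^\Box}:=\|\sup_{t>0}|f*P_t^d|\|_p<\infty$, where $P_t^d(x)=\sum_{k\in\mathbb{Z}^d}e^{-t\|k\|_2}e^{\imath k\cdot x}$ is the periodic Poisson kernel and $*$ is convolution on $\mathbb{T}^d$. *)

(* Defs.v *)
From HB Require Import structures.
From mathcomp Require Import all_boot all_order all_algebra.
From mathcomp Require Import all_classical all_reals all_analysis.
From mathcomp Require Import complex.

Set Implicit Arguments.
Unset Strict Implicit.
Unset Printing Implicit Defensive.

Import Order.TTheory GRing.Theory Num.Theory.
Import numFieldNormedType.Exports.

Local Open Scope classical_set_scope.
Local Open Scope ring_scope.
Local Open Scope complex_scope.

(* Points of the torus are represented by points of 'rV[R]_d, and functions on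
   the torus by functions on 'rV[R]_d that are 2pi-periodic in each coordinate;
   integration is over [-pi, pi]^d. *)

Section lebesgue_torus.
Context {R : realType}.
Local Notation mR := (measurableTypeR R).

Lemma lebesgue_itv_pi_lty :
  (@lebesgue_measure R `[(- pi)%R, (pi : R)] < +oo)%E.
Proof.
rewrite lebesgue_measure_itv/=; case: ifP => _; last exact: ltry.
by rewrite -EFinD ltry.
Qed.

Definition lebesgue_circle : {finite_measure set mR -> \bar R} :=
  @mfrestr _ mR R _ (@lebesgue_measure R)
    (measurable_itv `[(- pi)%R, (pi : R)]) lebesgue_itv_pi_lty.

Section cons_measure.
Variables (n : nat) (m : {finite_measure set (n.-tuple mR) -> \bar R}).

Definition cons_measure (A : set (n.+1.-tuple mR)) : \bar R :=
  pushforward (lebesgue_circle \x m)%E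
    (fun y : mR * n.-tuple mR => [the n.+1.-tuple mR of y.1 :: y.2]) A.

Let mcons : measurable_fun [set: mR * n.-tuple mR]
  (fun y : mR * n.-tuple mR => [the n.+1.-tuple mR of y.1 :: y.2]).
Proof. by apply: measurable_cons. Qed.

Let cons_measure0 : cons_measure set0 = 0%E.
Proof. by rewrite /cons_measure /pushforward preimage_set0 measure0. Qed.

Let cons_measure_ge0 A : (0 <= cons_measure A)%E.
Proof. exact: measure_ge0. Qed.

Let cons_measure_sigma_additive : semi_sigma_additive cons_measure.
Proof.
move=> F mF tF mUF; rewrite /cons_measure /pushforward preimage_bigcup.
apply: measure_semi_sigma_additive.
- by move=> k; rewrite -[X in measurable X]setTI; exact: mcons.
- apply/trivIsetP => /= i j _ _ ij; rewrite -preimage_setI.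
  by move/trivIsetP : tF => /(_ _ _ _ _ ij) ->//; rewrite preimage_set0.
- by rewrite -preimage_bigcup -[X in measurable X]setTI; exact: mcons.
Qed.

HB.instance Definition _ := isMeasure.Build _ _ _ cons_measure
  cons_measure0 cons_measure_ge0 cons_measure_sigma_additive.

Let cons_measure_fin : fin_num_fun cons_measure.
Proof.
move=> A mA; rewrite ge0_fin_numE//.
apply: (@le_lt_trans _ _ (cons_measure setT)).
  by apply: le_measure => //; rewrite inE.
rewrite /cons_measure /pushforward preimage_setT -setXTT product_measure1E//.
by rewrite lte_mul_pinfty// ?fin_num_measure// ltey_eq fin_num_measure.
Qed.

HB.instance Definition _ :=
  Measure_isFinite.Build _ _ _ cons_measure cons_measure_fin.

End cons_measure.

(* d-dimensional Lebesgue measure restricted to [-pi, pi]^d. *)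
Fixpoint lebesgue_torus (d : nat) :
    {finite_measure set (d.-tuple mR) -> \bar R} :=
  match d with
  | 0 => \d_([tuple] : 0.-tuple mR)
  | d'.+1 => cons_measure (lebesgue_torus d')
  end.

End lebesgue_torus.

Section hardy_riesz.
Context {R : realType} {d : nat}.

Definition Lp_torus (p : \bar R) (F : 'rV[R]_d -> \bar R) : \bar R :=
  Lnorm (lebesgue_torus d) p (fun y => F (\row_i tnth y i)).

Definition iterated_partial (s : seq 'I_d) (h : 'rV[R]_d -> R) :
    'rV[R]_d -> R :=
  foldr (fun i g x => 'D_(delta_mx 0 i) g x) h s.

Definition smooth (h : 'rV[R]_d -> R) : Prop :=
  forall s : seq 'I_d,
    continuous (iterated_partial s h) /\
    forall i x, derivable (iterated_partial s h) x (delta_mx 0 i).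

Definition periodic_2pi (phi : 'rV[R]_d -> R[i]) : Prop :=
  forall x i, phi (x + (2 * pi) *: delta_mx 0 i) = phi x.

Definition test_function (phi : 'rV[R]_d -> R[i]) : Prop :=
  [/\ periodic_2pi phi, smooth (fun x => complex.Re (phi x)) &
      smooth (fun x => complex.Im (phi x))].

Definition cpartial (s : seq 'I_d) (phi : 'rV[R]_d -> R[i]) :
    'rV[R]_d -> R[i] :=
  fun x => iterated_partial s (fun y => complex.Re (phi y)) x +i*
           iterated_partial s (fun y => complex.Im (phi y)) x.

Definition test_cvg (phi_ : nat -> 'rV[R]_d -> R[i])
    (phi : 'rV[R]_d -> R[i]) : Prop :=
  forall (s : seq 'I_d) (e : R), 0 < e ->
    \forall m \near \oo, forall x,
      Normc.normc (cpartial s (phi_ m) x - cpartial s phi x) < e.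

(* A distribution is a continuous linear functional on the test functions; its
   values outside test_function are irrelevant.  As that space is metrizable,
   continuity is sequential continuity. *)
Record distribution (f : ('rV[R]_d -> R[i]) -> R[i]) : Prop := Distribution {
  distribution_linear : forall (a : R[i]) phi psi,
    test_function phi -> test_function psi ->
    f (fun x => a * phi x + psi x) = a * f phi + f psi ;
  distribution_continuous : forall phi_ phi,
    (forall m, test_function (phi_ m)) -> test_function phi ->
    test_cvg phi_ phi ->
    (fun m => Normc.normc (f (phi_ m) - f phi)) @ \oo --> (0 : R) }.

Definition expi_dot (k : 'rV[int]_d) (x : 'rV[R]_d) : R[i] :=
  let t := \sum_(i < d) (k 0 i)%:~R * x 0 i in cos t +i* sin t.

(* The duality pairing is normalized: an integrable f is identified with the
   functional phi |-> (2pi)^-d \int f phi.  No factor (2pi)^-d therefore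
   appears in the Fourier coefficients or in convolutions. *)
Definition fourier_coef (f : ('rV[R]_d -> R[i]) -> R[i]) (k : 'rV[int]_d) :
  R[i] := f (expi_dot (- k)).

Definition convolution (f : ('rV[R]_d -> R[i]) -> R[i])
    (phi : 'rV[R]_d -> R[i]) : 'rV[R]_d -> R[i] :=
  fun x => f (fun y => phi (x - y)).

Definition freq_box (n : 'I_d -> nat) : set 'rV[int]_d :=
  [set k : 'rV[int]_d | forall i, (absz (k ord0 i) <= n i)%N].

(* Sum over Z^d as the limit of the sums over the cubes |k_i| <= N. *)
Definition sum_Zd (F : 'rV[int]_d -> R[i]) : R[i] :=
  limn (fun N => complex.Re (\sum_(k \in freq_box (fun=> N)) F k)) +i*
  limn (fun N => complex.Im (\sum_(k \in freq_box (fun=> N)) F k)).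

Definition l2norm (k : 'rV[int]_d) : R :=
  Num.sqrt (\sum_(i < d) ((k 0 i)%:~R : R) ^+ 2).

Definition poisson_kernel (t : R) (x : 'rV[R]_d) : R[i] :=
  sum_Zd (fun k => (expR (- t * l2norm k))%:C * expi_dot k x).

Definition poisson_maximal (f : ('rV[R]_d -> R[i]) -> R[i]) (x : 'rV[R]_d) :
    \bar R :=
  ereal_sup [set (Normc.normc (convolution f (poisson_kernel t) x))%:E
            | t in [set t : R | 0 < t]].

Definition hardy_norm (p : \bar R) (f : ('rV[R]_d -> R[i]) -> R[i]) : \bar R :=
  Lp_torus p (poisson_maximal f).

Definition hardy_space (p : \bar R) : set (('rV[R]_d -> R[i]) -> R[i]) :=
  [set f | distribution f /\ (hardy_norm p f < +oo)%E].

Definition riesz_mean (gamma alpha : R) (n : 'I_d -> nat)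
    (f : ('rV[R]_d -> R[i]) -> R[i]) (x : 'rV[R]_d) : R[i] :=
  \sum_(k \in freq_box n)
    (\prod_(i < d) (1 - ((absz (k 0 i))%:R / (n i)%:R) `^ gamma) `^ alpha)%:C
    * fourier_coef f k * expi_dot k x.

Definition cone (tau : R) : set ('I_d -> nat) :=
  [set n | (forall i, (1 <= n i)%N) /\
           (forall i j, tau^-1 <= (n i)%:R / (n j)%:R <= tau)].

Definition riesz_maximal (gamma alpha tau : R)
    (f : ('rV[R]_d -> R[i]) -> R[i]) (x : 'rV[R]_d) : \bar R :=
  ereal_sup [set (Normc.normc (riesz_mean gamma alpha n f x))%:E
            | n in cone tau].

End hardy_riesz.

(* Main.v *)
Require Import Defs.
From HB Require Import structures.
From mathcomp Require Import all_boot all_order all_algebra.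
From mathcomp Require Import all_classical all_reals all_analysis.
From mathcomp Require Import measurable_realfun ess_sup_inf.
From mathcomp Require Import complex ring lra zify.

(** For [p <= 1] the [L_p] norm of [f] does not control the Riesz means.  The
    Hardy norm does, because the Poisson integrals of [f] behave like
    subharmonic functions: the power [r] of such an integral, for suitable
    [r < p], is dominated by averages of powers [r] of other ones.
    Once [|sigma_n f| <= C (M (U ^ r)) ^ (1 / r)] is known, with [U] the Poisson
    maximal function and [M] the strong maximal operator, the boundedness of [M]
    on [L_(p / r)], [p / r > 1], concludes.

    The inequality is first proved on the grid of [2 N + 1] equidistant points
    per coordinate, where every sum is finite, and then transferred.  A function
    on the grid is given by its Fourier coefficients, and a multiplier acts by
    averaging against a kernel ([multiplierM]).  All kernels are compared with
    one family of weights, the products over the coordinates of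
    [n (1 + n s) ^ (- (1 + b))], where [s] is the distance; averages against
    such a weight are controlled by the strong maximal operator
    ([grid_average_le_strong_max]), which is bounded in [l_q] for [q > 1]
    because each coordinate line is the orbit of a permutation and Hopf's
    maximal ergodic theorem applies ([strong_max_strong]).

    - The Riesz kernel satisfies the bound for [b <= min (alpha, 1)], by
      summation by parts and the concavity of [1 - x ^ gamma]
      ([riesz_kernel_bound]).
    - The Poisson kernel is not a product.  Subordination writes it as a mean of
      heat kernels, which are products, and the bound survives integration in
      the subordination variable as soon as [b d < 1]
      ([poisson_kernel_bound]).

    If [r (1 + b) > 1], the power [r] of the weight is again an admissible
    weight.  Since the Poisson mean at time [t] is an average of Poisson means at
    time [t / 2], its value at [y], damped by a power of the distance from [x]
    to [y] relative to [t], has power [r] at most [C M (U ^ r) (x)]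
    ([poisson_level_tangential]).  A low-pass projection
    differs from a Poisson mean at a much smaller time by a small multiple of
    another low-pass projection, so that its averages are bounded in the same
    way after absorption ([low_pass_average]); and a Riesz mean is an average of
    a low-pass projection ([riesz_pointwise]).  The conditions
    [r < min (p, 1)], [r (1 + b) > 1], [b < 1 / d] and [b <= min (alpha, 1)] are
    compatible exactly when [p] exceeds [d / (d + 1)] and
    [1 / (min (alpha, 1) + 1)] ([riesz_exponents]).

    A trigonometric polynomial restricted to a translate of the grid is of the
    above form, and integrating over the translates gives the torus
    ([grid_transfer]).  A distribution has Fourier coefficients that grow more
    slowly than every exponential ([fourier_coef_growth]), so its Poisson
    integrals are uniform limits of trigonometric polynomials at times bounded
    away from zero ([poisson_sum_tail]).  The grid inequality is therefore
    applied to truncations of [f * P_e], with constants independent of the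
    truncation, and [e] tends to zero: Fatou's lemma for finite [p], and an
    inequality between the parts exceeding a level for [p = oo]. *)

Set Implicit Arguments.
Unset Strict Implicit.
Unset Printing Implicit Defensive.

Import Order.TTheory GRing.Theory Num.Theory.
Import numFieldNormedType.Exports.

Local Open Scope classical_set_scope.
Local Open Scope ring_scope.

Ltac nonneg := repeat first
  [ done | apply: mulr_ge0 | apply: addr_ge0 | apply: powR_ge0
  | apply: exprn_ge0 | apply: ler0n | apply: expR_ge0 | apply: normr_ge0
  | rewrite invr_ge0 | apply: sumr_ge0 => ? ? | apply: prodr_ge0 => ? ?
  | by apply: ltW ].

(** * Maximal inequality for a permutation of a finite set *)

Section ErgodicMaximal.
Variables (R : realType) (X : finType) (T : X -> X).
Implicit Types (g : X -> R) (x : X) (K n : nat).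

Definition ergodic_sum g n x : R := \sum_(i < n) g (iter i T x).

Definition ergodic_max g K x : R :=
  \big[Num.max/0]_(n < K) (ergodic_sum g n.+1 x / n.+1%:R).

Lemma ergodic_sum0 g x : ergodic_sum g 0 x = 0.
Proof. by rewrite /ergodic_sum big_ord0. Qed.

Lemma ergodic_sumS g n x :
  ergodic_sum g n.+1 x = g x + ergodic_sum g n (T x).
Proof.
rewrite /ergodic_sum big_ord_recl /=; congr (_ + _); apply: eq_bigr => i _.
by rewrite -iterSr.
Qed.

Lemma ergodic_max_ge0 g K x : 0 <= ergodic_max g K x.
Proof. exact: bigmax_ge_id. Qed.

Lemma ergodic_sum_le_max g K n x : (n <= K)%N ->
  ergodic_sum g n x <= n%:R * ergodic_max g K x.
Proof.
case: n => [|n] nK; first by rewrite ergodic_sum0 mul0r.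
rewrite mulrC -ler_pdivrMr ?ltr0n//.
exact: (le_bigmax 0 (fun i : 'I_K => ergodic_sum g i.+1 x / i.+1%:R) (Ordinal nK)).
Qed.

Lemma ergodic_max_le g K x c : 0 <= c -> (forall y, g y <= c) ->
  ergodic_max g K x <= c.
Proof.
move=> c0 gc; apply: bigmax_le => // i _.
rewrite ler_pdivrMr ?ltr0n// mulr_natr.
rewrite (le_trans (ler_sum _ (fun (j : 'I_i.+1) _ => gc (iter j T x))))//.
by rewrite sumr_const card_ord.
Qed.

(** Hopf's maximal ergodic theorem.  Garsia's argument: with [h = g - l] and
    [H] the largest partial sum of [h] along the orbit, [H <= h + H \o T] on the
    set where the maximal function exceeds [l], [H = 0] off it, and the sums of
    [H] and [H \o T] agree. *)
Lemma maximal_ergodic g K l : injective T -> 0 < l ->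
  l * (\sum_(x | l <= ergodic_max g K x) 1) <=
  \sum_(x | l <= ergodic_max g K x) g x.
Proof.
move=> injT l0; pose h x := g x - l.
have sumh n x : ergodic_sum h n x = ergodic_sum g n x - n%:R * l.
  by rewrite /ergodic_sum sumrB sumr_const card_ord mulr_natl.
pose H x := \big[Num.max/0]_(n < K.+1) ergodic_sum h n x.
have H0 x : 0 <= H x by exact: bigmax_ge_id.
suff : 0 <= \sum_(x | l <= ergodic_max g K x) h x.
  rewrite sumrB subr_ge0; move/(le_trans _); apply.
  by rewrite mulr_sumr; under eq_bigr do rewrite mulr1.
have HE x : l <= ergodic_max g K x -> H x - H (T x) <= h x.
  move=> lM; rewrite lerBlDr.
  have h0 : 0 <= h x + H (T x).
    have [/existsP[i lS]|/existsPn noS] :=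
        boolP [exists i : 'I_K, l <= ergodic_sum g i.+1 x / i.+1%:R]; last first.
      move: lM; rewrite leNgt => /negP[].
      by apply/bigmax_ltP; split=> // i _; rewrite ltNge; exact: noS.
    rewrite ler_pdivlMr ?ltr0n// in lS.
    have : 0 <= ergodic_sum h i.+1 x by rewrite sumh subr_ge0 mulrC.
    rewrite ergodic_sumS => /le_trans; apply; rewrite lerD2l.
    exact: (le_bigmax 0 (fun n : 'I_K.+1 => ergodic_sum h n (T x))
      (widen_ord (leqnSn K) i)).
  apply: bigmax_le => [|[[|n] /= nK] _]; [by []|by rewrite ergodic_sum0|].
  rewrite ergodic_sumS lerD2l.
  exact: (le_bigmax 0 (fun n : 'I_K.+1 => ergodic_sum h n (T x))
      (Ordinal (ltnW nK))).
have HnE x : ~~ (l <= ergodic_max g K x) -> H x = 0.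
  rewrite -ltNge => Ml; apply/eqP; rewrite eq_le H0 andbT.
  apply: bigmax_le => // -[n /= nK] _; rewrite sumh subr_le0.
  apply: le_trans (ergodic_sum_le_max g x _) _; first exact: nK.
  by rewrite ler_wpM2l// ltW.
apply: le_trans (ler_sum _ HE); rewrite sumrB subr_ge0.
apply: (@le_trans _ _ (\sum_x H (T x))).
  by rewrite [leRHS](bigID (fun x => l <= ergodic_max g K x)) lerDl sumr_ge0.
rewrite (_ : \sum_x H (T x) = \sum_x H x); last by rewrite [RHS](reindex_inj injT).
rewrite (bigID (fun x => l <= ergodic_max g K x)) /=.
by rewrite [X in _ + X]big1 ?addr0// => x /HnE.
Qed.

End ErgodicMaximal.

(** * From the weak to the strong type inequality *)

Section StrongType.
Variable R : realType.
Implicit Types a q M : R.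

Lemma powR_gt1 a q : 1 < a -> 0 < q -> 1 < a `^ q.
Proof.
move=> a1 q0; rewrite [ltLHS](_ : 1 = 1 `^ q); last by rewrite powR1.
by rewrite gt0_ltr_powR ?nnegrE ?ler01 ?(ltW (lt_trans _ a1)).
Qed.

(** With [dyadic_layers_lower]: a power of [M] is comparable to the sum of the
    same power over the dyadic levels below [M], a discrete layer-cake
    formula. *)
Lemma dyadic_layers_upper a q M B : 0 < a -> 1 < q -> 0 <= M ->
  M < a * 2 ^+ B ->
  M `^ q <= a `^ q + 2 `^ q *
    \sum_(i < B | a * 2 ^+ i <= M) (a * 2 ^+ i) `^ q.
Proof.
move=> a0 q1 M0; elim: B => [|B IH] MB.
  rewrite big_ord0 mulr0 addr0 ge0_ler_powR ?nnegrE ?(ltW a0)//; first lra.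
  by rewrite (le_trans (ltW MB))// expr0 mulr1.
have [{}/IH IH|BM] := ltP M (a * 2 ^+ B).
  rewrite (le_trans IH)// lerD2l ler_pM2l ?powR_gt0// big_mkcond [leRHS]big_mkcond.
  by rewrite big_ord_recr /= lerDl; case: ifP => // _; rewrite powR_ge0.
have a'0 := ltW a0.
have a2 i : 0 <= a * 2 ^+ i by rewrite mulr_ge0 ?exprn_ge0.
rewrite big_mkcond big_ord_recr /= BM mulrDr addrCA -powRM//.
rewrite (@le_trans _ _ ((2 * (a * 2 ^+ B)) `^ q))//.
  rewrite ge0_ler_powR ?nnegrE ?mulr_ge0//; first lra.
  by rewrite (le_trans (ltW MB))// exprS mulrCA.
rewrite addrA lerDr addr_ge0 ?powR_ge0// mulr_ge0 ?powR_ge0// sumr_ge0// => i _.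
by case: ifP => // _; rewrite powR_ge0.
Qed.

Lemma dyadic_layers_lower a q M B : 0 < a -> 0 < q -> 0 <= M ->
  (2 `^ q - 1) * \sum_(i < B | a * 2 ^+ i <= M) (a * 2 ^+ i) `^ q <=
  2 `^ q * M `^ q.
Proof.
move=> a0 q0 M0.
have a2 i : 0 <= a * 2 ^+ i by rewrite mulr_ge0 ?exprn_ge0// ltW.
have c0 : 0 < 2 `^ q - 1 :> R.
  by rewrite subr_gt0 powR_gt1// ltr1n.
have all_layers C : (2 `^ q - 1) * \sum_(i < C) (a * 2 ^+ i) `^ q <=
    (a * 2 ^+ C) `^ q.
  elim: C => [|C IH]; first by rewrite big_ord0 mulr0 powR_ge0.
  rewrite big_ord_recr /= mulrDr exprS mulrCA [in leRHS]powRM//.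
  by move: IH; set u := _ `^ q; lra.
elim: B => [|B IH]; first by rewrite big_ord0 mulr0 mulr_ge0// powR_ge0.
have [BM|MB] := leP (a * 2 ^+ B) M; last first.
  rewrite big_mkcond big_ord_recr /= (lt_geF MB) addr0 -big_mkcond.
  exact: IH.
apply: (@le_trans _ _ ((2 `^ q - 1) * \sum_(i < B.+1) (a * 2 ^+ i) `^ q)).
  rewrite ler_pM2l// [leLHS]big_mkcond ler_sum// => i _.
  by case: ifP => // _; rewrite powR_ge0.
apply: le_trans (all_layers _) _; rewrite exprS mulrCA powRM//.
by rewrite ler_pM2l ?powR_gt0// ge0_ler_powR ?nnegrE// ltW.
Qed.

Definition strong_type_const q : R :=
  let c := 2 `^ q * (2 `^ (q - 1) / (2 `^ (q - 1) - 1)) in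
  2 * (c * (2 * c) `^ (q - 1)).

(** Marcinkiewicz interpolation between the weak type inequality and the
    trivial bound, in its simplest form: summing the hypothesis over the dyadic
    levels [a * 2 ^+ i] gives [\sum M ^ q <= c * \sum g * M ^ (q - 1)] up to an
    error that vanishes with [a], and the last sum is absorbed. *)
Lemma weak_to_strong (X : finType) (M g : X -> R) q : 1 < q ->
  (forall x, 0 <= M x) -> (forall x, 0 <= g x) ->
  (forall l, 0 < l -> l * (\sum_(x | l <= M x) 1) <= \sum_(x | l <= M x) g x) ->
  \sum_x M x `^ q <= strong_type_const q * \sum_x g x `^ q.
Proof.
move=> q1 M0 g0 weak.
have q10 : 0 < q - 1 by rewrite subr_gt0.
have c0 : 0 < 2 `^ (q - 1) - 1 :> R.
  by rewrite subr_gt0 powR_gt1// ltr1n.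
rewrite /strong_type_const.
set c := 2 `^ q * _.
have c_ge0 : 0 <= c by rewrite !mulr_ge0 ?powR_ge0// invr_ge0 ltW.
have key : \sum_x M x `^ q <= c * \sum_x g x * M x `^ (q - 1).
  apply/ler_addgt0Pr => e e0.
  pose a : R := (e / (#|X|%:R + 1)) `^ q^-1.
  have X1 : 0 < #|X|%:R + 1 :> R by rewrite ltr_wpDl.
  have a0 : 0 < a by rewrite powR_gt0// divr_gt0.
  have aq : a `^ q = e / (#|X|%:R + 1).
    by rewrite -powRrM mulVf ?powRr1 ?divr_ge0 ?ltW//; lra.
  have [B MB] : exists B, forall x, M x < a * 2 ^+ B.
    exists (Num.truncn (\sum_x M x / a)).+1 => x.
    rewrite mulrC -ltr_pdivrMr//.
    apply: (@le_lt_trans _ _ (\sum_x M x / a)).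
      by rewrite (bigD1 x)//= lerDl sumr_ge0// => y _; rewrite divr_ge0// ltW.
    apply: lt_trans (truncnS_gt _) _.
    by rewrite -natrX ltr_nat ltn_expl.
  apply: le_trans (ler_sum _ (fun x _ => dyadic_layers_upper a0 q1 (M0 x) (MB x))) _.
  rewrite big_split /= addrC lerD//; last first.
    rewrite sumr_const aq -[leLHS]mulr_natr mulrAC ler_pdivrMr//.
    by rewrite mulrDr mulr1 lerDl ltW.
  rewrite -mulr_sumr -mulrA ler_pM2l ?powR_gt0//.
  have -> : \sum_x \sum_(i < B | a * 2 ^+ i <= M x) (a * 2 ^+ i) `^ q =
      \sum_(i < B) (a * 2 ^+ i) `^ (q - 1) *
         ((a * 2 ^+ i) * \sum_(x | a * 2 ^+ i <= M x) 1).
    under eq_bigr do rewrite big_mkcond.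
    rewrite exchange_big /=; apply: eq_bigr => i _.
    rewrite -big_mkcond mulrA [_ * (a * _)]mulrC.
    rewrite mulr_powRB1 ?mulr_ge0 ?exprn_ge0 ?(ltW a0)//; last lra.
    by rewrite mulr_sumr; apply: eq_bigr => x _; rewrite mulr1.
  apply: (@le_trans _ _ (\sum_(i < B) (a * 2 ^+ i) `^ (q - 1) *
       \sum_(x | a * 2 ^+ i <= M x) g x)).
    apply: ler_sum => i _; rewrite ler_wpM2l ?powR_ge0//.
    by apply: weak; rewrite mulr_gt0// exprn_gt0.
  have -> : \sum_(i < B) (a * 2 ^+ i) `^ (q - 1) *
       \sum_(x | a * 2 ^+ i <= M x) g x =
     \sum_x g x * \sum_(i < B | a * 2 ^+ i <= M x) (a * 2 ^+ i) `^ (q - 1).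
    under eq_bigr do rewrite mulr_sumr big_mkcond.
    rewrite exchange_big /=; apply: eq_bigr => x _.
    rewrite -big_mkcond mulr_sumr; apply: eq_bigr => i _.
    by rewrite mulrC.
  rewrite mulr_sumr; apply: ler_sum => x _.
  rewrite mulrCA ler_wpM2l// mulrAC ler_pdivlMr// mulrC.
  exact: dyadic_layers_lower.
clearbody c; suff half : c * (\sum_x g x * M x `^ (q - 1)) <=
    2^-1 * (\sum_x M x `^ q) + c * (2 * c) `^ (q - 1) * \sum_x g x `^ q.
  by move: key half; set u := \sum_x M x `^ q; rewrite -mulrA; lra.
rewrite !mulr_sumr -big_split /=; apply: ler_sum => x _.
have [gM|Mg] := leP (2 * c * g x) (M x).
  rewrite ler_wpDr//; first by nonneg.
  rewrite mulrA.
  rewrite -[in leRHS](mulr_powRB1 (M0 x)); last lra.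
  by rewrite mulrA ler_wpM2r ?powR_ge0//; lra.
rewrite ler_wpDl//; first by nonneg.
rewrite -(mulr_powRB1 (g0 x)); last lra.
rewrite -mulrA ler_wpM2l// mulrCA ler_wpM2l// -powRM ?mulr_ge0//.
by apply: ge0_ler_powR; rewrite ?nnegrE ?(ltW Mg) ?(ltW q10)//; nonneg.
Qed.

Lemma ergodic_max_strong (X : finType) (T : X -> X) (g : X -> R) K q :
  injective T -> 1 < q -> (forall x, 0 <= g x) ->
  \sum_x ergodic_max T g K x `^ q <= strong_type_const q * \sum_x g x `^ q.
Proof.
move=> injT q1 g0; apply: weak_to_strong => // [x|l l0].
  exact: ergodic_max_ge0.
exact: maximal_ergodic.
Qed.

Lemma strong_type_const_ge0 q : 1 < q -> 0 <= strong_type_const q.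
Proof.
move=> q1; have ? : 0 <= 2 `^ (q - 1) - 1 :> R.
  by rewrite subr_ge0 ltW// powR_gt1 ?ltr1n ?subr_gt0.
by rewrite /strong_type_const; nonneg.
Qed.

End StrongType.

(** * One-dimensional kernels *)

Lemma telescope_ord (V : zmodType) (f : nat -> V) n :
  \sum_(k < n) (f k - f k.+1) = f 0%N - f n.
Proof.
elim: n => [|n IH]; first by rewrite big_ord0 subrr.
by rewrite big_ord_recr /= IH addrA subrK.
Qed.

Section Abel.
Variable R : realType.
Implicit Types (a d s : nat -> R) (t B : R) (n N K : nat).

(** The kernel [\sum_(|k| <= N) a |k| e^(2 i k t)]; working with the half angle
    [t] keeps the factor [sin t] of summation by parts simple. *)
Definition even_kernel a N t : R :=
  a 0 + \sum_(k < N) 2 * a k.+1 * cos (2 * k.+1%:R * t).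

Lemma even_kernel_bound a N t : `|even_kernel a N t| <=
  `|a 0| + 2 * \sum_(k < N) `|a k.+1|.
Proof.
apply: le_trans (ler_normD _ _) _; rewrite lerD2l mulr_sumr.
apply: le_trans (ler_norm_sum _ _ _) _; apply: ler_sum => k _.
by rewrite !normrM normr_nat ler_piMr ?mulr_ge0// cos_max.
Qed.

Lemma even_kernelB a b N t :
  even_kernel (fun k => a k - b k) N t = even_kernel a N t - even_kernel b N t.
Proof.
rewrite /even_kernel opprD addrACA -sumrB; congr (_ + _).
by apply: eq_bigr => k _; rewrite mulrBr mulrBl.
Qed.

Lemma even_kernelZ c a N t :
  even_kernel (fun k => c * a k) N t = c * even_kernel a N t.
Proof.
rewrite /even_kernel mulrDr mulr_sumr; congr (_ + _).
by apply: eq_bigr => k _; ring.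
Qed.

(** Summation by parts against the Dirichlet sums; a second one, against the
    sums of odd sines, is [sum_odd_sin_variation]. *)
Lemma even_kernel_abel a N t : sin t * even_kernel a N t =
  \sum_(k < N) (a k - a k.+1) * sin ((2 * k + 1)%:R * t) +
  a N * sin ((2 * N + 1)%:R * t).
Proof.
elim: N => [|N IH]; first by rewrite /even_kernel !big_ord0 muln0 mul1r addr0 add0r mulrC.
rewrite /even_kernel big_ord_recr /= addrA mulrDr -/(even_kernel a N t) IH.
rewrite big_ord_recr /= -!addrA; congr (_ + _).
have -> : ((2 * N + 1)%:R : R) * t = 2 * N.+1%:R * t - t.
  by rewrite natrD natrM -[in RHS]natr1; ring.
have -> : ((2 * N.+1 + 1)%:R : R) * t = 2 * N.+1%:R * t + t.
  by rewrite natrD natrM; ring.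
by rewrite sinB sinD; ring.
Qed.

Lemma sum_odd_sin t n :
  sin t * \sum_(k < n) sin ((2 * k + 1)%:R * t) = sin (n%:R * t) ^+ 2.
Proof.
elim: n => [|n IH]; first by rewrite big_ord0 mulr0 mul0r sin0 expr0n.
rewrite big_ord_recr mulrDr IH /=.
have -> : ((2 * n + 1)%:R : R) * t = n%:R * t + (n%:R * t + t).
  by rewrite natrD natrM; ring.
have -> : n.+1%:R * t = n%:R * t + t by rewrite -natr1; ring.
rewrite !(sinD (n%:R * t)) !cosD.
move: (cos2Dsin2 (n%:R * t)) (cos2Dsin2 t).
set c := cos (n%:R * t); set s := sin (n%:R * t).
set C := cos t; set S := sin t => h1 h2.
have -> : s ^+ 2 = s ^+ 2 * (C ^+ 2 + S ^+ 2) by rewrite h2 mulr1.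
have -> : S * (s * (c * C - s * S) + c * (s * C + c * S)) =
   2 * s * c * C * S + (c ^+ 2 - s ^+ 2) * S ^+ 2 by ring.
by ring.
Qed.

Lemma abel_variation d s B K :
  (forall n, (n <= K.+1)%N -> `|\sum_(k < n) s k| <= B) ->
  `|\sum_(k < K.+1) d k * s k| <=
  B * (`|d K| + \sum_(k < K) `|d k - d k.+1|).
Proof.
move=> sB.
have -> : \sum_(k < K.+1) d k * s k =
  d K * (\sum_(k < K.+1) s k) +
  \sum_(k < K) (d k - d k.+1) * \sum_(j < k.+1) s j.
  elim: K {sB} => [|K IH]; first by rewrite !big_ord1 big_ord0 addr0.
  rewrite big_ord_recr /= IH [in RHS]big_ord_recr /=.
  rewrite [in X in _ = _ + X]big_ord_recr /=; set U := \sum_(i < K.+1) s i.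
  by set V := \sum_(k < K) _; ring.
apply: le_trans (ler_normD _ _) _; rewrite mulrDr lerD//.
  by rewrite normrM mulrC ler_wpM2r// sB.
rewrite mulr_sumr; apply: le_trans (ler_norm_sum _ _ _) _.
by apply: ler_sum => k _; rewrite normrM mulrC ler_wpM2r// sB// ltnS ltnW.
Qed.

Lemma sum_odd_sin_variation d t K :
  `|sin t| * `|\sum_(k < K.+1) d k * sin ((2 * k + 1)%:R * t)| <=
  `|d K| + \sum_(k < K) `|d k - d k.+1|.
Proof.
rewrite -normrM mulr_sumr.
under eq_bigr do rewrite mulrCA.
rewrite -[leRHS]mul1r.
apply: (@abel_variation d (fun k => sin t * sin ((2 * k + 1)%:R * t))) => n _.
by rewrite -mulr_sumr sum_odd_sin ger0_norm ?sqr_ge0.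
Qed.

Lemma even_kernel_variation a N t :
  sin ((2 * N.+1 + 1)%:R * t) = 0 \/ a N.+1 = 0 ->
  sin t ^+ 2 * `|even_kernel a N.+1 t| <=
  `|a N - a N.+1| + \sum_(k < N) `|a k - 2 * a k.+1 + a k.+2|.
Proof.
move=> aN; rewrite -real_normK ?num_real// expr2 -mulrA -normrM even_kernel_abel.
have -> : a N.+1 * sin ((2 * N.+1 + 1)%:R * t) = 0.
  by case: aN => ->; rewrite ?mulr0 ?mul0r.
rewrite addr0.
apply: le_trans (sum_odd_sin_variation (fun k => a k - a k.+1) t N) _.
rewrite lerD2l; apply: ler_sum => k _; rewrite le_eqVlt; apply/orP; left.
by apply/eqP; congr (`|_|); ring.
Qed.

End Abel.

Section Weight.
Variable R : realType.
Implicit Types (b s : R) (n : nat).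

(** An approximate identity at scale [1 / n]; [s] stands for the distance to
    the origin. *)
Definition bump_weight b n s : R := n%:R * (1 + n%:R * s) `^ (- (1 + b)).

Lemma bump_weight_ge0 b n s : 0 <= bump_weight b n s.
Proof. by rewrite /bump_weight; nonneg. Qed.

(** The two ways a kernel is estimated, by its size near the origin and by
    cancellation away from it, combine into the weight. *)
Lemma le_bump_weight b n s K B : 0 <= b <= 1 -> 0 <= s -> 0 <= B ->
  K <= B * n%:R ->
  (1 <= n%:R * s -> (n%:R * s) `^ (1 + b) * K <= B * n%:R) ->
  K <= 4 * B * bump_weight b n s.
Proof.
move=> /andP[b0 b1] s0 B0 K1 K2; rewrite /bump_weight powRN mulrA ler_pdivlMr; last first.
  by rewrite powR_gt0// ltr_wpDr// mulr_ge0.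
have u0 : 0 <= n%:R * s by rewrite mulr_ge0.
have Bn : 0 <= B * n%:R by rewrite mulr_ge0.
have bb : 0 <= 1 + b by rewrite addr_ge0.
have le2 (v : R) : 1 <= v -> (2 * v) `^ (1 + b) <= 4 * v `^ (1 + b).
  move=> v1; rewrite powRM//; last exact: le_trans v1.
  rewrite ler_wpM2r ?powR_ge0//.
  rewrite (@le_trans _ _ (2 `^ 2))//; last by rewrite powR_mulrn// expr2; lra.
  by rewrite ler_powR ?ler1n// ; lra.
have [u1|u1] := leP (n%:R * s) 1.
- have [K0|K0] := leP K 0.
    by rewrite (@le_trans _ _ 0)// ?mulr_le0_ge0 ?powR_ge0//; nonneg.
  rewrite (@le_trans _ _ (K * 4))//; last by rewrite mulrC -mulrA ler_wpM2l.
  rewrite ler_wpM2l ?(ltW K0)//.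
  rewrite (@le_trans _ _ ((2 * 1) `^ (1 + b)))//.
    by apply: ge0_ler_powR; rewrite ?nnegrE//; lra.
  by rewrite (le_trans (le2 _ _))// powR1 mulr1.
- have [K0|K0] := leP K 0.
    by rewrite (@le_trans _ _ 0)// ?mulr_le0_ge0 ?powR_ge0//; nonneg.
  rewrite (@le_trans _ _ (K * (4 * (n%:R * s) `^ (1 + b))))//; last first.
    rewrite mulrCA -mulrA ler_wpM2l// mulrC; exact: K2 (ltW u1).
  rewrite ler_wpM2l ?(ltW K0)// (le_trans _ (le2 _ (ltW u1)))//.
  by apply: ge0_ler_powR; rewrite ?nnegrE//; lra.
Qed.

End Weight.

Section Concave.
Variable R : realType.
Implicit Types (a : nat -> R) (A b t : R) (n N : nat).

(** Away from the edge [k = n], two summations by parts cost the slope of [a];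
    within distance [1 / sin t] of the edge a single one costs the size of [a]
    there.  Concavity bounds the slope by the same quantity, which the last
    hypothesis makes small. *)
Lemma concave_kernel a A b n N t : 0 < b <= 1 -> (0 < n <= N)%N -> 0 <= A ->
  (forall k, (n <= k)%N -> a k = 0) ->
  (forall k, (k.+2 <= n)%N -> a k - a k.+1 <= a k.+1 - a k.+2) ->
  (forall k, a k.+1 <= a k) ->
  (forall l, (l <= n)%N -> a (n - l)%N <= A * (l%:R / n%:R) `^ b) ->
  `|even_kernel a N t| <= 48 * A * bump_weight b n `|sin t|.
Proof.
move=> /andP[b0 b1] /andP[n0 nN] A0 an0 aconc adecr asmall.
have nR : 0 < n%:R :> R by rewrite ltr0n.
have b'0 := ltW b0.
have a_homo i j : (i <= j)%N -> a j <= a i.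
  move=> /subnK <-; elim: (j - i)%N => [|m IH]; first by rewrite add0n.
  by rewrite addSn (le_trans (adecr _)).
have a_ge0 k : 0 <= a k.
  rewrite (le_trans _ (a_homo _ (k + n)%N (leq_addr _ _)))// an0//.
  by rewrite leq_addl.
have aA k : a k <= A.
  rewrite (le_trans (a_homo 0%N _ _))//.
  by have := asmall n (leqnn _); rewrite subnn divff ?gt_eqF// powR1 mulr1.
have sN : even_kernel a N t = even_kernel a n t.
  rewrite /even_kernel; congr (_ + _).
  rewrite -(subnKC nN) big_split_ord /= [X in _ + X]big1 ?addr0// => k _.
  by rewrite an0 ?mulr0 ?mul0r// -addnS leq_addr.
have trivial_bound : `|even_kernel a n t| <= 3 * A * n%:R.
  rewrite (le_trans (even_kernel_bound _ _ _))// ger0_norm//.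
  rewrite (@le_trans _ _ (A + 2 * (A * n%:R)))//.
    rewrite lerD// ler_pM2l// (@le_trans _ _ (\sum_(k < n) A))//.
      by apply: ler_sum => k _; rewrite ger0_norm.
    by rewrite sumr_const card_ord mulr_natr.
  have : A * 1 <= A * n%:R by rewrite ler_wpM2l// ler1n.
  lra.
rewrite sN (_ : 48 * A = 4 * (12 * A)); last by ring.
pose S : R := `|sin t|; rewrite -/S; have S0 : 0 <= S by exact: normr_ge0.
have S1 : S <= 1 by exact: sin_max.
apply: le_bump_weight => //; rewrite ?b'0 ?mulr_ge0//.
  by rewrite (le_trans trivial_bound)// ler_wpM2r// ler_wpM2r//; lra.
move=> nS; have Sp : 0 < S.
  by rewrite lt_neqAle S0 andbT; apply: contraTneq nS => <-; rewrite mulr0 -ltNge.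
have [n2|n2] := leP (n%:R * S) 2.
  rewrite (@le_trans _ _ (4 * (3 * A * n%:R)))//; last by rewrite !mulrA; lra.
  rewrite ler_pM ?powR_ge0//.
  rewrite (@le_trans _ _ (2 `^ 2))//; last by rewrite powR_mulrn// expr2; lra.
  rewrite (@le_trans _ _ (2 `^ (1 + b)))//.
    by apply: ge0_ler_powR; rewrite ?nnegrE ?mulr_ge0//; lra.
  by rewrite ler_powR ?ler1n//; lra.
(* The distance to the edge at which the two estimates balance. *)
pose l := (Num.truncn S^-1).+1.
have lS1 : 1 <= l%:R * S.
  by rewrite -ler_pdivrMr// div1r ltW// truncnS_gt.
have lS2 : l%:R * S <= 2.
  have : (Num.truncn S^-1)%:R * S <= 1.
    by rewrite -ler_pdivlMr// div1r truncn_le invr_ge0.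
  by rewrite /l -natr1; lra.
have ln : (l < n)%N.
  by rewrite -(ltr_nat R) -(ltr_pM2r Sp) (le_lt_trans lS2).
have [K Kl] : exists K, n = (K.+1 + l)%N.
  by exists (n - l).-1; rewrite prednK ?subn_gt0// subnK// ltnW.
have kn k : (k <= K)%N -> (k.+2 <= n)%N.
  by move=> kK; rewrite Kl /l addnS !addSn !ltnS (leq_trans kK)// leq_addr.
have aK : a K.+1 <= A * (2 / (n%:R * S)) `^ b.
  rewrite (_ : K.+1 = (n - l)%N); last by rewrite Kl addnK.
  rewrite (le_trans (asmall _ (ltnW ln)))// ler_wpM2l//.
  apply: ge0_ler_powR; rewrite ?nnegrE// ?divr_ge0 ?mulr_ge0//.
  by rewrite ler_pdivrMr// invfM mulrA mulrAC mulfVK ?gt_eqF// ler_pdivlMr.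
have main : S * `|even_kernel a n t| <= 3 * a K.+1.
  rewrite -normrM even_kernel_abel an0// mul0r addr0.
  rewrite Kl big_split_ord /= (le_trans (ler_normD _ _))//.
  rewrite (_ : 3 * _ = 2 * a K.+1 + a K.+1); last by ring.
  rewrite lerD//; last first.
    apply: le_trans (ler_norm_sum _ _ _) _.
    rewrite (@le_trans _ _ (\sum_(k < l) (a (K.+1 + k)%N - a (K.+1 + k.+1)%N)))//.
      apply: ler_sum => k _; rewrite normrM -addnS ger0_norm; last first.
        by rewrite subr_ge0 a_homo// leq_add2l.
      by rewrite ler_piMr ?sin_max// subr_ge0 a_homo// leq_add2l.
    by rewrite (telescope_ord (fun k => a (K.+1 + k)%N)) addn0 -Kl [a n]an0// subr0.
  rewrite -(ler_pM2l Sp) (le_trans (sum_odd_sin_variation (fun k => a k - a k.+1) t K))//.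
  rewrite ger0_norm ?subr_ge0//.
  have -> : \sum_(k < K) `|a k - a k.+1 - (a k.+1 - a k.+2)| =
            (a K - a K.+1) - (a 0 - a 1%N).
    rewrite -opprB -(telescope_ord (fun k => a k - a k.+1)) -sumrN.
    by apply: eq_bigr => k _; rewrite ler0_norm// subr_le0 aconc// kn// ltnW.
  have slope : l%:R * (a K - a K.+1) <= a K.+1.
    have step k : (k < l)%N -> a K - a K.+1 <= a (K.+1 + k)%N - a (K.+1 + k.+1)%N.
      elim: k => [_|k IH kl].
        by rewrite addn0 addn1 aconc// kn.
      rewrite (le_trans (IH (ltnW kl)))// !addnS.
      by apply: aconc; rewrite Kl -!addnS leq_add2l.
    rewrite (@le_trans _ _ (\sum_(k < l) (a (K.+1 + k)%N - a (K.+1 + k.+1)%N)))//.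
      rewrite -[l in leLHS]card_ord mulr_natl -sumr_const.
      by apply: ler_sum => k _; exact: step.
    by rewrite (telescope_ord (fun k => a (K.+1 + k)%N)) addn0 -Kl [a n]an0// subr0.
  have d01 : 0 <= a 0%N - a 1%N by rewrite subr_ge0.
  have : a K - a K.+1 <= S * (l%:R * (a K - a K.+1)).
    by rewrite mulrA [S * _]mulrC ler_peMl// subr_ge0.
  have := ler_wpM2l S0 slope.
  lra.
rewrite powRD; last by rewrite mulf_neq0 ?implybT ?gt_eqF.
rewrite powRr1 ?mulr_ge0//.
rewrite (_ : _ * _ * _ = n%:R * (n%:R * S) `^ b * (S * `|even_kernel a n t|)); last by ring.
rewrite (@le_trans _ _ (n%:R * (n%:R * S) `^ b * (3 * (A * (2 / (n%:R * S)) `^ b))))//.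
  rewrite ler_wpM2l ?mulr_ge0 ?powR_ge0// (le_trans main)// ler_pM2l//.
rewrite (_ : _ * _ * _ = 3 * A * n%:R * ((n%:R * S) `^ b * (2 / (n%:R * S)) `^ b)); last by ring.
rewrite -powRM ?divr_ge0 ?mulr_ge0// mulrCA mulfV ?mulr1 ?gt_eqF ?mulr_gt0//.
rewrite (@le_trans _ _ (3 * A * n%:R * 2))//; last first.
  by rewrite -!mulrA; have : 0 <= A * n%:R by [rewrite mulr_ge0]; lra.
by rewrite ler_wpM2l ?mulr_ge0// ler1_powR// ler1n.
Qed.

End Concave.

Section Powers.
Variable R : realType.
Implicit Types (x y g : R).

Lemma powR_le1 x g : 0 <= g -> 0 <= x <= 1 -> x `^ g <= 1.
Proof.
move=> g0 /andP[x0 x1]; rewrite [leRHS](_ : 1 = 1 `^ g); last by rewrite powR1.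
by rewrite ge0_ler_powR ?nnegrE.
Qed.

Lemma powR_midpoint x y g : 1 <= g -> 0 <= x -> 0 <= y ->
  ((x + y) / 2) `^ g <= (x `^ g + y `^ g) / 2.
Proof.
move=> g1 x0 y0.
have -> : (x + y) / 2 = 2^-1 * x + (1 - 2^-1) * y by field.
have -> : (x `^ g + y `^ g) / 2 = 2^-1 * x `^ g + (1 - 2^-1) * y `^ g by field.
have h0 : 0 <= 2^-1 :> R by rewrite invr_ge0.
have h1 : 2^-1 <= 1 :> R by rewrite invf_le1// ler1n.
by apply: (convex_powR g1 (Itv01 h0 h1)); rewrite inE/= in_itv/= andbT.
Qed.

Lemma powR_midpoint_concave x y g : 0 < g <= 1 -> 0 <= x -> 0 <= y ->
  (x `^ g + y `^ g) / 2 <= ((x + y) / 2) `^ g.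
Proof.
move=> /andP[g0 g1] x0 y0.
have gV : 1 <= g^-1 by rewrite invf_ge1.
have := @powR_midpoint (x `^ g) (y `^ g) _ gV (powR_ge0 _ _) (powR_ge0 _ _).
rewrite -!powRrM mulfV ?gt_eqF// !powRr1// => h.
have u0 : 0 <= (x `^ g + y `^ g) / 2 by nonneg.
set u := _ / 2 in h u0 *.
have -> : u = (u `^ g^-1) `^ g by rewrite -powRrM mulVf ?powRr1// gt_eqF.
by apply: ge0_ler_powR; rewrite ?nnegrE ?powR_ge0 ?(ltW g0)//; nonneg.
Qed.

Lemma powR_tangent x g : 1 <= g -> 0 <= x -> 1 + g * (x - 1) <= x `^ g.
Proof.
rewrite le_eqVlt => /predU1P[<-|g1] x0.
  by rewrite powRr1// mul1r addrC subrK.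
have g0 : 0 < g by exact: lt_trans g1.
have q0 : 0 < 1 - g^-1 by rewrite subr_gt0 invf_lt1.
have := @conjugate_powR R x 1 g (1 - g^-1)^-1 x0 ler01 g0.
rewrite invr_gt0 q0 invrK addrCA subrr addr0 powR1 mulr1 mul1r.
move=> /(_ erefl erefl); rewrite -(ler_pM2l g0) mulrDr mulrCA mulfV ?gt_eqF//.
rewrite mulr1 mulrBr mulr1 mulfV ?gt_eqF//; lra.
Qed.

Lemma powR_tangent_midpoint x y g : 1 <= g -> 0 <= x -> 0 <= y ->
  (g * x - x `^ g + (g * y - y `^ g)) / 2 <=
  g * ((x + y) / 2) - ((x + y) / 2) `^ g.
Proof. by move=> g1 x0 y0; have := powR_midpoint g1 x0 y0; lra. Qed.

(** With [powR_tangent_midpoint]: the remainder [g x - x ^ g] is concave and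
    nondecreasing on the unit interval, like the power itself for exponents
    below one. *)
Lemma powR_tangent_homo x y g : 1 <= g -> 0 <= x -> x <= y -> y <= 1 ->
  g * x - x `^ g <= g * y - y `^ g.
Proof.
move=> g1 x0 xy y1; have [y0|y0] := leP y 0.
  by have -> : x = y by apply/eqP; rewrite eq_le xy (le_trans y0).
have yn0 := lt0r_neq0 y0; have y0' := ltW y0.
have /(powR_tangent g1) : 0 <= x / y by rewrite divr_ge0.
have xE : x `^ g = y `^ g * (x / y) `^ g.
  by rewrite -powRM ?divr_ge0// mulrCA mulfV// mulr1.
rewrite -(ler_pM2l (powR_gt0 g y0)) -xE => h.
have yg : y `^ g <= y by rewrite ge1r_powR ?y0.
have : (y - y `^ g) * (x / y - 1) <= 0.
  by rewrite mulr_ge0_le0 ?subr_ge0// subr_le0 ler_pdivrMr// mul1r.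
have -> : (y - y `^ g) * (x / y - 1) = (x - y) - y `^ g * (x / y - 1).
  by field.
rewrite -(pmulr_rle0 _ (lt_le_trans ltr01 g1)) => h2; move: h h2.
by rewrite mulrDr mulr1; move: (x / y - 1) (y `^ g) (x `^ g) => v u w; lra.
Qed.

End Powers.

Section Riesz.
Variable R : realType.
Implicit Types (g al b t : R) (psi : R -> R) (n N k l : nat).

Definition riesz_base g n k : R :=
  if (k <= n)%N then 1 - (k%:R / n%:R) `^ g else 0.

Lemma riesz_base_itv g n k : 0 < g -> 0 <= riesz_base g n k <= 1.
Proof.
move=> g0; rewrite /riesz_base; case: ifP => kn; last by rewrite lexx ler01.
rewrite subr_ge0 lerBlDr lerDl powR_ge0 andbT.
case: n kn => [|n] kn; first by rewrite invr0 mulr0 powR0 ?gt_eqF.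
rewrite powR_le1 ?(ltW g0)// divr_ge0//=.
by rewrite ler_pdivrMr ?ltr0n// mul1r ler_nat.
Qed.

Lemma riesz_base_out g n k : 0 < g -> (n <= k)%N -> (0 < n)%N -> riesz_base g n k = 0.
Proof.
move=> g0 nk n0; rewrite /riesz_base; case: ifP => kn //.
have -> : k = n by apply/eqP; rewrite eqn_leq kn.
by rewrite divff ?pnatr_eq0 -?lt0n// powR1 subrr.
Qed.

(** The concave function [1 - x ^ g] lies below its tangent at [x = 1]. *)
Lemma riesz_base_edge g n l : 1 <= g -> (0 < n)%N -> (l <= n)%N ->
  riesz_base g n (n - l)%N <= g * (l%:R / n%:R).
Proof.
move=> g1 n0 ln; rewrite /riesz_base leq_subr.
have nR : n%:R != 0 :> R by rewrite pnatr_eq0 -lt0n.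
have := @powR_tangent R ((n - l)%:R / n%:R) g g1.
rewrite divr_ge0// => /(_ isT).
have -> : (n - l)%:R / n%:R - 1 = - (l%:R / n%:R) :> R.
  by rewrite natrB// mulrBl mulfV//; ring.
lra.
Qed.

Lemma riesz_base_decr g n k : 0 < g -> riesz_base g n k.+1 <= riesz_base g n k.
Proof.
move=> g0; have [kn|kn] := ltnP k n; last first.
  rewrite {1}/riesz_base leqNgt ltnS kn /=.
  by have /andP[] := riesz_base_itv n k g0.
rewrite /riesz_base kn (ltnW kn) lerD2l lerN2.
by rewrite ge0_ler_powR ?nnegrE ?divr_ge0 ?(ltW g0)// ler_wpM2r ?invr_ge0// ler_nat.
Qed.

Lemma riesz_base_concave g n k : 1 <= g -> (k.+2 <= n)%N ->
  (riesz_base g n k + riesz_base g n k.+2) / 2 <= riesz_base g n k.+1.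
Proof.
move=> g1 kn; rewrite /riesz_base kn (ltnW kn) (ltnW (ltnW kn)).
have := @powR_midpoint R (k%:R / n%:R) (k.+2%:R / n%:R) g g1.
rewrite !divr_ge0// => /(_ isT isT).
have -> : (k%:R / n%:R + k.+2%:R / n%:R) / 2 = k.+1%:R / n%:R :> R.
  by rewrite -[k.+2%:R]natr1 -[k.+1%:R]natr1; field; rewrite pnatr_eq0; case: n kn.
lra.
Qed.

(** A concave nondecreasing function of a concave sequence is concave. *)
Lemma concave_riesz_kernel psi D g b n N t :
  1 <= g -> 0 < b <= 1 -> (0 < n <= N)%N -> 0 <= D ->
  psi 0 = 0 ->
  (forall x y, 0 <= x -> x <= y -> y <= 1 -> psi x <= psi y) ->
  (forall x y, 0 <= x -> 0 <= y -> (psi x + psi y) / 2 <= psi ((x + y) / 2)) ->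
  (forall x, 0 <= x <= 1 -> psi x <= D * x `^ b) ->
  `|even_kernel (fun k => psi (riesz_base g n k)) N t| <=
  48 * (D * g) * bump_weight b n `|sin t|.
Proof.
move=> g1 b01 /andP[n0 nN] D0 psi0 psi_homo psi_mid psi_small.
have g0 : 0 < g by exact: lt_le_trans g1.
have [b0 b1] : 0 <= b /\ b <= 1 by case/andP: b01 => /ltW.
apply: (@concave_kernel _ _ _ b) => //.
- by rewrite n0.
- by rewrite mulr_ge0// ltW.
- by move=> k nk; rewrite riesz_base_out.
- move=> k kn; have := psi_mid (riesz_base g n k) (riesz_base g n k.+2).
  have /andP[h0 _] := riesz_base_itv n k g0; rewrite h0 => /(_ isT).
  have /andP[h2 _] := riesz_base_itv n k.+2 g0; rewrite h2 => /(_ isT).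
  have /andP[_ h1] := riesz_base_itv n k.+1 g0.
  have h3 : 0 <= (riesz_base g n k + riesz_base g n k.+2) / 2.
    by rewrite divr_ge0// addr_ge0.
  have := psi_homo _ _ h3 (riesz_base_concave g1 kn) h1.
  lra.
- move=> k; apply: psi_homo; [|exact: riesz_base_decr|].
    by have /andP[] := riesz_base_itv n k.+1 g0.
  by have /andP[] := riesz_base_itv n k g0.
- move=> l ln; have h := riesz_base_itv n (n - l) g0.
  rewrite (le_trans (psi_small _ h))// -mulrA ler_wpM2l//.
  rewrite (@le_trans _ _ ((g * (l%:R / n%:R)) `^ b))//.
    rewrite ge0_ler_powR ?nnegrE ?mulr_ge0 ?divr_ge0 ?(ltW g0)//.
      by case/andP: h.
    exact: riesz_base_edge.
  rewrite powRM ?divr_ge0 ?(ltW g0)// ler_wpM2r ?powR_ge0//.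
  by rewrite ler1_powR.
Qed.

Definition riesz_weight g al n k : R := riesz_base g n k `^ al.

(** For [al > 1] the power is not concave, but [al x] and [al x - x ^ al]
    are, and both vanish linearly at the edge. *)
Lemma riesz_kernel_bound g al b n N t :
  1 <= g -> 0 < b -> b <= al -> b <= 1 -> (0 < n <= N)%N ->
  `|even_kernel (riesz_weight g al n) N t| <=
  96 * (g * (al + 1)) * bump_weight b n `|sin t|.
Proof.
move=> g1 b0 bal b1 nN; have al0 : 0 < al by exact: lt_le_trans bal.
have g0 : 0 < g by exact: lt_le_trans g1.
have w0 := bump_weight_ge0 b n `|sin t|.
have b01 : 0 < b <= 1 by rewrite b0.
have pow_b (x c : R) : b <= c -> 0 <= x <= 1 -> x `^ c <= x `^ b.
  move=> bc /andP[]; rewrite le_eqVlt => /predU1P[<- _|x0 x1].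
    by rewrite !powR0 ?gt_eqF// (lt_le_trans b0).
  by rewrite ger_powR// x0.
have gal : 0 <= g * al by rewrite mulr_ge0// ltW.
have [al1|al1] := leP al 1.
  apply: (@le_trans _ _ (48 * (1 * g) * bump_weight b n `|sin t|)).
    apply: (@concave_riesz_kernel (fun x => x `^ al)) => //.
    - by rewrite powR0// gt_eqF.
    - move=> x y x0 xy _; rewrite ge0_ler_powR ?nnegrE ?(ltW al0)//.
      exact: le_trans xy.
    - by move=> x y; apply: powR_midpoint_concave; rewrite al0.
    - by move=> x x01; rewrite mul1r; exact: pow_b.
  by rewrite ler_wpM2r//; lra.
have -> : even_kernel (riesz_weight g al n) N t =
  al * even_kernel (fun k => riesz_base g n k) N t -
  even_kernel (fun k => al * riesz_base g n k - riesz_base g n k `^ al) N t.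
  rewrite -even_kernelZ -even_kernelB; congr even_kernel; apply/funext => k.
  by rewrite /riesz_weight; ring.
rewrite (le_trans (ler_normB _ _))//.
apply: (@le_trans _ _ (al * (48 * (1 * g) * bump_weight b n `|sin t|) +
                       48 * (al * g) * bump_weight b n `|sin t|)); last first.
  rewrite mulrA -mulrDl ler_wpM2r//; lra.
apply: lerD.
  rewrite normrM (gtr0_norm al0) ler_pM2l//.
  apply: (@concave_riesz_kernel idfun) => //.
  by move=> x x01; rewrite mul1r -[leLHS]powRr1; [exact: pow_b|case/andP: x01].
apply: (@concave_riesz_kernel (fun x => al * x - x `^ al)) => //.
- exact: ltW.
- by rewrite mulr0 powR0 ?gt_eqF// subr0.
- by move=> x y x0 xy y1; apply: powR_tangent_homo => //; exact: ltW.
- by move=> x y; apply: powR_tangent_midpoint; exact: ltW.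
- move=> x x01; rewrite lerBlDr ler_wpDr ?powR_ge0// ler_pM2l//.
  by rewrite -[leLHS]powRr1; [exact: pow_b|case/andP: x01].
Qed.

Definition triangle n k : R := riesz_base 1 n k.

Lemma triangle_kernel_bound b n N t : 0 < b <= 1 -> (0 < n <= N)%N ->
  `|even_kernel (triangle n) N t| <= 48 * bump_weight b n `|sin t|.
Proof.
move=> b01 nN; rewrite -[48]mulr1 -[X in 48 * X](mulr1 1).
apply: (@concave_riesz_kernel idfun) => // x x01.
rewrite mul1r -[leLHS]powRr1; last by case/andP: x01.
case/andP: x01; rewrite le_eqVlt => /predU1P[<- _|x0 x1].
  by rewrite !powR0 ?gt_eqF//; case/andP: b01.
by rewrite ger_powR ?x0//; case/andP: b01.
Qed.

(** The multiplier of the de la Vallee-Poussin kernel: 1 up to [n], 0 beyond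
    [2 n]. *)
Definition trapezoid n k : R := 2 * triangle (2 * n) k - triangle n k.

Lemma triangleE n k : (k <= n)%N -> triangle n k = 1 - k%:R / n%:R.
Proof. by move=> kn; rewrite /triangle /riesz_base kn powRr1// divr_ge0. Qed.

Lemma trapezoid1 n k : (0 < n)%N -> (k <= n)%N -> trapezoid n k = 1.
Proof.
move=> n0 kn; rewrite /trapezoid !triangleE//; last by lia.
by rewrite natrM; field; rewrite pnatr_eq0 -lt0n.
Qed.

Lemma trapezoid0 n k : (0 < n)%N -> (2 * n <= k)%N -> trapezoid n k = 0.
Proof.
move=> n0 nk; rewrite /trapezoid /triangle !riesz_base_out//; last 2 first.
- by lia.
- by lia.
by rewrite mulr0 subr0.
Qed.

Lemma bump_weight_double b n s : 0 <= b -> 0 <= s ->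
  bump_weight b (2 * n) s <= 2 * bump_weight b n s.
Proof.
move=> b0 s0; rewrite /bump_weight natrM mulrA ler_wpM2l ?mulr_ge0//.
have p1 : 0 < 1 + n%:R * s by rewrite ltr_wpDr ?mulr_ge0.
have p2 : 0 < 1 + 2 * n%:R * s by rewrite ltr_wpDr ?mulr_ge0.
rewrite !powRN lef_pV2 ?posrE ?powR_gt0//.
rewrite ge0_ler_powR ?nnegrE ?(ltW p1) ?(ltW p2) ?addr_ge0//.
by rewrite lerD2l -mulrA ler_peMl ?mulr_ge0// ler1n.
Qed.

Lemma trapezoid_kernel_bound b n N t : 0 < b <= 1 -> (0 < n)%N -> (2 * n <= N)%N ->
  `|even_kernel (trapezoid n) N t| <= 240 * bump_weight b n `|sin t|.
Proof.
move=> b01 n0 nN; rewrite /trapezoid (even_kernelB (fun k => 2 * triangle (2 * n) k)).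
rewrite even_kernelZ (le_trans (ler_normB _ _))// normrM ger0_norm//.
have b0 : 0 <= b by case/andP: b01 => /ltW.
have h1 : `|even_kernel (triangle n) N t| <= 48 * bump_weight b n `|sin t|.
  by apply: triangle_kernel_bound; lia.
have h2 : `|even_kernel (triangle (2 * n)) N t| <= 48 * bump_weight b (2 * n) `|sin t|.
  by apply: triangle_kernel_bound; lia.
have := @bump_weight_double b n `|sin t| b0 (normr_ge0 _); lra.
Qed.

End Riesz.

Lemma even_kernel_support (R : realType) (a : nat -> R) n N t : (n <= N)%N ->
  (forall k, (n < k)%N -> a k = 0) -> even_kernel a N t = even_kernel a n t.
Proof.
move=> nN an0; rewrite /even_kernel; congr (_ + _).
rewrite -(subnKC nN) big_split_ord /= [X in _ + X]big1 ?addr0// => k _.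
by rewrite an0 ?mulr0 ?mul0r// ltnS leq_addr.
Qed.

Section Gauss.
Variable R : realType.
Implicit Types (r b t : R) (n N k : nat).

Definition gauss r k : R := expR (- (r * k%:R) ^+ 2).

Lemma gauss_ge0 r k : 0 <= gauss r k.
Proof. exact: expR_ge0. Qed.

Lemma gauss0 r : gauss r 0 = 1.
Proof. by rewrite /gauss mulr0 expr0n/= oppr0 expR0. Qed.

Lemma gauss_le1 r k : gauss r k <= 1.
Proof. by rewrite /gauss -expR0 ler_expR oppr_le0 sqr_ge0. Qed.

Lemma one_sub_expRN_le (x : R) : 1 - expR (- x) <= x.
Proof. by have := expR_ge1Dx (- x); lra. Qed.

Lemma gauss_ratio r k :
  gauss r k.+1 = gauss r k * expR (- (r ^+ 2 * (2 * k + 1)%:R)).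
Proof.
rewrite /gauss -expRD; congr expR.
by rewrite -[k.+1%:R]natr1 natrD natrM; ring.
Qed.

Lemma gauss_decr r k : gauss r k.+1 <= gauss r k.
Proof.
rewrite gauss_ratio ler_piMr ?gauss_ge0// -expR0 ler_expR oppr_le0.
by rewrite mulr_ge0 ?sqr_ge0.
Qed.

Lemma gauss_step r k :
  gauss r k - gauss r k.+1 <= gauss r k * (r ^+ 2 * (2 * k + 1)%:R).
Proof.
rewrite gauss_ratio; have := one_sub_expRN_le (r ^+ 2 * (2 * k + 1)%:R).
move=> /(ler_wpM2l (gauss_ge0 r k)); lra.
Qed.

(** The logarithm of [gauss] being quadratic, a second difference costs
    [r ^ 2] times the value, or [r ^ 2 k] times a first difference; the latter
    is summable after one more summation by parts ([gauss_variation]). *)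
Lemma gauss_second_diff r k : `|gauss r k - 2 * gauss r k.+1 + gauss r k.+2| <=
  2 * r ^+ 2 * gauss r k + r ^+ 2 * (2 * k + 3)%:R * (gauss r k - gauss r k.+1).
Proof.
have s0 : 0 <= r ^+ 2 by exact: sqr_ge0.
pose e j := expR (- (r ^+ 2 * (2 * j + 1)%:R)).
have -> : gauss r k - 2 * gauss r k.+1 + gauss r k.+2 =
  gauss r k * (e k.+1 - e k) + (gauss r k - gauss r k.+1) * (1 - e k.+1).
  by rewrite (gauss_ratio r k.+1) (gauss_ratio r k) -/(e k) -/(e k.+1); ring.
have eE : e k.+1 = e k * expR (- (2 * r ^+ 2)).
  by rewrite /e -expRD; congr expR; rewrite !natrD !natrM -[k.+1%:R]natr1; ring.
have e0 : 0 <= e k by exact: expR_ge0.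
have e1 : e k <= 1 by rewrite /e -expR0 ler_expR oppr_le0 mulr_ge0.
have e1' : e k.+1 <= 1 by rewrite /e -expR0 ler_expR oppr_le0 mulr_ge0.
have g0 := gauss_ge0 r k.
apply: le_trans (ler_normD _ _) _; apply: lerD.
  rewrite normrM ger0_norm// mulrC ler_wpM2r//.
  rewrite distrC ger0_norm; last first.
    rewrite subr_ge0 eE ler_piMr// -[leRHS]expR0 ler_expR; lra.
  rewrite eE -[X in X - _]mulr1 -mulrBr.
  have := one_sub_expRN_le (2 * r ^+ 2).
  have : expR (- (2 * r ^+ 2)) <= 1 by rewrite -[leRHS]expR0 ler_expR; lra.
  by move: (expR _) => u u1 h; nra.
rewrite normrM ger0_norm; last by rewrite subr_ge0 gauss_decr.
rewrite mulrC ler_wpM2r ?subr_ge0 ?gauss_decr//.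
rewrite ger0_norm ?subr_ge0// (le_trans (one_sub_expRN_le _))//.
by rewrite ler_wpM2l// ler_nat; lia.
Qed.

Lemma gauss_sum r N : 0 < r -> \sum_(k < N) gauss r k.+1 <= 2 / r.
Proof.
move=> r0.
suff : \sum_(k < N) gauss r k.+1 <= 2 / r - 2 / (r * (1 + r * N%:R)).
  move=> /le_trans; apply; rewrite gerBl divr_ge0// mulr_ge0 ?ltW//.
  by rewrite ltr_wpDr// mulr_ge0// ltW.
elim: N => [|N IH]; first by rewrite big_ord0 mulr0 addr0 mulr1 subrr.
rewrite big_ord_recr /=.
have -> : 2 / r - 2 / (r * (1 + r * N.+1%:R)) = 2 / r - 2 / (r * (1 + r * N%:R)) +
    2 / ((1 + r * N%:R) * (1 + r * N.+1%:R)).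
  have y0 : 0 <= r * N%:R by rewrite mulr_ge0// ltW.
  have y1 : 0 <= r * N.+1%:R by rewrite mulr_ge0// ltW.
  rewrite -[N.+1%:R]natr1 in y1 *; field; apply/and3P; split; rewrite gt_eqF//; lra.
apply: lerD => //; rewrite /gauss expRN.
set y := r * N%:R; set x := r * N.+1%:R.
have y0 : 0 <= y by rewrite mulr_ge0// ltW.
have xy : y <= x by rewrite ler_wpM2l ?(ltW r0)// ler_nat.
rewrite -[leLHS]mul1r ler_pdivrMr ?expR_gt0// mulrAC ler_pdivlMr; last first.
  by rewrite mulr_gt0//; lra.
rewrite mul1r (@le_trans _ _ ((1 + x) * (1 + x)))//; first by rewrite ler_wpM2r//; lra.
by have := expR_ge1Dx (x ^+ 2); have := sqr_ge0 (1 - x); nra.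
Qed.

Lemma gauss_kernel_sup r N t : 0 < r ->
  `|even_kernel (gauss r) N t| <= 1 + 4 / r.
Proof.
move=> r0; rewrite (le_trans (even_kernel_bound _ _ _))// gauss0 normr1 lerD2l.
rewrite (_ : 4 / r = 2 * (2 / r)); last by field; rewrite gt_eqF.
rewrite ler_pM2l// (le_trans _ (gauss_sum N r0))// ler_sum// => k _.
by rewrite ger0_norm ?gauss_ge0.
Qed.

Lemma gauss_variation r N : 0 < r ->
  \sum_(k < N) `|gauss r k - 2 * gauss r k.+1 + gauss r k.+2| <=
  r ^+ 2 * (5 + 8 / r).
Proof.
move=> r0; have s0 : 0 <= r ^+ 2 by exact: sqr_ge0.
apply: le_trans (ler_sum _ (fun (k : 'I_N) _ => gauss_second_diff r k)) _.
rewrite big_split /= -mulr_sumr.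
under [X in _ + X]eq_bigr do rewrite -mulrA.
rewrite -mulr_sumr [2 * _]mulrC -mulrA -mulrDr ler_wpM2l//.
have sum1 : \sum_(k < N) gauss r k <= 1 + 2 / r.
  case: (N) => [|m].
    by rewrite big_ord0 addr_ge0// divr_ge0// ltW.
  by rewrite big_ord_recl gauss0 lerD2l; exact: gauss_sum.
have sum2 m : \sum_(k < m) (2 * k + 3)%:R * (gauss r k - gauss r k.+1) <=
    3 + 2 * \sum_(k < m) gauss r k.+1 - (2 * m + 3)%:R * gauss r m.
  elim: m => [|m IH].
    by rewrite !big_ord0 gauss0 mulr0 addr0 mulr1 subrr.
  rewrite !big_ord_recr /=; move: IH; set A := \sum_(k < m) _.
  set B := \sum_(k < m) _ => IH.
  rewrite (_ : (2 * m.+1 + 3)%:R = (2 * m + 3)%:R + 2); last first.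
    by rewrite -natrD; congr (_%:R); lia.
  lra.
have := sum2 N; have := gauss_sum N r0.
have : 0 <= (2 * N + 3)%:R * gauss r N by rewrite mulr_ge0// gauss_ge0.
have -> : 8 / r = 4 * (2 / r) by field; rewrite gt_eqF.
move: sum1; set A := \sum_(k < N) _; set B := \sum_(k < N) _.
by set D := \sum_(k < N) gauss r k.+1; lra.
Qed.

Lemma gauss_kernel_variation r N t : 0 < r -> (0 < N)%N ->
  sin ((2 * N + 1)%:R * t) = 0 ->
  sin t ^+ 2 * `|even_kernel (gauss r) N t| <= 11 * r ^+ 2 + 16 * r.
Proof.
move=> r0; case: N => // N _ tN.
apply: le_trans (even_kernel_variation (or_introl tN)) _.
have Vb := gauss_variation N r0; move: Vb; set V : R := \sum_(k < N) _ => Vb.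
have d0 : `|gauss r 0 - gauss r 1| <= r ^+ 2.
  rewrite ger0_norm ?subr_ge0 ?gauss_decr// (le_trans (gauss_step _ _))//.
  by rewrite gauss0 mul1r muln0 add0n mulr1.
have step : `|gauss r N - gauss r N.+1| <= r ^+ 2 + V.
  apply: (@le_trans _ _ (`|gauss r 0 - gauss r 1| + V)); last by rewrite lerD2r.
  rewrite -lerBlDl (le_trans (lerB_dist _ _))// distrC.
  rewrite -(telescope_ord (fun k => gauss r k - gauss r k.+1) N).
  rewrite (le_trans (ler_norm_sum _ _ _))//; apply: ler_sum => k _.
  by rewrite le_eqVlt; apply/orP; left; apply/eqP; congr (`|_|); ring.
rewrite (_ : 11 * r ^+ 2 + 16 * r = r ^+ 2 + 2 * (r ^+ 2 * (5 + 8 / r))).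
  lra.
by field; rewrite gt_eqF.
Qed.

(** The periodized heat kernel.  The hypothesis on [t] says that [t] is half an
    angle of the grid of [2 N + 1] points, so that the sequence, continued
    periodically, has no jump of slope other than the one at [N]. *)
Lemma gauss_kernel_bound r b n N t : 0 < r -> 0 < b <= 1 -> (0 < n)%N ->
  (0 < N)%N -> sin ((2 * N + 1)%:R * t) = 0 ->
  `|even_kernel (gauss r) N t| <=
  108 * ((r * n%:R)^-1 + (r * n%:R) `^ b) * bump_weight b n `|sin t|.
Proof.
move=> r0 /andP[b0 b1] n0 N0 tN; have b'0 := ltW b0; have r'0 := ltW r0.
have := gauss_kernel_sup N t r0; have := gauss_kernel_variation r0 N0 tN.
have : 0 <= `|even_kernel (gauss r) N t| by exact: normr_ge0.
rewrite -(real_normK (num_real (sin t))).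
have : `|sin t| <= 1 by exact: sin_max.
have : 0 <= `|sin t| by exact: normr_ge0.
move: `|sin t| `|even_kernel _ _ _| => /= S K S0 S1 K0 K2 K1.
have nR : 1 <= n%:R :> R by rewrite ler1n.
have nR0 : 0 < n%:R :> R by rewrite ltr0n.
have rn0 : 0 < r * n%:R by rewrite mulr_gt0.
have rn'0 := ltW rn0; have nR'0 := ltW nR0.
have rnV : 0 <= (r * n%:R)^-1 by rewrite invr_ge0.
have rnb : 0 <= (r * n%:R) `^ b by exact: powR_ge0.
have nS0 : 0 <= n%:R * S by rewrite mulr_ge0.
have VnE : (r * n%:R)^-1 * n%:R = r^-1 by field; rewrite !gt_eqF.
rewrite (_ : 108 = 4 * 27); last by rewrite -natrM.
rewrite -[4 * 27 * _]mulrA.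
have [r1|r1] := leP 1 r.
  have K5 : K <= 5.
    rewrite (le_trans K1)// (_ : 5 = 1 + 4); last by ring.
    rewrite lerD2l ler_pdivrMr//; lra.
  have nb : n%:R `^ b <= (r * n%:R) `^ b.
    by rewrite ge0_ler_powR ?nnegrE// ler_peMl.
  have nb1 : 1 <= n%:R `^ b by rewrite -[leLHS](powRr0 n%:R) ler_powR.
  apply: le_bump_weight => //; first by rewrite b'0.
  - by rewrite mulr_ge0// addr_ge0.
  - rewrite -mulrA (le_trans K5)//.
    have : 1 * 1 <= ((r * n%:R)^-1 + (r * n%:R) `^ b) * n%:R.
      by rewrite ler_pM//; lra.
    lra.
  - move=> _; rewrite (@le_trans _ _ (n%:R `^ (1 + b) * 5))//.
      rewrite ler_pM ?powR_ge0// ge0_ler_powR ?nnegrE ?addr_ge0//.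
      by rewrite ler_piMr.
    rewrite powRD ?(gt_eqF nR0) ?implybT// powRr1//.
    have : n%:R * n%:R `^ b <= n%:R * (r * n%:R) `^ b by rewrite ler_wpM2l.
    have : 0 <= (r * n%:R)^-1 * n%:R by rewrite mulr_ge0.
    have : 0 <= n%:R * (r * n%:R) `^ b by rewrite mulr_ge0.
    lra.
have K1' : r * K <= 5.
  have := ler_wpM2l r'0 K1; rewrite mulrDr mulr1 [r * (4 / r)]mulrC mulfVK ?gt_eqF//.
  lra.
have K2' : S ^+ 2 * K <= 27 * r.
  have : r ^+ 2 <= r by rewrite expr2 ler_piMl// ltW.
  lra.
have BnE : 27 * ((r * n%:R)^-1 + (r * n%:R) `^ b) * n%:R =
    27 * (r^-1 + (r * n%:R) `^ b * n%:R) by rewrite -VnE; ring.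
apply: le_bump_weight => //; first by rewrite b'0.
- by rewrite mulr_ge0// addr_ge0.
- rewrite BnE; have : 0 <= (r * n%:R) `^ b * n%:R by rewrite mulr_ge0.
  have : K <= 5 / r by rewrite ler_pdivlMr// mulrC.
  have : 0 <= r^-1 by rewrite invr_ge0.
  lra.
move=> nS; rewrite BnE.
have rnbn : 0 <= (r * n%:R) `^ b * n%:R by rewrite mulr_ge0.
have rV : 0 <= r^-1 by rewrite invr_ge0.
have b2 : 0 <= 1 + b by rewrite addr_ge0.
have [rn1|rn1] := leP (r * n%:R) 1.
  apply: (@le_trans _ _ (27 / r)); last lra.
  rewrite (@le_trans _ _ ((n%:R * S) ^+ 2 * K))//.
    rewrite ler_wpM2r// -powR_mulrn// ler_powR//; lra.
  rewrite exprMn -mulrA (@le_trans _ _ (n%:R ^+ 2 * (27 * r)))//.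
    by rewrite ler_wpM2l ?exprn_ge0.
  rewrite ler_pdivlMr// (_ : _ * _ * _ = 27 * (r * n%:R) ^+ 2); last by ring.
  by rewrite ger_pMr// expr_le1.
have rnE : (r * n%:R) `^ (1 + b) = (r * n%:R) `^ b * n%:R * r.
  by rewrite powRD ?(gt_eqF rn0) ?implybT// powRr1//; ring.
have [Sr|Sr] := leP S r.
  apply: (@le_trans _ _ ((r * n%:R) `^ (1 + b) * K)).
    rewrite ler_wpM2r// ge0_ler_powR ?nnegrE//.
    by rewrite [leRHS]mulrC ler_wpM2l.
  rewrite rnE -mulrA; have := ler_wpM2l rnbn K1'; lra.
have S'0 : 0 < S by exact: lt_trans Sr.
have -> : (n%:R * S) `^ (1 + b) * K =
    n%:R `^ (1 + b) * S `^ (b - 1) * (S ^+ 2 * K).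
  rewrite powRM// (_ : 1 + b = (b - 1) + 2%:R) ?(natrD _ 1 1); last by ring.
  rewrite [S `^ (_ + _)]powRD ?(gt_eqF S'0) ?implybT//.
  by rewrite -(powR_mulrn 2 S0) !mulrA.
apply: (@le_trans _ _ (n%:R `^ (1 + b) * r `^ (b - 1) * (27 * r))).
  apply: ler_pM => //; rewrite ?mulr_ge0 ?powR_ge0 ?exprn_ge0//.
  rewrite ler_wpM2l ?powR_ge0//.
  rewrite -(opprK (b - 1)) !(powRN _ (- _)) lef_pV2 ?posrE ?powR_gt0//.
  by rewrite ge0_ler_powR ?nnegrE ?(ltW Sr)// opprB subr_ge0.
have -> : n%:R `^ (1 + b) * r `^ (b - 1) * (27 * r) =
    27 * ((r * n%:R) `^ b * n%:R).
  rewrite [n%:R `^ (1 + b)]powRD ?(gt_eqF nR0) ?implybT// powRr1// powRM//.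
  rewrite -(mulr_powRB1 r'0 b0); ring.
lra.
Qed.

Lemma triangle_gauss_second_diff r m k : (k.+2 <= m)%N -> r * m%:R <= 2 -> 0 < r ->
  `|(1 - k%:R / m%:R) * (1 - gauss r k) -
    2 * ((1 - k.+1%:R / m%:R) * (1 - gauss r k.+1)) +
    (1 - k.+2%:R / m%:R) * (1 - gauss r k.+2)| <= 22 * r ^+ 2.
Proof.
move=> km rm r0; have m0 : 0 < m%:R :> R by rewrite ltr0n; case: m km {rm}.
have r'0 := ltW r0; have s0 : 0 <= r ^+ 2 by exact: sqr_ge0.
have rk j : (j <= m)%N -> 0 <= r * j%:R <= 2.
  move=> jm; rewrite mulr_ge0//= (le_trans _ rm)// ler_wpM2l// ler_nat//.
have -> : (1 - k%:R / m%:R) * (1 - gauss r k) -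
    2 * ((1 - k.+1%:R / m%:R) * (1 - gauss r k.+1)) +
    (1 - k.+2%:R / m%:R) * (1 - gauss r k.+2) =
    - ((1 - k.+1%:R / m%:R) * (gauss r k - 2 * gauss r k.+1 + gauss r k.+2)) -
    m%:R^-1 * ((gauss r k - gauss r k.+1) + (gauss r k.+1 - gauss r k.+2)).
  by rewrite -[k.+2%:R]natr1 -[k.+1%:R]natr1; field; rewrite gt_eqF.
rewrite (le_trans (ler_normB _ _))// normrN !normrM.
have q0 : 0 <= k.+1%:R / m%:R :> R by rewrite divr_ge0// ltW.
have q1 : k.+1%:R / m%:R <= 1 :> R by rewrite ler_pdivrMr// mul1r ler_nat; lia.
have stepb j : (j.+2 <= m.+1)%N -> 0 <= gauss r j - gauss r j.+1 <= 2 * r ^+ 2 * m%:R.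
  move=> jm; rewrite subr_ge0 gauss_decr/= (le_trans (gauss_step _ _))//.
  rewrite (le_trans (ler_piMl _ (gauss_le1 _ _))) ?mulr_ge0//.
  rewrite (_ : 2 * r ^+ 2 * _ = r ^+ 2 * (2 * m%:R)); last by ring.
  by rewrite ler_wpM2l// -natrM ler_nat; lia.
have := stepb k; have := stepb k.+1; rewrite ltnS km ltnS (ltnW km).
move=> /(_ isT) /andP[d0 d1] /(_ isT) /andP[d2 d3].
rewrite (_ : 22 * _ = 18 * r ^+ 2 + 4 * r ^+ 2); last by ring.
apply: lerD.
  rewrite ger0_norm ?subr_ge0// (le_trans (ler_piMl _ _)) ?lerBlDr ?lerDl//.
  rewrite (le_trans (gauss_second_diff _ _))//.
  rewrite (_ : 18 * _ = 2 * r ^+ 2 + r ^+ 2 * 16); last by ring.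
  apply: lerD; first by rewrite ler_piMr ?mulr_ge0// gauss_le1.
  rewrite -mulrA ler_wpM2l//.
  have -> : 16 = 4 * 2 * 2 :> R by ring.
  apply: (@le_trans _ _ ((2 * m%:R) * (2 * r ^+ 2 * m%:R))).
    apply: ler_pM => //; rewrite -natrM ler_nat.
    by clear -km; lia.
  have -> : 2 * m%:R * (2 * r ^+ 2 * m%:R) = 4 * (r * m%:R) ^+ 2 by ring.
  rewrite -mulrA ler_wpM2l//; have /andP[] := rk m (leqnn _); move: (r * m%:R) => u; nra.
rewrite ger0_norm ?invr_ge0 ?(ltW m0)// ger0_norm; last exact: addr_ge0.
rewrite ler_pdivrMl//; lra.
Qed.

(** On frequencies below [m <= 2 / r] the heat kernel is close to the
    identity, with an error of second order in [r m]. *)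
Lemma triangle_gauss_kernel r b m N t : 0 < r -> 0 < b <= 1 ->
  (0 < m <= N)%N -> r * m%:R <= 2 ->
  `|even_kernel (fun k => triangle R m k * (1 - gauss r k)) N t| <=
  92 * (r * m%:R) ^+ 2 * bump_weight b m `|sin t|.
Proof.
case: m => // m r0 /andP[b0 b1] /andP[_ mN] rm.
have r'0 := ltW r0; have mR : 0 < m.+1%:R :> R by rewrite ltr0n.
have mR1 : 1 <= m.+1%:R :> R by rewrite ler1n.
set a := fun k => _.
have am k : (m < k)%N -> a k = 0.
  by move=> mk; rewrite /a /triangle riesz_base_out// mul0r.
have B0 : 0 <= (r * m.+1%:R) ^+ 2 by exact: sqr_ge0.
have asmall k : `|a k| <= (r * m.+1%:R) ^+ 2.
  have [mk|km] := leqP m.+1 k; first by rewrite am// normr0.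
  have /andP[t0 t1] := @riesz_base_itv R 1 m.+1 k ltr01.
  rewrite normrM !ger0_norm ?subr_ge0 ?gauss_le1//.
  rewrite (le_trans (ler_piMl _ t1)) ?subr_ge0 ?gauss_le1//.
  rewrite (le_trans (one_sub_expRN_le _))//.
  by rewrite lerXn2r ?nnegrE ?mulr_ge0// ler_wpM2l// ler_nat ltnW.
rewrite (even_kernel_support _ mN); last by move=> k /ltnW /am.
have a0 : a 0%N = 0 by rewrite /a gauss0 subrr mulr0.
have K1 : `|even_kernel a m.+1 t| <= 2 * (r * m.+1%:R) ^+ 2 * m.+1%:R.
  rewrite (le_trans (even_kernel_bound _ _ _))// a0 normr0 add0r -mulrA ler_wpM2l//.
  rewrite (le_trans (ler_sum _ (fun (k : 'I_m.+1) _ => asmall k.+1)))//.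
  by rewrite sumr_const card_ord [leRHS]mulr_natr.
have K2 : sin t ^+ 2 * `|even_kernel a m.+1 t| <= 23 * (r * m.+1%:R) ^+ 2 / m.+1%:R.
  apply: le_trans (even_kernel_variation (or_intror (am m.+1 (leqnn _)))) _.
  rewrite [a m.+1]am// subr0.
  rewrite (_ : 23 * (r * m.+1%:R) ^+ 2 / m.+1%:R =
     (r * m.+1%:R) ^+ 2 / m.+1%:R + m.+1%:R * (22 * r ^+ 2)); last first.
    by field; rewrite gt_eqF.
  apply: lerD.
    rewrite normrM /triangle -/(triangle R m.+1 m) triangleE//.
    have -> : 1 - m%:R / m.+1%:R = m.+1%:R^-1 :> R.
      by rewrite -[m.+1%:R]natr1; field; rewrite natr1 gt_eqF.
    rewrite ger0_norm ?invr_ge0 ?(ltW mR)// mulrC ler_wpM2r ?invr_ge0 ?(ltW mR)//.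
    rewrite ger0_norm ?subr_ge0 ?gauss_le1// (le_trans (one_sub_expRN_le _))//.
    by rewrite lerXn2r ?nnegrE ?mulr_ge0// ler_wpM2l// ler_nat.
  apply: (@le_trans _ _ (\sum_(k < m) 22 * r ^+ 2)).
    apply: ler_sum => k _; rewrite /a !triangleE; last 3 first.
    - by move: (ltn_ord k); clear; lia.
    - by move: (ltn_ord k); clear; lia.
    - by move: (ltn_ord k); clear; lia.
    by apply: triangle_gauss_second_diff => //; exact: ltn_ord.
  rewrite sumr_const card_ord -[leLHS]mulr_natl ler_wpM2r ?mulr_ge0 ?sqr_ge0// ler_nat//.
rewrite (_ : 92 * (r * m.+1%:R) ^+ 2 = 4 * (23 * (r * m.+1%:R) ^+ 2)); last by ring.
apply: le_bump_weight => //; first by rewrite (ltW b0).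
- by rewrite mulr_ge0.
- rewrite (le_trans K1)// ler_wpM2r ?(ltW mR)// ler_wpM2r//; lra.
move=> mS; apply: (@le_trans _ _ ((m.+1%:R * `|sin t|) ^+ 2 * `|even_kernel a m.+1 t|)).
  rewrite ler_wpM2r// -powR_mulrn ?(le_trans _ mS)// ler_powR//; lra.
rewrite exprMn real_normK ?num_real// -mulrA.
apply: le_trans (ler_wpM2l (sqr_ge0 _) K2) _.
rewrite (_ : m.+1%:R ^+ 2 * _ = 23 * (r * m.+1%:R) ^+ 2 * m.+1%:R)//.
by field; rewrite gt_eqF.
Qed.

End Gauss.

(** * Averages over the grid and the strong maximal operator *)

Section WeightedErgodic.
Variables (R : realType) (X : finType) (T : X -> X).

(** A decreasing weight is a superposition of uniform ones. *)
Lemma ergodic_max_weighted (w : nat -> R) (g : X -> R) K x :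
  (forall n, w n.+1 <= w n) -> (forall n, 0 <= w n) ->
  \sum_(n < K) w n * g (iter n T x) <=
  (\sum_(n < K) w n) * ergodic_max T g K x.
Proof.
move=> wd w0; set M := ergodic_max T g K x.
have step n : (n <= K)%N ->
    \sum_(j < n) w j * g (iter j T x) - w n * ergodic_sum T g n x <=
    M * (\sum_(j < n) w j - n%:R * w n).
  elim: n => [|n IH] nK.
    by rewrite !big_ord0 ergodic_sum0 mul0r mulr0 subrr mulr0.
  have := IH (ltnW nK); rewrite !big_ord_recr /=.
  have -> : ergodic_sum T g n.+1 x = ergodic_sum T g n x + g (iter n T x).
    by rewrite /ergodic_sum big_ord_recr.
  have : (w n - w n.+1) * ergodic_sum T g n.+1 x <= (w n - w n.+1) * (n.+1%:R * M).
    by rewrite ler_wpM2l ?subr_ge0// ergodic_sum_le_max.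
  rewrite {1}/ergodic_sum big_ord_recr /= -/(ergodic_sum T g n x) -natr1.
  move: (g _) (ergodic_sum _ _ _ _) (\sum_(i < n) w i) (\sum_(i < n) _).
  by move=> G E A B; lra.
have := step K (leqnn _); rewrite mulrBr.
have : w K * ergodic_sum T g K x <= w K * (K%:R * M).
  by rewrite ler_wpM2l// ergodic_sum_le_max.
move: (\sum_(i < K) w i) (\sum_(i < K) _) => A B; lra.
Qed.

End WeightedErgodic.

Section BumpSum.
Variable R : realType.
Implicit Types (e h s u v : R).

Lemma ln_le_sub1 u : 0 < u -> ln u <= u - 1.
Proof.
move=> u0; rewrite -ler_expR lnK ?posrE// (le_trans _ (expR_ge1Dx _))//.
by rewrite addrC subrK.
Qed.

(** Comparison of a rectangle with the integral of a decreasing power, whose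
    primitive is known. *)
Lemma powR_integral_bound e u h : 0 < e -> 0 < u -> 0 <= h ->
  e * (h * (u + h) `^ (- (1 + e))) <= u `^ (- e) - (u + h) `^ (- e).
Proof.
move=> e0 u0 h0; set v := u + h; have v0 : 0 < v by rewrite ltr_wpDr.
have lnuv : h / v <= ln (v / u).
  have := @ln_le_sub1 (u / v); rewrite divr_gt0// => /(_ isT).
  rewrite -(invf_div v u) lnV ?posrE ?divr_gt0//.
  have -> : h / v = 1 - u / v by rewrite /v; field; rewrite gt_eqF.
  by rewrite invf_div; lra.
have : 1 + e * (h / v) <= (v / u) `^ e.
  rewrite /powR gt_eqF ?divr_gt0// (le_trans _ (expR_ge1Dx _))//.
  by rewrite lerD2l ler_pM2l.
rewrite powRM ?invr_ge0 ?(ltW v0) ?(ltW u0)// => H.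
have ve0 : 0 < v `^ (- e) by rewrite powR_gt0.
have uE : (u^-1) `^ e = u `^ (- e).
  by rewrite -(powR_inv1 (ltW u0)) -powRrM mulN1r.
have vE : v `^ e * v `^ (- e) = 1.
  by rewrite -powRD ?subrr ?powRr0// ?eqxx/= ?gt_eqF.
have -> : v `^ (- (1 + e)) = v^-1 * v `^ (- e).
  by rewrite opprD powRD ?(gt_eqF v0) ?implybT// powR_inv1// ltW.
have := ler_wpM2l (ltW ve0) H.
rewrite [v `^ (- e) * (v `^ e * _)]mulrCA [v `^ e * _]mulrA vE mul1r uE; lra.
Qed.

Lemma bump_weight_sum e n L : 0 < e -> (0 < n <= L)%N ->
  L%:R^-1 * \sum_(a < L) bump_weight e n (a%:R / L%:R : R) <= 1 + e^-1.
Proof.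
move=> e0 /andP[n0 nL]; have L0 : 0 < L%:R :> R by rewrite ltr0n (leq_trans n0).
case: L nL L0 => [|L] nL L0; first by rewrite ltxx in L0.
set h : R := n%:R / L.+1%:R.
have h0 : 0 <= h by rewrite divr_ge0.
have h1 : h <= 1 by rewrite ler_pdivrMr// mul1r ler_nat.
have hE a : L.+1%:R^-1 * bump_weight e n (a%:R / L.+1%:R) =
    h * (1 + a%:R * h) `^ (- (1 + e)).
  rewrite /bump_weight mulrA [_^-1 * _]mulrC -/h; congr (_ * (1 + _) `^ _).
  by rewrite /h; ring.
rewrite mulr_sumr big_ord_recl hE mul0r addr0 powR1 mulr1 lerD//.
rewrite (@le_trans _ _ (\sum_(a < L) e^-1 * ((1 + a%:R * h) `^ (- e) -
    (1 + a.+1%:R * h) `^ (- e))))//.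
  apply: ler_sum => a _; rewrite lift0 hE ler_pdivlMl//.
  have -> : 1 + a.+1%:R * h = (1 + a%:R * h) + h by rewrite -natr1; ring.
  by apply: powR_integral_bound => //; rewrite ltr_wpDr// mulr_ge0.
rewrite -mulr_sumr (telescope_ord (fun a => (1 + a%:R * h) `^ (- e))).
rewrite mul0r addr0 powR1 ler_piMr ?invr_ge0 ?(ltW e0)//.
by rewrite lerBlDr lerDl powR_ge0.
Qed.

Lemma bump_weight_homo e n s u : 0 < e -> 0 <= s -> s <= u ->
  bump_weight e n u <= bump_weight e n s.
Proof.
move=> e0 s0 su; rewrite /bump_weight ler_wpM2l// !powRN.
have p1 : 0 < 1 + n%:R * s by rewrite ltr_wpDr// mulr_ge0.
have su' : 1 + n%:R * s <= 1 + n%:R * u by rewrite lerD2l ler_wpM2l.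
rewrite lef_pV2 ?posrE ?powR_gt0 ?(lt_le_trans p1)//.
apply: ge0_ler_powR; rewrite ?nnegrE ?(ltW p1)//; first lra.
by rewrite (le_trans (ltW p1)).
Qed.

(** A crude form of the concavity of the sine. *)
Lemma sin_ge_linear u : 0 <= u <= pi / 2 -> u / pi <= sin u.
Proof.
move=> /andP[u0 u1]; have p0 := @pi_gt0 R.
rewrite leNgt; apply/negP => su.
have u'0 : 0 < u.
  by rewrite lt_neqAle u0 andbT; apply: contraTneq su => <-; rewrite mul0r sin0 ltxx.
have u'1 : u < pi / 2.
  rewrite lt_neqAle u1 andbT; apply: contraTneq su => ->.
  by rewrite sin_pihalf -leNgt ler_pdivrMr//; lra.
have d (x : R) : is_derive x 1 sin (cos x) by exact: is_derive_sin.
have cts (a b : R) : {within `[a, b], continuous (@sin R)}.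
  by apply: continuous_subspaceT => x; exact: continuous_sin.
have [c1] := @MVT _ sin cos 0 u u'0 (fun x _ => d x) (cts _ _).
rewrite in_itv/= sin0 !subr0 => /andP[c10 c1u] E1.
have [c2] := @MVT _ sin cos u (pi / 2) u'1 (fun x _ => d x) (cts _ _).
rewrite in_itv/= sin_pihalf => /andP[c2u c2p] E2.
have : cos c2 < cos c1.
  by rewrite ltr_cos ?in_itv/= ?(lt_trans c1u)//; apply/andP; split; lra.
have B1 : cos c1 * pi < 1.
  by rewrite -(ltr_pM2r u'0) mul1r mulrAC -E1 -ltr_pdivlMr.
have w0 : 0 < pi / 2 - u by rewrite subr_gt0.
have B2 : 1 < cos c2 * pi.
  rewrite -(ltr_pM2r w0) mul1r mulrAC -E2 -ltr_pdivrMr//.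
  rewrite mulrBl mulrAC divff ?gt_eqF//.
  by move: su; move: (u / pi) => v; lra.
by rewrite -(ltr_pM2r p0) => /(lt_trans B2) /(lt_trans B1); rewrite ltxx.
Qed.

End BumpSum.

Section Grid.
Variables (R : realType) (d N : nat).
Local Notation L := (2 * N).+1.
Local Notation X := {ffun 'I_d -> 'I_L}.
Implicit Types (p q r : 'I_L) (x y z : X) (i : 'I_d) (s : seq 'I_d).
Implicit Types (g : X -> R) (e b : R) (n : nat).

Definition half_angle p q : R := pi * (p%:R - q%:R) / L%:R.

(** Half the Euclidean distance between two grid points of the unit circle: it
    satisfies the triangle inequality and is the quantity by which summation by
    parts divides. *)
Definition chord p q : R := `|sin (half_angle p q)|.

Lemma chord_ge0 p q : 0 <= chord p q. Proof. exact: normr_ge0. Qed.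

Lemma chordC p q : chord p q = chord q p.
Proof.
rewrite /chord -[RHS]normrN -sinN; congr (`|sin _|).
by rewrite /half_angle; ring.
Qed.

Lemma chord_triangle p q r : chord p r <= chord p q + chord q r.
Proof.
rewrite /chord (_ : half_angle p r = half_angle p q + half_angle q r); last first.
  by rewrite /half_angle; ring.
rewrite sinD (le_trans (ler_normD _ _))// !normrM.
by rewrite lerD ?ler_piMr ?ler_piMl ?cos_max.
Qed.

Lemma grid_sin0 p q : sin (L%:R * half_angle p q) = 0.
Proof.
have L0 : L%:R != 0 :> R by rewrite pnatr_eq0.
have -> : L%:R * half_angle p q = pi *+ p - pi *+ q.
  rewrite /half_angle -[pi *+ p]mulr_natr -[pi *+ q]mulr_natr mulrC.
  by rewrite divfK// mulrBr.
have sinpin m : sin (pi *+ m) = 0 :> R.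
  elim: m => [|m IH]; first by rewrite sin0.
  by rewrite mulrSr sinDpi IH oppr0.
by rewrite sinB !sinpin mul0r mulr0 subr0.
Qed.

(** The linear minorant of the sine applies to the shorter of the two arcs that
    join the points. *)
Lemma chord_ge p q :
  (val (q - p))%:R / L%:R <= chord p q \/ (val (p - q))%:R / L%:R <= chord p q.
Proof.
have L0 : 0 < L%:R :> R by rewrite ltr0n.
have p0 := @pi_gt0 R.
wlog pq : p q / (p <= q)%N.
  move=> H; have [/H //|/ltnW /H] := leqP p q.
  by rewrite (chordC q p) => -[]; [right|left].
have half a : (2 * a <= L)%N -> a%:R / L%:R <= sin (pi * a%:R / L%:R) :> R.
  move=> aL; have := @sin_ge_linear R (pi * a%:R / L%:R).
  rewrite !mulr_ge0 ?invr_ge0 ?(ltW p0)//=.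
  rewrite [_ / pi]mulrC -!mulrA mulKf ?gt_eqF//.
  apply; rewrite ler_pM2l// ler_pdivrMr// mulrC ler_pdivlMr// -natrM.
  by rewrite ler_nat mulnC.
have vqp : val (q - p) = (q - p)%N.
  rewrite /= modnDmr addnBA ?(ltnW (ltn_ord p))//.
  rewrite addnC -addnBA// modnDl modn_small//.
  by rewrite (leq_ltn_trans (leq_subr _ _)).
have chE : chord p q = sin (pi * (q - p)%:R / L%:R).
  rewrite chordC /chord /half_angle -natrB// ger0_norm// sin_ge0_pi//.
  rewrite !mulr_ge0 ?invr_ge0 ?(ltW p0)//= ler_pdivrMr// ler_pM2l// ler_nat.
  by rewrite (leq_trans (leq_subr _ _))// ltnW.
have [h|h] := leqP (2 * (q - p))%N L.
  by left; rewrite vqp chE half.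
right; have pq' : (p < q)%N.
  by rewrite ltn_neqAle pq andbT; apply: contraTneq h => ->; rewrite subnn muln0.
have vpq : val (p - q) = (L - (q - p))%N.
  rewrite /= modnDmr addnBA ?(ltnW (ltn_ord q))// modn_small.
    have := ltn_ord q; lia.
  have := ltn_ord q; lia.
rewrite vpq chE (_ : pi * (q - p)%:R / L%:R = pi - pi * (L - (q - p))%:R / L%:R).
  rewrite sinB sinpi mul0r sub0r cospi mulN1r opprK half//.
  have := ltn_ord q; lia.
rewrite [(L - _)%:R]natrB; last by have := ltn_ord q; lia.
by rewrite mulrBr mulrBl mulfK ?gt_eqF// subKr.
Qed.

Definition upd x i q : X := [ffun j => if j == i then q else x j].

Definition shift_coord (a : 'I_L) i x : X := upd x i (x i + a).

Lemma iter_shift_coord (a : 'I_L) i m x :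
  iter m (shift_coord a i) x = upd x i (x i + a *+ m).
Proof.
elim: m => [|m IH].
  by rewrite mulr0n addr0; apply/ffunP => j; rewrite ffunE; case: eqP => // ->.
rewrite iterS IH /shift_coord; apply/ffunP => j; rewrite !ffunE eqxx mulrSr addrA.
by case: eqP.
Qed.

Lemma shift_coord_inj a i : injective (shift_coord a i).
Proof.
move=> x y /ffunP xy; apply/ffunP => j; have := xy j.
by rewrite !ffunE; case: eqP => [->|//] /addIr.
Qed.

Definition unit_step : 'I_L := inZp 1.

Lemma unit_step_mulrn (a : 'I_L) : unit_step *+ a = a.
Proof.
apply: val_inj; rewrite /unit_step.
have : forall m, val ((inZp 1 : 'I_L) *+ m) = (m %% L)%N.
  by elim=> [|m IH]; rewrite ?mod0n// mulrS /= IH modnDm.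
by move=> ->; rewrite modn_small.
Qed.

Lemma unit_step_mulNrn (a : 'I_L) : (- unit_step) *+ a = - a.
Proof. by rewrite mulNrn unit_step_mulrn. Qed.

Definition line_max i g x : R :=
  ergodic_max (shift_coord unit_step i) g L x +
  ergodic_max (shift_coord (- unit_step) i) g L x.

(** On a coordinate circle, the weight decreases along the shorter of the two
    arcs that join a point to [x i].  It is thus at most the sum of two
    decreasing weights, one along the orbits of each unit rotation. *)
Lemma line_average e i n g x : 0 < e -> (0 < n <= L)%N ->
  (forall y, 0 <= g y) ->
  L%:R^-1 * \sum_q bump_weight e n (chord (x i) q) * g (upd x i q) <=
  (1 + e^-1) * line_max i g x.
Proof.
move=> e0 nL g0.
have L0 : 0 < L%:R :> R by rewrite ltr0n.
pose w a : R := L%:R^-1 * bump_weight e n (a%:R / L%:R).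
have w0 a : 0 <= w a by rewrite mulr_ge0 ?invr_ge0 ?bump_weight_ge0.
have wd a : w a.+1 <= w a.
  rewrite ler_pM2l ?invr_gt0// bump_weight_homo ?divr_ge0//.
  by rewrite ler_pM2r ?invr_gt0// ler_nat.
have side a : (\sum_(m < L) w m) * ergodic_max (shift_coord a i) g L x <=
    (1 + e^-1) * ergodic_max (shift_coord a i) g L x.
  rewrite ler_wpM2r ?ergodic_max_ge0// -mulr_sumr.
  exact: bump_weight_sum.
rewrite mulrDr; apply: le_trans (lerD (side _) (side _)).
apply: le_trans (lerD
  (@ergodic_max_weighted _ _ (shift_coord unit_step i) w g L x wd w0)
  (@ergodic_max_weighted _ _ (shift_coord (- unit_step) i) w g L x wd w0)).
rewrite mulr_sumr.
under [X in _ <= X + _]eq_bigr do rewrite iter_shift_coord unit_step_mulrn.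
under [X in _ <= _ + X]eq_bigr do rewrite iter_shift_coord unit_step_mulNrn.
have -> : \sum_(m < L) w m * g (upd x i (x i + m)) =
    \sum_q w (val (q - x i)) * g (upd x i q).
  rewrite [RHS](reindex_inj (addrI (x i))); apply: eq_bigr => m _.
  by rewrite (addrC (x i)) addrK.
have -> : \sum_(m < L) w m * g (upd x i (x i - m)) =
    \sum_q w (val (x i - q)) * g (upd x i q).
  have inj : injective (fun m : 'I_L => x i - m) by move=> a b /addrI /oppr_inj.
  by rewrite [RHS](reindex_inj inj); apply: eq_bigr => m _; rewrite subKr.
rewrite -big_split /=; apply: ler_sum => q _; rewrite mulrA -mulrDl ler_wpM2r//.
have [h|h] := chord_ge (x i) q.
  apply: ler_wpDr => //; rewrite ler_pM2l ?invr_gt0//.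
  by rewrite bump_weight_homo// divr_ge0.
apply: ler_wpDl => //; rewrite ler_pM2l ?invr_gt0//.
by rewrite bump_weight_homo// divr_ge0.
Qed.

Definition strong_max s g : X -> R := foldr line_max g s.

Definition grid_weight e n x y : R := \prod_i bump_weight e n (chord (x i) (y i)).

Definition average (F : X -> R) : R := L%:R ^- d * \sum_y F y.

Lemma line_max_ge0 i g x : 0 <= line_max i g x.
Proof. by rewrite addr_ge0 ?ergodic_max_ge0. Qed.

Lemma strong_max_ge0 s g x : (forall y, 0 <= g y) -> 0 <= strong_max s g x.
Proof. by case: s => [|i s] g0 //=; exact: line_max_ge0. Qed.

(** Integrating one variable at a time bounds product averages by the
    composition of the maximal operators along the coordinate lines. *)
Lemma grid_average_le_strong_max e n g x : 0 < e -> (0 < n <= L)%N ->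
  (forall y, 0 <= g y) ->
  average (fun y => grid_weight e n x y * g y) <=
  (1 + e^-1) ^+ d * strong_max (enum 'I_d) g x.
Proof.
move=> e0 nL g0.
pose agree s x y := [forall j, (j \in s) || (y j == x j)].
pose A s x := L%:R ^- size s * \sum_(y | agree s x y)
  (\prod_(i <- s) bump_weight e n (chord (x i) (y i))) * g y.
have e1 : 0 <= 1 + e^-1 by rewrite addr_ge0// invr_ge0 ltW.
have A0 s z : 0 <= A s z.
  rewrite mulr_ge0 ?invr_ge0 ?exprn_ge0// sumr_ge0// => y _.
  by rewrite mulr_ge0// prodr_ge0// => i _; exact: bump_weight_ge0.
have key s z : uniq s -> A s z <= (1 + e^-1) ^+ size s * strong_max s g z.
  elim: s z => [|i s IH] z /=.
    rewrite /A expr0 invr1 !mul1r => _.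
    rewrite (bigD1 z) /=; last by apply/forallP => j; rewrite eqxx orbT.
    rewrite big_nil mul1r big1 ?addr0// => y /andP[/forallP zy /eqP[]].
    by apply/ffunP => j; apply/eqP; have := zy j.
  move=> /andP[iNs us].
  have -> : A (i :: s) z =
      L%:R^-1 * \sum_q bump_weight e n (chord (z i) q) * A s (upd z i q).
    rewrite /A /= exprS invfM -mulrA; congr (_ * _).
    rewrite (partition_big (fun y : X => y i) xpredT)//= mulr_sumr.
    apply: eq_bigr => q _; rewrite mulrCA; congr (_ * _).
    rewrite mulr_sumr; apply: eq_big => [y|y /andP[_ /eqP yq]].
      apply/andP/forallP => [[/forallP zy /eqP yq] j|zy].
        rewrite ffunE; have := zy j; rewrite inE.
        by case: eqP => [->|//]; rewrite yq eqxx orbT.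
      split; last by have := zy i; rewrite (negbTE iNs) ffunE eqxx.
      apply/forallP => j; have := zy j; rewrite inE ffunE.
      by case: (j =P i).
    rewrite big_cons yq !mulrA; congr (_ * _ * _).
    rewrite !big_seq; apply: eq_bigr => j js; rewrite ffunE.
    by case: eqP => // ji; rewrite -ji js in iNs.
  apply: (@le_trans _ _ (L%:R^-1 * \sum_q bump_weight e n (chord (z i) q) *
      ((1 + e^-1) ^+ size s * strong_max s g (upd z i q)))).
    rewrite ler_wpM2l ?invr_ge0//; apply: ler_sum => q _.
    by rewrite ler_wpM2l ?bump_weight_ge0// IH.
  under eq_bigr do rewrite mulrCA.
  rewrite -mulr_sumr mulrCA exprS [(1 + e^-1) * _]mulrC -mulrA.
  rewrite ler_wpM2l ?exprn_ge0//.
  by apply: line_average => // y; exact: strong_max_ge0.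
have := key _ x (enum_uniq 'I_d); rewrite size_enum_ord; apply: le_trans.
rewrite /A size_enum_ord /average le_eqVlt; apply/orP; left; apply/eqP.
congr (_ * _); apply: eq_big => [y|y _].
  by apply/esym/forallP => j; rewrite mem_enum.
by rewrite /grid_weight big_enum.
Qed.

(** The shifts of one coordinate are permutations of the grid, so the
    one-dimensional inequality applies with the other coordinates as
    parameters. *)
Lemma strong_max_strong s g (q : R) : 1 < q -> (forall y, 0 <= g y) ->
  \sum_x strong_max s g x `^ q <=
  (2 `^ q * (2 * strong_type_const q)) ^+ size s * \sum_x g x `^ q.
Proof.
move=> q1 g0; have q0 : 0 <= q by lra.
elim: s => [|i s IH] /=; first by rewrite expr0 mul1r.
set h := strong_max s g in IH *.
have h0 y : 0 <= h y by exact: strong_max_ge0.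
have C0 := strong_type_const_ge0 q1.
apply: (@le_trans _ _ (2 `^ q * (2 * strong_type_const q) * \sum_x h x `^ q)); last first.
  by rewrite exprS -[leRHS]mulrA; apply: ler_wpM2l => //; nonneg.
apply: (@le_trans _ _ (\sum_x 2 `^ q *
   (ergodic_max (shift_coord unit_step i) h L x `^ q +
    ergodic_max (shift_coord (- unit_step) i) h L x `^ q))).
  apply: ler_sum => x _; rewrite /line_max.
  have := ergodic_max_ge0 (shift_coord unit_step i) h L x.
  have := ergodic_max_ge0 (shift_coord (- unit_step) i) h L x.
  move: (ergodic_max _ _ _ _) (ergodic_max _ _ _ _) => u v u0 v0.
  wlog uv : u v u0 v0 / u <= v.
    by have [uv /(_ _ _ u0 v0 uv)|/ltW vu /(_ _ _ v0 u0 vu)] := leP u v;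
      rewrite // addrC [X in _ * X]addrC.
  apply: (@le_trans _ _ ((2 * v) `^ q)).
    by apply: ge0_ler_powR; rewrite ?nnegrE; lra.
  by rewrite powRM// ler_wpM2l ?powR_ge0// lerDr powR_ge0.
rewrite -mulr_sumr -mulrA ler_wpM2l ?powR_ge0// big_split /=.
rewrite mulr_natl mulr2n mulrDl lerD//.
  apply: ergodic_max_strong => //; exact: shift_coord_inj.
apply: ergodic_max_strong => //; exact: shift_coord_inj.
Qed.

Lemma strong_max_le s g c x : 0 <= c -> (forall y, g y <= c) ->
  strong_max s g x <= 2 ^+ size s * c.
Proof.
move=> c0 gc; elim: s x => [|i s IH] x /=; first by rewrite expr0 mul1r.
rewrite exprS -mulrA mulrDl mul1r.
by rewrite lerD// ergodic_max_le// mulr_ge0 ?exprn_ge0.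
Qed.

End Grid.

(** * Subordination of the Poisson semigroup to the heat semigroup *)

Section Subordination.
Variable R : realType.
Implicit Types (a b c v x : R) (f g : R -> R).

Lemma le_increment f g (df dg : R -> R) a b : a <= b ->
  (forall x, a <= x <= b -> is_derive x 1 f (df x)) ->
  (forall x, a <= x <= b -> is_derive x 1 g (dg x)) ->
  (forall x, a <= x <= b -> df x <= dg x) ->
  f b - f a <= g b - g a.
Proof.
move=> ab Df Dg fg.
have D x : a <= x <= b -> is_derive x 1 (g - f) (dg x - df x).
  by move=> xab; apply: is_deriveB; [exact: Dg|exact: Df].
have [x|x|c] := @MVT_segment _ (g - f) (fun x => dg x - df x) a b ab.
- by rewrite in_itv/= => /andP[/ltW ax /ltW xb]; apply: D; rewrite ax.
- by apply: derivable_within_continuous => y; rewrite in_itv/= => /D [].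
rewrite in_itv/= => /fg h; rewrite !fctE => E.
have : 0 <= (dg c - df c) * (b - a) by rewrite mulr_ge0// subr_ge0.
by rewrite -E; lra.
Qed.

(** An odd primitive is obtained by symmetrization, and it is bounded because
    its derivative is below that of the arctangent. *)
Lemma gauss_primitive : exists (G : R -> R) (l : R),
  [/\ 0 < l, forall x, G (- x) = - G x,
      forall x, is_derive x 1 G (expR (- x ^+ 2)) & G x @[x --> +oo] --> l].
Proof.
pose F x := (\int[@lebesgue_measure R]_(t in [set` Interval -oo%O (BRight x)])
  (gauss_fun t))%R.
have DF x : is_derive x 1 F (expR (- x ^+ 2)).
  have [||||D E] := @continuous_FTC1 R gauss_fun -oo%O x (x + 1).
  - by rewrite ltrDl.
  - apply: integrableS integrableT_gauss => //.
  - by rewrite ltNyr.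
  - exact: continuous_gauss_fun.
  by rewrite -[expR _]/(gauss_fun x) -E derive1E; exact: DeriveDef.
pose G x := (F x - F (- x)) / 2.
have DG x : is_derive x 1 G (expR (- x ^+ 2)).
  have -> : G = 2^-1 \*: (F - (F \o -%R)) by apply/funext => y; exact: mulrC.
  have D1 : is_derive (- x) 1 F (expR (- x ^+ 2)) by rewrite -[x ^+ 2]sqrrN.
  have D2 : is_derive x 1 (F \o -%R) (expR (- x ^+ 2) * -1) by exact: is_derive1_comp.
  by apply: is_derive_eq; rewrite /GRing.scale/=; field.
have G0 : G 0 = 0 by rewrite /G oppr0 subrr mul0r.
have ndG : {homo G : x y / x <= y}.
  move=> x y xy.
  have := @le_increment (cst 0) G (cst 0) (fun x => expR (- x ^+ 2)) x y xy.
  rewrite subrr subr_ge0; apply => // z _; exact: expR_ge0.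
have ubG : has_ubound (range G).
  exists (pi / 2) => _ [x _ <-].
  have [x0|x0] := leP x 0.
    by rewrite (le_trans (ndG _ _ x0))// G0 divr_ge0// pi_ge0.
  have := @le_increment G atan (fun x => expR (- x ^+ 2)) (fun x => (1 + x ^+ 2)^-1) 0 x (ltW x0).
  rewrite G0 atan0 !subr0 => H; rewrite (le_trans (H _ _ _)) ?(ltW (atan_ltpi2 x))//.
  move=> z _; rewrite expRN lef_pV2 ?posrE ?expR_gt0 ?expR_ge1Dx//.
  by rewrite ltr_wpDr// sqr_ge0.
exists G, (sup (range G)); split => //.
- have [x _] := @MVT _ G (fun x => expR (- x ^+ 2)) 0 1 ltr01 (fun x _ => DG x)
    (derivable_within_continuous (fun x _ => @ex_derive _ _ _ _ _ _ _ (DG x))).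
  rewrite G0 !subr0 mulr1 => G1.
  apply: (@lt_le_trans _ _ (G 1)); first by rewrite G1 expR_gt0.
  by apply: ub_le_sup => //; exists 1.
- by move=> x; rewrite /G opprK; field.
- exact: nondecreasing_cvgr.
Qed.

Lemma is_derive_bigsum (I : Type) (s : seq I) (f : I -> R -> R) (df : I -> R) x :
  (forall i, is_derive x 1 (f i) (df i)) ->
  is_derive x 1 (fun y => \sum_(i <- s) f i y) (\sum_(i <- s) df i).
Proof.
move=> D; elim: s => [|i s IH].
  rewrite big_nil (_ : (fun y => _) = cst 0); first exact: is_derive_cst.
  by apply/funext => y; rewrite big_nil.
rewrite big_cons (_ : (fun y => _) = f i + (fun y => \sum_(i <- s) f i y)).
  exact: is_deriveD.
by apply/funext => y; rewrite big_cons.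
Qed.

Lemma cvg_bigsum (I : Type) (s : seq I) (f : I -> nat -> R) (l : I -> R) :
  (forall i, f i n @[n --> \oo] --> l i) ->
  \sum_(i <- s) f i n @[n --> \oo] --> \sum_(i <- s) l i.
Proof.
move=> fl; elim: s => [|i s IH].
  by rewrite big_nil; under eq_fun do rewrite big_nil; exact: cvg_cst.
by rewrite big_cons; under eq_fun do rewrite big_cons; exact: cvgD.
Qed.

Lemma is_derive_cpowR (k e v : R) : 0 < v ->
  is_derive v 1 (fun y => k * y `^ e) (k * (e * v `^ (e - 1))).
Proof. by move=> v0; apply: is_deriveZ; exact: is_derive1_powR. Qed.

Lemma is_derive_cinv (k v : R) : 0 < v ->
  is_derive v 1 (fun y => k / y) (- k / v ^+ 2).
Proof.
move=> v0; have vn0 : v != 0 by rewrite gt_eqF.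
have D1 := @is_deriveV R id v 1 1 vn0 (is_derive_id _ _).
have D2 : is_derive v 1 (fun y => k / y) (k *: (- v ^- 2 *: 1)) by exact: is_deriveZ.
by apply: is_derive_eq; rewrite /GRing.scale/=; field.
Qed.

Lemma linear_cvgy (u : nat -> R) a b : 0 < a ->
  (forall n, a * n%:R - b <= u n) -> u n @[n --> \oo] --> +oo.
Proof.
move=> a0 ub; apply/cvgryPge => A; near=> n.
rewrite (le_trans _ (ub n))// lerBrDr -ler_pdivrMl//.
by near: n; exact: nbhs_infty_ger.
Unshelve. all: by end_near. Qed.

Lemma exp_poly_bound d v : 0 <= v ->
  expR (- v ^+ 2) * v ^+ (2 * d) <= d%:R ^+ d.
Proof.
move=> v0; case: d => [|d].
  by rewrite muln0 !expr0 mulr1 -[leRHS]expR0 ler_expR oppr_le0 sqr_ge0.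
rewrite expRN mulrC ler_pdivrMr ?expR_gt0// exprM.
have d0 : d.+1%:R != 0 :> R by rewrite pnatr_eq0.
have -> : v ^+ 2 = d.+1%:R * (v ^+ 2 / d.+1%:R) by rewrite mulrC divfK.
rewrite expRM_natl exprMn ler_wpM2l ?exprn_ge0//.
rewrite lerXn2r ?nnegrE ?expR_ge0 ?divr_ge0 ?sqr_ge0//.
by rewrite (le_trans _ (expR_ge1Dx _))// lerDr.
Qed.

Section Primitive.
Variables (G : R -> R) (l : R).
Hypotheses (GN : forall x, G (- x) = - G x)
  (DG : forall x, is_derive x 1 G (expR (- x ^+ 2)))
  (Gl : G x @[x --> +oo] --> l).

(** A primitive on the positive half line of [e^(- v^2 - (c / v)^2)]. *)
Definition subordination_primitive c v : R :=
  2^-1 * (expR (2 * c) * G (v + c / v) + expR (- (2 * c)) * G (v - c / v)).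

Lemma is_derive_subordination_primitive c v : 0 < v ->
  is_derive v 1 (subordination_primitive c)
    (expR (- v ^+ 2) * expR (- (c / v) ^+ 2)).
Proof.
move=> v0; have vn0 : v != 0 by rewrite gt_eqF.
have DV e : is_derive v 1 (fun y => y + e / y) (1 - e / v ^+ 2).
  have -> : 1 - e / v ^+ 2 = 1 + - e / v ^+ 2 by rewrite mulNr.
  by apply: is_deriveD; exact: is_derive_cinv.
have DA e k : is_derive v 1 (fun y => k * G (y + e / y))
    (k * (expR (- (v + e / v) ^+ 2) * (1 - e / v ^+ 2))).
  have -> : (fun y => k * G (y + e / y)) = k \*: (G \o (fun y => y + e / y)).
    by apply/funext => y.
  apply: is_deriveZ; apply: is_derive1_comp.
have -> : subordination_primitive c = 2^-1 \*:
    ((fun y => expR (2 * c) * G (y + c / y)) +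
     (fun y => expR (- (2 * c)) * G (y + - c / y))).
  by apply/funext => y; rewrite /subordination_primitive -[- (c / y)]mulNr.
apply: is_derive_eq.
have e1 : expR (2 * c) * expR (- (v + c / v) ^+ 2) =
    expR (- v ^+ 2) * expR (- (c / v) ^+ 2).
  by rewrite -!expRD; congr expR; field.
have e2 : expR (- (2 * c)) * expR (- (v + - c / v) ^+ 2) =
    expR (- v ^+ 2) * expR (- (c / v) ^+ 2).
  by rewrite -!expRD; congr expR; field.
by rewrite /GRing.scale/= !mulrA e1 e2; field.
Qed.

(** The increments of the primitive over the half line give the subordination
    formula [int exp (- v^2 - (c / v)^2) = l exp (- 2 c)]. *)
Lemma cvg_subordination_primitive c : 0 <= c ->
  subordination_primitive c n.+1%:R - subordination_primitive c n.+1%:R^-1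
    @[n --> \oo] --> l * expR (- (2 * c)).
Proof.
move=> c0.
have Gu (u : nat -> R) : u n @[n --> \oo] --> +oo -> G (u n) @[n --> \oo] --> l.
  by move=> uoo; exact: (cvg_comp _ _ uoo Gl).
have n1 n : n.+1%:R^-1 <= 1 :> R by rewrite invf_le1 ?ler1n ?ltr0n.
have nV0 n : 0 <= n.+1%:R^-1 :> R by rewrite invr_ge0.
have nE n : n.+1%:R = n%:R + 1 :> R by rewrite natr1.
have G1 : G (n.+1%:R + c / n.+1%:R) @[n --> \oo] --> l.
  apply: Gu; apply: (@linear_cvgy _ 1 0) => // n.
  by rewrite mul1r subr0 nE -nE -[leLHS]addr0 lerD ?ler_nat ?divr_ge0.
have G2 : G (n.+1%:R - c / n.+1%:R) @[n --> \oo] --> l.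
  apply: Gu; apply: (@linear_cvgy _ 1 c) => // n.
  by rewrite mul1r lerB ?ler_nat// ler_piMr.
have [c00|cn0] := eqVneq c 0.
  rewrite c00 in G1 G2 *.
  have G0 : G 0 = 0 by have := GN 0; rewrite oppr0; lra.
  have contG : {for 0, continuous G}.
    by apply/differentiable_continuous/derivable1_diffP; case: (DG 0).
  have G3 : G (n.+1%:R^-1) @[n --> \oo] --> (0 : R).
    rewrite -[X in _ --> X]G0; apply: (cvg_comp (fun n : nat => n.+1%:R^-1) G) contG.
    exact: cvg_harmonic.
  rewrite (_ : (fun n => _) = (fun n => G (n.+1%:R + 0 / n.+1%:R) - G (n.+1%:R^-1))).
    by rewrite mulr0 oppr0 expR0 mulr1 -[X in _ --> X]subr0; exact: cvgB.
  apply/funext => n; rewrite /subordination_primitive !mul0r !mulr0 oppr0 expR0.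
  by rewrite !addr0; field.
have cp : 0 < c by rewrite lt_neqAle eq_sym cn0.
have G3 : G (n.+1%:R^-1 + c / n.+1%:R^-1) @[n --> \oo] --> l.
  apply: Gu; apply: (@linear_cvgy _ c 0) => // n.
  rewrite subr0 invrK -[leLHS]add0r lerD// ler_wpM2l// ler_nat//.
have G4 : G (c / n.+1%:R^-1 - n.+1%:R^-1) @[n --> \oo] --> l.
  apply: Gu; apply: (@linear_cvgy _ c 1) => // n.
  by rewrite invrK lerB// ler_wpM2l// ler_nat.
pose e1 := expR (2 * c); pose e2 := expR (- (2 * c)).
have -> : l * expR (- (2 * c)) = 2^-1 * (e1 * l + e2 * l) - 2^-1 * (e1 * l - e2 * l).
  by rewrite -/e2; field.
apply: cvgB; apply: cvgMr.
  by apply: cvgD; apply: cvgMr.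
rewrite (_ : (fun n => _) = (fun n => e1 * G (n.+1%:R^-1 + c / n.+1%:R^-1) -
    e2 * G (c / n.+1%:R^-1 - n.+1%:R^-1))).
  by apply: cvgB; apply: cvgMr.
apply/funext => n; rewrite -/e1 -/e2 -(opprB (c / _)) GN; ring.
Qed.

End Primitive.

(** Integrating [e^(- v^2) * (v ^ d + v ^ (- b))] over the half line bounds any
    combination of Poisson multipliers by the supremum of the corresponding
    combinations of Gaussian ones.  The integral is only seen through the
    increments of the primitive above. *)
Lemma subordination_real (d : nat) b : 0 <= b -> b < 1 ->
  exists2 C, 0 <= C & forall (K : finType) (c z : K -> R) A B,
    (forall k, 0 <= c k) -> 0 <= B ->
    (forall v, 0 < v -> A + \sum_k expR (- (c k / v) ^+ 2) * z k <=
      B * (v ^+ d + v `^ (- b))) ->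
    A + \sum_k expR (- (2 * c k)) * z k <= C * B.
Proof.
move=> b0 b1; have [G [l [l0 GN DG Gl]]] := gauss_primitive.
pose m := d.+2; pose D : R := m%:R ^+ m.
have D0 : 0 <= D by rewrite exprn_ge0.
have b1' : 0 < 1 - b by rewrite subr_gt0.
pose C := (2 / (1 - b) + 2 * D) / l.
have C0 : 0 <= C.
  by rewrite divr_ge0 ?(ltW l0)// addr_ge0//; [rewrite divr_ge0// ltW|rewrite mulr_ge0].
exists C => // K c z A B c0 B0 H.
pose E := subordination_primitive G.
pose Z v := A * E 0 v + \sum_k z k * E (c k) v.
pose dZ v := expR (- v ^+ 2) * (A + \sum_k expR (- (c k / v) ^+ 2) * z k).
have DZ v : 0 < v -> is_derive v 1 Z (dZ v).
  move=> v0; have DE k := is_derive_subordination_primitive DG k v0.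
  have -> : Z = A \*: E 0 + (fun v => \sum_k (z k \*: E (c k)) v).
    by apply/funext => y.
  have D1 : is_derive v 1 (A \*: E 0) (A *: (expR (- v ^+ 2) * expR (- (0 / v) ^+ 2))).
    exact: is_deriveZ.
  have D2 : is_derive v 1 (fun v => \sum_k (z k \*: E (c k)) v)
    (\sum_k z k *: (expR (- v ^+ 2) * expR (- (c k / v) ^+ 2))).
    by apply: is_derive_bigsum => k; exact: is_deriveZ.
  apply: is_derive_eq; rewrite /dZ mulrDr mulr_sumr mul0r expr0n/= oppr0 expR0.
  by congr (_ + _); [rewrite /GRing.scale/= mulr1 mulrC|apply: eq_bigr => k _;
    rewrite /GRing.scale/=; ring].
have low e : 0 < e -> e <= 1 -> Z 1 - Z e <= 2 * B / (1 - b).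
  move=> e0 e1.
  pose P v := (2 * B / (1 - b)) * v `^ (1 - b).
  have DP v : 0 < v -> is_derive v 1 P (2 * B * v `^ (- b)).
    move=> v0; have := is_derive_cpowR (2 * B / (1 - b)) (1 - b) v0.
    have -> : 1 - b - 1 = - b by ring.
    by rewrite mulrA divfK// gt_eqF.
  apply: le_trans (@le_increment Z P dZ (fun v => 2 * B * v `^ (- b)) e 1 e1 _ _ _) _.
  - move=> x /andP[ex _]; apply: DZ; exact: lt_le_trans ex.
  - move=> x /andP[ex _]; apply: DP; exact: lt_le_trans ex.
  - move=> x /andP[ex x1]; have x0 : 0 < x by exact: lt_le_trans ex.
    have xb1 : x ^+ d <= x `^ (- b).
      apply: (@le_trans _ _ 1); first by rewrite exprn_ile1// ltW.
      by rewrite -[leLHS](powRr0 x) ger_powR ?x0// oppr_le0.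
    have eb : expR (- x ^+ 2) <= 1 by rewrite -[leRHS]expR0 ler_expR oppr_le0 sqr_ge0.
    have S0 : 0 <= B * (x ^+ d + x `^ (- b)).
      by rewrite mulr_ge0// addr_ge0 ?powR_ge0// exprn_ge0// ltW.
    apply: (@le_trans _ _ (B * (x ^+ d + x `^ (- b)))).
      rewrite (le_trans (ler_wpM2l (expR_ge0 _) (H x x0)))//.
      by rewrite ler_piMl.
    rewrite (_ : 2 * B * _ = B * (2 * x `^ (- b))); last by ring.
    by rewrite ler_wpM2l//; lra.
  - rewrite /P powR1 mulr1 lerBlDr lerDl mulr_ge0 ?powR_ge0//.
    by rewrite divr_ge0 ?mulr_ge0// ltW.
have high T : 1 <= T -> Z T - Z 1 <= 2 * D * B.
  move=> T1; pose P v : R := - (2 * D * B) / v.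
  have DP v : 0 < v -> is_derive v 1 P (2 * D * B / v ^+ 2).
    by move=> v0; have := is_derive_cinv (- (2 * D * B)) v0; rewrite opprK.
  apply: le_trans (@le_increment Z P dZ (fun v => 2 * D * B / v ^+ 2) 1 T T1 _ _ _) _.
  - move=> x /andP[ex _]; apply: DZ; exact: lt_le_trans ex.
  - move=> x /andP[ex _]; apply: DP; exact: lt_le_trans ex.
  - move=> x /andP[x1 _]; have x0 : 0 < x by exact: lt_le_trans x1.
    have xb1 : x `^ (- b) <= x ^+ d.
      apply: (@le_trans _ _ 1); last by rewrite exprn_ege1.
      by rewrite -[leRHS](powRr0 x) ler_powR// oppr_le0.
    apply: (@le_trans _ _ (expR (- x ^+ 2) * (2 * B * x ^+ d))).
      rewrite ler_wpM2l ?expR_ge0// (le_trans (H x x0))//.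
      rewrite (_ : 2 * B * _ = B * (2 * x ^+ d)); last by ring.
      by rewrite ler_wpM2l//; lra.
    rewrite ler_pdivlMr ?exprn_gt0//.
    have -> : expR (- x ^+ 2) * (2 * B * x ^+ d) * x ^+ 2 =
        2 * B * (expR (- x ^+ 2) * x ^+ m).
      have -> : x ^+ m = x ^+ d * x ^+ 2 by rewrite -exprD addn2.
      by ring.
    rewrite [leRHS]mulrAC; apply: ler_wpM2l; first exact: mulr_ge0.
    rewrite (le_trans _ (exp_poly_bound m (ltW x0)))// ler_wpM2l ?expR_ge0//.
    by rewrite ler_weXn2l// mul2n -addnn leq_addr.
  - rewrite /P divr1 opprK gerDr mulNr oppr_le0.
    have T0 : 0 <= T by exact: le_trans T1.
    by apply: divr_ge0 => //; apply: mulr_ge0 => //; exact: mulr_ge0.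
rewrite -(ler_pM2l l0) (_ : l * (C * B) = (2 / (1 - b) + 2 * D) * B); last first.
  by rewrite /C mulrA [l * _]mulrC divfK// gt_eqF.
have : Z n.+1%:R - Z n.+1%:R^-1 @[n --> \oo] -->
    l * (A + \sum_k expR (- (2 * c k)) * z k).
  have -> : l * (A + \sum_k expR (- (2 * c k)) * z k) =
      A * (l * expR (- (2 * 0))) + \sum_k z k * (l * expR (- (2 * c k))).
    rewrite mulr0 oppr0 expR0 mulr1 mulrDr mulr_sumr [l * A]mulrC; congr (_ + _).
    by apply: eq_bigr => k _; ring.
  have -> : (fun n : nat => Z n.+1%:R - Z n.+1%:R^-1) = (fun n : nat =>
      A * (E 0 n.+1%:R - E 0 n.+1%:R^-1) +
      \sum_k z k * (E (c k) n.+1%:R - E (c k) n.+1%:R^-1)).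
    apply/funext => n; rewrite /Z mulrBr.
    under [in RHS]eq_bigr do rewrite mulrBr.
    by rewrite sumrB; ring.
  apply: cvgD; first by apply: cvgMl_tmp; exact: cvg_subordination_primitive.
  apply: cvg_bigsum => k; apply: cvgMl_tmp; exact: cvg_subordination_primitive.
move=> cvgZ.
apply: (ler_cvg_to cvgZ (@cvg_cst _ ((2 / (1 - b) + 2 * D) * B) nat \oo _)).
apply: nearW => n.
have n1 : n.+1%:R^-1 <= 1 :> R by rewrite invf_le1 ?ler1n ?ltr0n.
have n0 : 0 < n.+1%:R^-1 :> R by rewrite invr_gt0 ltr0n.
have nT : 1 <= n.+1%:R :> R by rewrite ler1n.
rewrite mulrDl mulrAC; have := low _ n0 n1; have := high _ nT; lra.
Qed.

End Subordination.

(** * Fourier multipliers on the grid *)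

Section ComplexNorm.
Variable R : realType.
Local Open Scope complex_scope.
Implicit Types (z w : R[i]) (t u : R).

Local Notation normc := (@Normc.normc R).

Lemma normc_ge0 z : 0 <= normc z.
Proof. by case: z => a b; exact: sqrtr_ge0. Qed.

Lemma normc_real t : normc t%:C = `|t|.
Proof. by rewrite /= expr0n/= addr0 sqrtr_sqr. Qed.

Lemma normcB z w : normc (z - w) <= normc z + normc w.
Proof. by rewrite -(normcN w); exact: le_normcD. Qed.

Lemma normc_sum (I : Type) (s : seq I) (P : pred I) (F : I -> R[i]) :
  normc (\sum_(i <- s | P i) F i) <= \sum_(i <- s | P i) normc (F i).
Proof.
elim/big_ind2 : _ => // [|z t w u zt wu]; first by rewrite Normc.normc0.
by rewrite (le_trans (le_normcD _ _))// lerD.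
Qed.

Lemma Re_le_normc z : complex.Re z <= normc z.
Proof.
case: z => a b /=; rewrite (le_trans (ler_norm a))// -sqrtr_sqr ler_wsqrtr//.
by rewrite lerDl sqr_ge0.
Qed.

Lemma normc_le_ReIm z : normc z <= `|complex.Re z| + `|complex.Im z|.
Proof.
case: z => a b /=; rewrite -[leRHS]ger0_norm ?addr_ge0// -sqrtr_sqr ler_wsqrtr//.
rewrite -[a ^+ 2]real_normK ?num_real// -[b ^+ 2]real_normK ?num_real//.
by have := normr_ge0 a; have := normr_ge0 b; nra.
Qed.

Lemma exists_rotation z : exists2 w, normc w = 1 & complex.Re (w * z) = normc z.
Proof.
have [->|z0] := eqVneq z 0.
  by exists 1; rewrite ?Normc.normc1// mulr0 Normc.normc0.
have n0 : normc z != 0 by apply: contra z0 => /eqP /Normc.eq0_normc ->.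
have nz : 0 < normc z by rewrite lt_neqAle eq_sym n0 normc_ge0.
case: z z0 n0 nz => a b _ n0 nz.
set n := normc _ in n0 nz *.
have nE : n ^+ 2 = a ^+ 2 + b ^+ 2 by rewrite /n /= sqr_sqrtr// addr_ge0 ?sqr_ge0.
exists ((a / n) +i* (- b / n)).
  rewrite /= -[RHS](sqrtr1 R); congr Num.sqrt.
  rewrite !expr_div_n sqrrN -mulrDl -nE divff//.
  by rewrite expf_neq0.
rewrite /= -/n; apply: (mulIf n0); rewrite -expr2 nE; field.
exact: n0.
Qed.

Definition cis t : R[i] := cos t +i* sin t.

Lemma cisD t u : cis (t + u) = cis t * cis u.
Proof. by rewrite /cis cosD sinD; apply/eqP; rewrite eq_complex /= eqxx/= addrC. Qed.

Lemma cis0 : cis 0 = 1.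
Proof. by rewrite /cis cos0 sin0. Qed.

Lemma normc_cis t : normc (cis t) = 1.
Proof. by rewrite /= cos2Dsin2 sqrtr1. Qed.

Lemma cis_neq0 t : cis t != 0.
Proof.
apply/eqP => h; have := normc_cis t; rewrite h Normc.normc0 => /eqP.
by rewrite eq_sym oner_eq0.
Qed.

Lemma cis_inv t : (cis t)^-1 = cis (- t).
Proof.
by apply: (mulfI (cis_neq0 t)); rewrite mulfV ?cis_neq0// -cisD subrr cis0.
Qed.

Lemma cis_sum (I : Type) (s : seq I) (F : I -> R) :
  cis (\sum_(i <- s) F i) = \prod_(i <- s) cis (F i).
Proof. by elim/big_rec2 : _ => [|i z t _ <-]; rewrite ?cis0// cisD. Qed.

Lemma cis_mulrn t n : cis (t *+ n) = cis t ^+ n.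
Proof. by elim: n => [|n IH]; rewrite ?mulr0n ?cis0// mulrS cisD IH exprS. Qed.

Lemma cis_addN t : cis t + cis (- t) = (2 * cos t)%:C.
Proof.
rewrite /cis cosN sinN; apply/eqP; rewrite eq_complex /= subrr eqxx andbT.
by rewrite mulr_natl mulr2n.
Qed.

(** Subordination for complex combinations: test against the conjugate
    direction of the value to be estimated. *)
Lemma subordination (d : nat) b : 0 <= b -> b < 1 ->
  exists2 C, 0 <= C & forall (K : finType) (c : K -> R) (z : K -> R[i])
    (A : R[i]) B, (forall k, 0 <= c k) -> 0 <= B ->
    (forall v, 0 < v -> normc (A + \sum_k (expR (- (c k / v) ^+ 2))%:C * z k) <=
      B * (v ^+ d + v `^ (- b))) ->
    normc (A + \sum_k (expR (- (2 * c k)))%:C * z k) <= C * B.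
Proof.
move=> b0 b1; have [C C0 HC] := subordination_real d b0 b1; exists C => //.
move=> K c z A B c0 B0 H.
have [w w1 <-] := exists_rotation (A + \sum_k (expR (- (2 * c k)))%:C * z k).
have ReE (e : K -> R) : complex.Re (w * (A + \sum_k (e k)%:C * z k)) =
    complex.Re (w * A) + \sum_k e k * complex.Re (w * z k).
  rewrite mulrDr raddfD /= mulr_sumr raddf_sum /=; congr (_ + _).
  by apply: eq_bigr => k _; case: (w) (z k) => [p q] [s t] /=; ring.
rewrite ReE; apply: HC => // v v0; rewrite -ReE (le_trans _ (H v v0))//.
by rewrite (le_trans (Re_le_normc _))// Normc.normcM w1 mul1r.
Qed.

End ComplexNorm.

Section Dft.
Variables (R : realType) (d N : nat).
Local Open Scope complex_scope.
Local Notation L := (2 * N).+1.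
Local Notation X := {ffun 'I_d -> 'I_L}.
Local Notation normc := (@Normc.normc R).
Implicit Types (k x y z : X) (a : X -> R) (c : X -> R[i]).

(** The index [p] stands for the frequency [p - N]. *)
Definition freq (p : 'I_L) : R := p%:R - N%:R.

Definition absfreq (p : 'I_L) : nat := (p - N + (N - p))%N.

Lemma absfreqE p : (absfreq p)%:R = `|freq p|.
Proof.
rewrite /absfreq /freq; have [pN|Np] := leqP p N.
  have -> : (p - N)%N = 0%N by apply/eqP; rewrite subn_eq0.
  by rewrite add0n natrB// distrC ger0_norm// subr_ge0 ler_nat.
have -> : (N - p)%N = 0%N by apply/eqP; rewrite subn_eq0 ltnW.
by rewrite addn0 natrB ?(ltnW Np)// ger0_norm// subr_ge0 ler_nat ltnW.
Qed.

Definition mode k x : R[i] := cis (\sum_i freq (k i) * (2 * (pi * (x i)%:R / L%:R))).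

Definition phase k x y : R[i] := cis (\sum_i freq (k i) * (2 * half_angle R (x i) (y i))).

Lemma phase_mode k x y : phase k x y * mode k y = mode k x.
Proof.
rewrite /phase /mode -cisD -big_split /=; congr cis; apply: eq_bigr => i _.
by rewrite /half_angle; ring.
Qed.

Definition multiplier a c x : R[i] := \sum_k (a k)%:C * c k * mode k x.

Definition kernel a x y : R[i] := \sum_k (a k)%:C * phase k x y.

Definition product_multiplier (A : 'I_d -> nat -> R) k : R :=
  \prod_i A i (absfreq (k i)).

Lemma sum_freq_even (A : nat -> R) t :
  \sum_(p < L) (A (absfreq p))%:C * cis (freq p * (2 * t)) =
  (even_kernel A N t)%:C.
Proof.
have NL : L = (N + 1 + N)%N by rewrite addn1 mul2n -addnn.
pose F m : R[i] := (A (m - N + (N - m))%N)%:C * cis ((m%:R - N%:R) * (2 * t)).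
rewrite -(big_mkord xpredT F) NL.
rewrite (@big_cat_nat _ _ _ N 0%N (N + 1 + N))//=; last by lia.
rewrite (@big_cat_nat _ _ _ N.+1 N (N + 1 + N))//=; last by lia.
rewrite big_nat1 {2}/F subnn subrr mul0r cis0 mulr1 addrCA.
rewrite big_nat_rev /= add0n.
rewrite -{1}[N.+1]add0n big_addn addn1 addSn subSS addKn add0n.
rewrite !big_mkord /even_kernel -big_split /= rmorphD rmorph_sum /=.
congr (_ + _); apply: eq_bigr => j _.
have -> : F (N - j.+1)%N = (A j.+1)%:C * cis (- (j.+1%:R * (2 * t))).
  rewrite /F natrB//; congr (_%:C * cis _); last by ring.
  congr A; have := ltn_ord j; lia.
have -> : F (j + N.+1)%N = (A j.+1)%:C * cis (j.+1%:R * (2 * t)).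
  rewrite /F natrD; congr (_%:C * cis _); last by rewrite -[N.+1%:R]natr1 -natr1; ring.
  congr A; lia.
rewrite -mulrDr [X in _ * X]addrC cis_addN -rmorphM; congr (_%:C).
have -> : j.+1%:R * (2 * t) = 2 * j.+1%:R * t by ring.
by rewrite mulrCA mulrA.
Qed.

Lemma product_kernel (A : 'I_d -> nat -> R) x y :
  kernel (product_multiplier A) x y =
  (\prod_i even_kernel (A i) N (half_angle R (x i) (y i)))%:C.
Proof.
rewrite /kernel rmorph_prod /=.
under [RHS]eq_bigr do rewrite -sum_freq_even.
rewrite bigA_distr_bigA /=; apply: eq_bigr => k _.
by rewrite /phase cis_sum /product_multiplier rmorph_prod -big_split.
Qed.

(** Orthogonality of the characters of the grid, one geometric sum per
    coordinate. *)
Lemma sum_mode k l : \sum_y mode l y * (mode k y)^-1 = if l == k then L%:R ^+ d else 0.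
Proof.
pose u (p q : 'I_L) : R[i] := cis ((freq p - freq q) * (2 * (pi / L%:R))).
have -> : \sum_y mode l y * (mode k y)^-1 = \prod_i \sum_(q < L) u (l i) (k i) ^+ q.
  rewrite bigA_distr_bigA /=; apply: eq_bigr => y _.
  rewrite /mode cis_inv -cisD -sumrN -big_split /= cis_sum; apply: eq_bigr => i _.
  rewrite /u -cis_mulrn; congr cis; rewrite -[RHS]mulr_natr; ring.
have L0 : L%:R != 0 :> R by rewrite pnatr_eq0.
have [->|lk] := eqVneq l k.
  rewrite (eq_bigr (fun=> L%:R : R[i])); first by rewrite prodr_const card_ord.
  move=> i _; rewrite /u subrr mul0r cis0.
  by under eq_bigr do rewrite expr1n; rewrite sumr_const card_ord.
have [i /eqP lki] : exists i, l i <> k i.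
  apply: contrapT => /forallNP H; move/eqP: lk; apply.
  by apply/ffunP => i; apply: contrapT; exact: H.
rewrite (bigD1 i)//= [X in X * _](_ : _ = 0) ?mul0r//.
have uL : u (l i) (k i) ^+ L = 1.
  rewrite /u -cis_mulrn.
  have -> : (freq (l i) - freq (k i)) * (2 * (pi / L%:R)) *+ L =
      (pi *+ 2) *+ (l i) - (pi *+ 2) *+ (k i).
    rewrite -[LHS]mulr_natr -[pi *+ 2 *+ l i]mulr_natr -[pi *+ 2 *+ k i]mulr_natr.
    rewrite -[pi *+ 2]mulr_natr /freq; move: L%:R L0 => e e0.
    by move: (l i)%:R (k i)%:R N%:R => p q m; field.
  have per m : cis ((pi *+ 2) *+ m) = 1 :> R[i].
    by rewrite cis_mulrn /cis cos2pi sin2pi expr1n.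
  by rewrite cisD -cis_inv !per invr1 mulr1.
have u1 : u (l i) (k i) != 1.
  apply/eqP => /(congr1 (@complex.Re R)) /= => h.
  have {}h : cos ((freq (l i) - freq (k i)) * (pi / L%:R) *+ 2) = 1.
    rewrite -[RHS]h; congr cos; rewrite -[LHS]mulr_natr.
    by move: (freq _ - freq _) (pi / _) => e f; ring.
  move: h; rewrite cos_mulr2n cos2sin2 => h.
  have s0 : sin ((freq (l i) - freq (k i)) * (pi / L%:R)) = 0.
    by apply/eqP; rewrite -sqrf_eq0; apply/eqP; lra.
  have : 0 < sin (pi * `|(l i)%:R - (k i)%:R| / L%:R) :> R.
    have p0 := @pi_gt0 R; have Lp : 0 < L%:R :> R by rewrite ltr0n.
    apply: sin_gt0_pi; apply/andP; split.
      rewrite !mulr_gt0 ?invr_gt0// normr_gt0 subr_eq0 eqr_nat.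
      by apply: contraNN lki => /eqP/val_inj ->.
    rewrite ltr_pdivrMr// ltr_pM2l//.
    have := ltn_ord (l i); have := ltn_ord (k i).
    rewrite -!(ltr_nat R) ltr_norml; have : 0 <= (l i)%:R :> R by [].
    by have : 0 <= (k i)%:R :> R by []; lra.
  have -> : pi * `|(l i)%:R - (k i)%:R| / L%:R =
      `|(freq (l i) - freq (k i)) * (pi / L%:R)| :> R.
    rewrite normrM (ger0_norm (x := pi / _)) ?divr_ge0 ?pi_ge0//.
    have -> : freq (l i) - freq (k i) = (l i)%:R - (k i)%:R by rewrite /freq; ring.
    by rewrite mulrA [pi * _]mulrC.
  have [h1|h1] := leP 0 ((freq (l i) - freq (k i)) * (pi / L%:R)).
    by rewrite ger0_norm// s0 ltxx.
  by rewrite ltr0_norm// sinN s0 oppr0 ltxx.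
apply: (mulfI (x := u (l i) (k i) - 1)); first by rewrite subr_eq0.
by rewrite -subrX1 uL subrr mulr0.
Qed.

Lemma mode_neq0 k x : mode k x != 0.
Proof. exact: cis_neq0. Qed.

(** A product of multipliers acts by convolution over the grid. *)
Lemma multiplierM a b c x :
  multiplier (fun k => a k * b k) c x =
  L%:R ^- d * \sum_y kernel a x y * multiplier b c y.
Proof.
have Ld : L%:R ^+ d != 0 :> R[i] by rewrite expf_neq0// pnatr_eq0.
apply: (mulfI Ld); rewrite mulrA divff// mul1r.
under [RHS]eq_bigr => y _.
  rewrite /kernel /multiplier mulr_suml.
  under eq_bigr do rewrite mulr_sumr.
  over.
rewrite exchange_big /=; under [RHS]eq_bigr do rewrite exchange_big /=.
rewrite /multiplier mulr_sumr; apply: eq_bigr => k _.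
rewrite (bigD1 k)//= [X in _ = _ + X]big1 ?addr0 => [|l lk].
  transitivity (\sum_y (a k)%:C * (b k)%:C * c k * mode k x * (mode k y * (mode k y)^-1)).
    by rewrite -mulr_sumr sum_mode eqxx rmorphM; ring.
  apply: eq_bigr => y _; rewrite -(phase_mode k x y) mulfV ?mode_neq0//; ring.
transitivity (\sum_y (a k)%:C * (b l)%:C * c l * mode k x * (mode l y * (mode k y)^-1)).
  apply: eq_bigr => y _; rewrite -(phase_mode k x y).
  have := mode_neq0 k y; move: (mode k y) => w w0.
  by rewrite [_ * w]mulrC; field.
by rewrite -mulr_sumr sum_mode (negbTE lk) mulr0.
Qed.

Lemma multiplierM_le a b c x (W : X -> X -> R) :
  (forall x y, normc (kernel a x y) <= W x y) ->
  normc (multiplier (fun k => a k * b k) c x) <=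
  average (fun y => W x y * normc (multiplier b c y)).
Proof.
move=> aW; rewrite multiplierM Normc.normcM /average.
have -> : normc (L%:R ^- d) = L%:R ^- d.
  have -> : L%:R ^- d = (L%:R ^- d)%:C :> R[i].
    by rewrite rmorphV ?rmorphXn/= ?rmorph_nat// unitfE expf_neq0// pnatr_eq0.
  by rewrite normc_real ger0_norm// invr_ge0 exprn_ge0.
rewrite ler_wpM2l ?invr_ge0 ?exprn_ge0//.
apply: le_trans (normc_sum _ _ _) _; apply: ler_sum => y _.
by rewrite Normc.normcM ler_wpM2r ?normc_ge0.
Qed.

Lemma eq_multiplier a b c x : (forall k, c k != 0 -> a k = b k) ->
  multiplier a c x = multiplier b c x.
Proof.
move=> ab; apply: eq_bigr => k _; have [->|/ab ->//] := eqVneq (c k) 0.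
by rewrite !mulr0.
Qed.

Lemma multiplierD a b c x :
  multiplier (fun k => a k + b k) c x = multiplier a c x + multiplier b c x.
Proof.
by rewrite /multiplier -big_split; apply: eq_bigr => k _; rewrite rmorphD !mulrDl.
Qed.

End Dft.

(** * Kernel estimates on the grid *)

Section ScalarEstimates.
Variable R : realType.
Implicit Types (b s u v : R) (n m : nat).

Definition decay b n s : R := (1 + n%:R * s) `^ (- (1 + b)).

Lemma bump_weightE b n s : bump_weight b n s = n%:R * decay b n s.
Proof. by []. Qed.

Lemma decay_ge0 b n s : 0 <= decay b n s. Proof. exact: powR_ge0. Qed.

Lemma decay_compare b n m s (l : R) : 0 <= b <= 1 -> 0 <= s -> 1 <= l ->
  m%:R <= l * n%:R -> decay b n s <= l ^+ 2 * decay b m s.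
Proof.
move=> /andP[b0 b1] s0 l1 ml.
have ns : 0 <= n%:R * s by rewrite mulr_ge0.
have ms : 0 <= m%:R * s by rewrite mulr_ge0.
have l0 : 0 <= l by exact: le_trans l1.
have lp : 0 < l by exact: lt_le_trans l1.
rewrite /decay !powRN ler_pdivlMr; last by rewrite powR_gt0//; lra.
rewrite mulrC ler_pdivrMr; last by rewrite powR_gt0//; lra.
apply: (@le_trans _ _ ((l * (1 + n%:R * s)) `^ (1 + b))).
  apply: ge0_ler_powR; rewrite ?nnegrE; [lra|lra|by rewrite mulr_ge0//; lra|].
  by have := ler_wpM2r s0 ml; lra.
rewrite powRM//; last by lra.
rewrite ler_wpM2r ?powR_ge0// -powR_mulrn// ler_powR//; lra.
Qed.

Lemma bump_weight_compare b n m s (l : R) : 0 <= b <= 1 -> 0 <= s -> 1 <= l ->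
  (n <= m)%N -> m%:R <= l * n%:R -> bump_weight b n s <= l ^+ 2 * bump_weight b m s.
Proof.
move=> b01 s0 l1 nm ml; rewrite !bump_weightE mulrCA.
by rewrite ler_pM ?decay_ge0 ?ler_nat// decay_compare.
Qed.

(** Triangle inequality for the weights: [1 + n (s + u)] is at most
    [(1 + n s) (1 + n u)]. *)
Lemma decay_submul b n s u : 0 <= b -> 0 <= s -> 0 <= u ->
  decay b n s * decay b n u <= decay b n (s + u).
Proof.
move=> b0 s0 u0; rewrite /decay.
have ns : 0 <= n%:R * s by rewrite mulr_ge0.
have nu : 0 <= n%:R * u by rewrite mulr_ge0.
rewrite -powRM ?addr_ge0// !powRN lef_pV2 ?posrE ?powR_gt0//; last 2 first.
- by rewrite mulr_gt0//; lra.
- by rewrite mulrDr; lra.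
apply: ge0_ler_powR; rewrite ?nnegrE ?mulr_ge0//; [lra|rewrite mulrDr; lra|lra|lra|].
rewrite !mulrDr !mulrDl !mulr1 !mul1r.
have : 0 <= n%:R * s * (n%:R * u) by rewrite mulr_ge0.
lra.
Qed.

Lemma decay_homo b n s u : 0 <= b -> 0 <= s -> s <= u -> decay b n u <= decay b n s.
Proof.
move=> b0 s0 su; rewrite /decay !powRN.
have ns : 0 <= n%:R * s by rewrite mulr_ge0.
have nsu : n%:R * s <= n%:R * u by rewrite ler_wpM2l.
rewrite lef_pV2 ?posrE ?powR_gt0//; [|lra|lra].
by apply: ge0_ler_powR; rewrite ?nnegrE; lra.
Qed.

Lemma exprDn_le u v d : 0 <= u -> 0 <= v ->
  (u + v) ^+ d <= 2 ^+ d * (u ^+ d + v ^+ d).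
Proof.
move=> u0 v0; wlog uv : u v u0 v0 / u <= v.
  move=> H; have [uv|/ltW vu] := leP u v; first exact: H.
  by rewrite addrC [u ^+ d + _]addrC; exact: H.
rewrite (@le_trans _ _ ((2 * v) ^+ d))//.
  by rewrite lerXn2r ?nnegrE ?addr_ge0 ?mulr_ge0//; lra.
by rewrite exprMn ler_wpM2l ?exprn_ge0// lerDr exprn_ge0.
Qed.

(** Replacing the factors of a product one at a time. *)
Lemma prod_perturbation (I : Type) (s : seq I) (x y w : I -> R) M e :
  1 <= M -> 0 <= e -> (forall i, 0 <= w i) ->
  (forall i, `|x i| <= M * w i) -> (forall i, `|y i| <= M * w i) ->
  (forall i, `|x i - y i| <= e * w i) ->
  `|\prod_(i <- s) x i - \prod_(i <- s) y i| <=
  (size s)%:R * M ^+ size s * e * \prod_(i <- s) w i.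
Proof.
move=> M1 e0 w0 xM yM xye; have M0 : 0 <= M by exact: le_trans M1.
have xs t : `|\prod_(i <- t) x i| <= M ^+ size t * \prod_(i <- t) w i.
  elim: t => [|i t IH]; first by rewrite !big_nil normr1 expr0 mulr1.
  by rewrite !big_cons normrM exprS mulrACA ler_pM.
elim: s => [|i s IH]; first by rewrite !big_nil subrr normr0 !mul0r.
rewrite !big_cons; set X := \prod_(j <- s) x j; set Y := \prod_(j <- s) y j.
set W := \prod_(j <- s) w j.
have W0 : 0 <= W by apply: prodr_ge0.
have -> : x i * X - y i * Y = (x i - y i) * X + y i * (X - Y) by ring.
rewrite (le_trans (ler_normD _ _))// !normrM.
have h1 : `|x i - y i| * `|X| <= (e * w i) * (M ^+ size s * W) by rewrite ler_pM ?xs.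
have h2 : `|y i| * `|X - Y| <= (M * w i) * ((size s)%:R * M ^+ size s * e * W).
  by rewrite ler_pM.
rewrite (le_trans (lerD h1 h2))//= -natr1 exprS.
set n := (size s)%:R; set T := M ^+ size s.
have T0 : 0 <= T by exact: exprn_ge0.
have : (e * w i * T * W) * 1 <= (e * w i * T * W) * M by rewrite ler_wpM2l// !mulr_ge0.
lra.
Qed.

End ScalarEstimates.

Section GridKernels.
Variables (R : realType) (d N : nat).
Local Open Scope complex_scope.
Local Notation L := (2 * N).+1.
Local Notation X := {ffun 'I_d -> 'I_L}.
Local Notation normc := (@Normc.normc R).
Implicit Types (p q : 'I_L) (k x y z : X) (b r t : R) (n : nat).

Lemma average_bump b n p : 0 < b -> (0 < n <= L)%N ->
  L%:R^-1 * \sum_q bump_weight b n (chord R p q) <= 2 * (1 + b^-1).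
Proof.
move=> b0 nL.
have := @line_average R 1 N b ord0 n (fun=> 1) [ffun=> p] b0 nL (fun=> ler01).
under eq_bigr do rewrite ffunE mulr1.
move=> /le_trans; apply; rewrite mulrC ler_wpM2r ?addr_ge0 ?invr_ge0 ?(ltW b0)//.
by rewrite /line_max (_ : 2 = 1 + 1)// lerD// ergodic_max_le.
Qed.

(** One of the distances from [r] to [p] and to [q] is at least half the distance
    from [p] to [q], so one of the two factors may be taken out of the sum. *)
Lemma bump_convolution b n p q : 0 < b <= 1 -> (0 < n <= L)%N ->
  L%:R^-1 * \sum_r bump_weight b n (chord R p r) * bump_weight b n (chord R r q) <=
  16 * (1 + b^-1) * bump_weight b n (chord R p q).
Proof.
move=> /andP[b0 b1] nL; have b'0 := ltW b0.
set w := bump_weight b n; have w0 s : 0 <= w s by exact: bump_weight_ge0.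
have half s u : 0 <= s -> 0 <= u -> u <= 2 * s -> w s <= 4 * w u.
  move=> s0 u0 us; rewrite /w !bump_weightE mulrCA ler_wpM2l//.
  have h2 : decay b n s <= decay b n (u / 2) by apply: decay_homo => //; lra.
  apply: (le_trans h2); rewrite /decay !powRN.
  have nu : 0 <= n%:R * u by rewrite mulr_ge0.
  rewrite ler_pdivlMr; last by rewrite powR_gt0//; lra.
  rewrite mulrC ler_pdivrMr; last by rewrite powR_gt0//; lra.
  apply: (@le_trans _ _ ((2 * (1 + n%:R * (u / 2))) `^ (1 + b))).
    by apply: ge0_ler_powR; rewrite ?nnegrE; lra.
  rewrite powRM//; last by lra.
  rewrite ler_wpM2r ?powR_ge0//.
  rewrite (@le_trans _ _ (2 `^ 2%:R))//; first by rewrite ler_powR ?ler1n//; lra.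
  by rewrite powR_mulrn// expr2; lra.
apply: (@le_trans _ _ (L%:R^-1 * \sum_r 4 * w (chord R p q) *
    (w (chord R p r) + w (chord R r q)))).
  rewrite ler_wpM2l ?invr_ge0//; apply: ler_sum => r _.
  have := chord_triangle R p r q.
  have := chord_ge0 R p q; have := chord_ge0 R p r; have := chord_ge0 R r q.
  move: (chord R p q) (chord R p r) (chord R r q) => s u v v0 u0 s0 suv.
  have [uv|vu] := leP u v.
    have := ler_wpM2l (w0 u) (half v s v0 s0 ltac:(lra)).
    by have := mulr_ge0 (w0 s) (w0 v); lra.
  have := ler_wpM2r (w0 v) (half u s u0 s0 ltac:(lra)).
  by have := mulr_ge0 (w0 s) (w0 u); lra.
rewrite -mulr_sumr mulrCA big_split /= mulrDr.
have h1 := average_bump p b0 nL.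
have h2 : L%:R^-1 * \sum_r w (chord R r q) <= 2 * (1 + b^-1).
  by under eq_bigr do rewrite chordC; exact: average_bump.
rewrite (_ : 16 * (1 + b^-1) * _ = 4 * w (chord R p q) * (2 * (1 + b^-1) + 2 * (1 + b^-1))).
  by apply: ler_wpM2l; [rewrite mulr_ge0|exact: lerD].
ring.
Qed.

Lemma grid_weight_ge0 b n x y : 0 <= grid_weight b n x y :> R.
Proof. by apply: prodr_ge0 => i _; exact: bump_weight_ge0. Qed.

Lemma average_le (F G : X -> R) : (forall y, F y <= G y) -> average F <= average G.
Proof.
by move=> FG; rewrite /average ler_wpM2l ?invr_ge0 ?exprn_ge0// ler_sum.
Qed.

Lemma averageZ (F : X -> R) (a : R) : average (fun y => a * F y) = a * average F.
Proof. by rewrite /average -mulr_sumr mulrCA. Qed.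

Lemma average_exchange (F : X -> X -> R) :
  average (fun x => average (F x)) = average (fun y => average (F ^~ y)).
Proof.
have E (G : X -> X -> R) : average (fun x => average (G x)) =
    L%:R ^- d * (L%:R ^- d * \sum_x \sum_y G x y).
  by rewrite /average -mulr_sumr.
by rewrite !E exchange_big.
Qed.

Lemma grid_weight_convolution b n x z : 0 < b <= 1 -> (0 < n <= L)%N ->
  average (fun y => grid_weight b n x y * grid_weight b n y z) <=
  (16 * (1 + b^-1)) ^+ d * grid_weight b n x z.
Proof.
move=> b01 nL; rewrite /average /grid_weight.
rewrite (eq_bigr (fun y : X => \prod_i (bump_weight b n (chord R (x i) (y i)) *
  bump_weight b n (chord R (y i) (z i))))); last first.
  by move=> y _; rewrite -big_split.
rewrite -(bigA_distr_bigA (fun i q => bump_weight b n (chord R (x i) q) *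
  bump_weight b n (chord R q (z i)))).
have -> : L%:R ^- d = \prod_(i < d) L%:R^-1 :> R.
  by rewrite prodr_const card_ord exprVn.
have -> : (16 * (1 + b^-1)) ^+ d = \prod_(i < d) (16 * (1 + b^-1)) :> R.
  by rewrite prodr_const card_ord.
rewrite -!big_split /=; apply: ler_prod => i _.
apply/andP; split; last exact: bump_convolution.
rewrite mulr_ge0 ?invr_ge0// sumr_ge0// => q _.
by rewrite mulr_ge0 ?bump_weight_ge0.
Qed.

Lemma normc_product_kernel (A : 'I_d -> nat -> R) x y :
  normc (kernel (product_multiplier A) x y) =
  \prod_i `|even_kernel (A i) N (half_angle R (x i) (y i))|.
Proof. by rewrite product_kernel normc_real normr_prod. Qed.

Lemma product_kernel_le (A : 'I_d -> nat -> R) b n x y (C : R) :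
  (forall i, `|even_kernel (A i) N (half_angle R (x i) (y i))| <=
    C * bump_weight b n (chord R (x i) (y i))) ->
  normc (kernel (product_multiplier A) x y) <= C ^+ d * grid_weight b n x y.
Proof.
move=> AC; rewrite normc_product_kernel.
have -> : C ^+ d = \prod_(i < d) C by rewrite prodr_const card_ord.
by rewrite /grid_weight -big_split; apply: ler_prod => i _; rewrite normr_ge0 AC.
Qed.

Definition trapezoid_multiplier n : X -> R :=
  product_multiplier (fun=> trapezoid R n).

Definition riesz_multiplier (gamma alpha : R) (n : 'I_d -> nat) : X -> R :=
  product_multiplier (fun i => riesz_weight gamma alpha (n i)).

Definition gauss_multiplier r : X -> R := product_multiplier (fun=> gauss r).

Definition freq_norm k : R := Num.sqrt (\sum_i (absfreq (k i))%:R ^+ 2).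

Definition poisson_multiplier t k : R := expR (- (t * freq_norm k)).

Lemma gauss_multiplierE r k :
  gauss_multiplier r k = expR (- (r * freq_norm k) ^+ 2).
Proof.
rewrite exprMn sqr_sqrtr; last by apply: sumr_ge0 => i _; exact: sqr_ge0.
rewrite /gauss_multiplier /product_multiplier /gauss -expR_sum sumrN mulr_sumr.
by congr (expR (- _)); apply: eq_bigr => i _; rewrite exprMn.
Qed.

Lemma trapezoid_multiplier_kernel b n x y : 0 < b <= 1 -> (0 < n)%N ->
  (2 * n <= N)%N ->
  normc (kernel (trapezoid_multiplier n) x y) <= 240 ^+ d * grid_weight b n x y.
Proof.
by move=> b01 n0 nN; apply: product_kernel_le => i; exact: trapezoid_kernel_bound.
Qed.

Lemma gauss_multiplier_kernel r b n x y : 0 < r -> 0 < b <= 1 -> (0 < n)%N ->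
  (0 < N)%N ->
  normc (kernel (gauss_multiplier r) x y) <=
  (108 * ((r * n%:R)^-1 + (r * n%:R) `^ b)) ^+ d * grid_weight b n x y.
Proof.
move=> r0 b01 n0 N0; apply: product_kernel_le => i.
by apply: gauss_kernel_bound => //; rewrite addn1; exact: grid_sin0.
Qed.

Lemma riesz_multiplier_kernel gamma alpha tau b (n : 'I_d -> nat) m x y :
  1 <= gamma -> 0 < b -> b <= alpha -> b <= 1 -> 1 <= tau ->
  (forall i, (0 < n i <= N)%N) ->
  (forall i, (n i <= m)%N) -> (forall i, m%:R <= tau * (n i)%:R) ->
  normc (kernel (riesz_multiplier gamma alpha n) x y) <=
  (96 * (gamma * (alpha + 1)) * tau ^+ 2) ^+ d * grid_weight b m x y.
Proof.
move=> g1 b0 ba b1 t1 nN nm mn; apply: product_kernel_le => i.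
have c0 : 0 <= 96 * (gamma * (alpha + 1)).
  by rewrite !mulr_ge0 ?addr_ge0 ?(le_trans _ g1)// (le_trans (ltW b0)).
apply: le_trans (riesz_kernel_bound _ g1 b0 ba b1 (nN i)) _.
rewrite -[leRHS]mulrA ler_wpM2l//.
by apply: bump_weight_compare; rewrite ?chord_ge0 ?(ltW b0).
Qed.

End GridKernels.

Section PoissonKernel.
Variable R : realType.
Local Open Scope complex_scope.
Local Notation normc := (@Normc.normc R).
Local Notation grid d N := {ffun 'I_d -> 'I_(2 * N).+1}.

Lemma powR_exprn (u e : R) d : (u `^ e) ^+ d = u `^ (e * d%:R).
Proof. by rewrite -powR_mulrn ?powR_ge0// -powRrM. Qed.

(** The Poisson kernel at time [1 / n] is dominated by the product weight with
    exponent [1 + b], as soon as [b * d < 1]: subordination turns the product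
    bound for the heat kernel at time [(t / 2 v) ^ 2] into the integral of
    [v ^ d + v ^ (- b d)]. *)
Lemma poisson_kernel_bound d b : 0 < b <= 1 -> b * d%:R < 1 ->
  exists2 C, 0 <= C & forall N n (x y : grid d N), (0 < n)%N -> (0 < N)%N ->
    normc (kernel (@poisson_multiplier R d N n%:R^-1) x y) <=
    C * grid_weight b n x y.
Proof.
move=> b01 bd; have b0 : 0 <= b by case/andP: b01 => /ltW.
have bd0 : 0 <= b * d%:R by rewrite mulr_ge0.
have [C C0 HC] := @subordination R d (b * d%:R) bd0 bd.
pose D : R := 108 ^+ d * 4 ^+ d.
have D0 : 0 <= D by rewrite mulr_ge0 ?exprn_ge0.
exists (C * D); first exact: mulr_ge0.
move=> N n x y n0 N0; set W := grid_weight b n x y.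
have W0 : 0 <= W by exact: grid_weight_ge0.
have nR : 0 < n%:R :> R by rewrite ltr0n.
have fn0 (k : grid d N) : 0 <= freq_norm R k by exact: sqrtr_ge0.
have := HC _ (fun k => n%:R^-1 / 2 * freq_norm R k) (fun k => phase R k x y) 0 (D * W).
rewrite add0r -mulrA => H; apply: le_trans (H _ _ _).
- rewrite le_eqVlt; apply/orP; left; apply/eqP; congr normc.
  apply: eq_bigr => k _; congr ((expR _)%:C * _); congr (- _).
  by rewrite mulrA [2 * _]mulrC divfK.
- by move=> k; rewrite !mulr_ge0 ?invr_ge0 ?ler0n.
- exact: mulr_ge0.
move=> v v0; have v'0 := ltW v0; rewrite add0r.
pose r := n%:R^-1 / 2 / v.
have r0 : 0 < r by rewrite !divr_gt0// invr_gt0.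
apply: (@le_trans _ _ (normc (kernel (@gauss_multiplier R d N r) x y))).
  rewrite le_eqVlt; apply/orP; left; apply/eqP; congr normc.
  apply: eq_bigr => k _; rewrite gauss_multiplierE; congr ((expR (- _ ^+ 2))%:C * _).
  by rewrite /r mulrAC.
apply: le_trans (gauss_multiplier_kernel _ _ r0 b01 n0 N0) _.
rewrite -/W [leRHS]mulrAC; apply: ler_wpM2r => //.
have rn : r * n%:R = (2 * v)^-1 by rewrite /r; field; rewrite !gt_eqF.
rewrite rn invrK exprMn /D -mulrA ler_wpM2l ?exprn_ge0//.
apply: (le_trans (exprDn_le _ _ _)); [by rewrite mulr_ge0|exact: powR_ge0|].
rewrite (_ : 4 ^+ d = 2 ^+ d * 2 ^+ d :> R); last by rewrite -exprMn -natrM.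
rewrite -mulrA ler_wpM2l ?exprn_ge0// mulrDr exprMn lerD//.
rewrite (@le_trans _ _ (v `^ (- (b * d%:R))))//; last first.
  by rewrite ler_peMl ?powR_ge0// exprn_ege1// ler1n.
rewrite powR_exprn powRN -(powR_inv1 (mulr_ge0 _ v'0))// -powRrM mulN1r powRN.
rewrite lef_pV2 ?posrE ?powR_gt0 ?mulr_gt0//.
apply: ge0_ler_powR; rewrite ?nnegrE ?mulr_ge0//; lra.
Qed.

End PoissonKernel.

Section PoissonDefect.
Variable R : realType.
Local Open Scope complex_scope.
Local Notation normc := (@Normc.normc R).
Local Notation grid d N := {ffun 'I_d -> 'I_(2 * N).+1}.

Lemma multiplier_mode d N (a : grid d N -> R) x z :
  multiplier a (fun k => (mode R k z)^-1) x = kernel a x z.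
Proof.
apply: eq_bigr => k _; rewrite -(phase_mode R k x z) -mulrA; congr (_ * _).
by rewrite mulrC mulfK ?mode_neq0.
Qed.

(** The kernel of a product of multipliers is the convolution of the kernels,
    and the weights are stable under convolution. *)
Lemma kernelM_le d N b n (a a' : grid d N -> R) A A' x z :
  0 < b <= 1 -> (0 < n <= (2 * N).+1)%N -> 0 <= A -> 0 <= A' ->
  (forall x y, normc (kernel a x y) <= A * grid_weight b n x y) ->
  (forall x y, normc (kernel a' x y) <= A' * grid_weight b n x y) ->
  normc (kernel (fun k => a k * a' k) x z) <=
  A * A' * (16 * (1 + b^-1)) ^+ d * grid_weight b n x z.
Proof.
move=> b01 nL A0 A'0 aA aA'; rewrite -multiplier_mode.
apply: (le_trans (multiplierM_le _ _ _ aA)).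
rewrite -[leRHS]mulrA.
apply: le_trans (ler_wpM2l (mulr_ge0 A0 A'0) (grid_weight_convolution x z b01 nL)).
rewrite -averageZ; apply: average_le => y; rewrite multiplier_mode.
rewrite (_ : A * A' * _ = A * grid_weight b n x y * (A' * grid_weight b n y z)).
  by apply: ler_wpM2l; rewrite ?mulr_ge0 ?grid_weight_ge0.
ring.
Qed.

Lemma double_le_facts n N : (0 < n)%N -> (2 * n <= N)%N ->
  [/\ (0 < N)%N, (0 < n <= N)%N, (0 < 2 * n <= N)%N & (0 < n <= (2 * N).+1)%N].
Proof. by move=> n0 nN; split; lia. Qed.

(** In one coordinate a trapezoid is a combination of two triangles, for which
    the heat kernel has a second order defect; the coordinates are then changed
    one at a time.  [K] stands for any number above the constants of the
    one-dimensional bounds. *)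
Lemma gauss_defect_small d b N n r (x y : grid d N) (K : R) : 0 < b <= 1 ->
  0 < r -> (0 < n)%N -> (2 * n <= N)%N -> r * n%:R <= 1 -> 20 * 100 <= K ->
  normc (kernel (@trapezoid_multiplier R d N n) x y -
    kernel (product_multiplier (fun=> fun j => trapezoid R n j * gauss r j)) x y)
  <= d%:R * (2 * K) ^+ d * (K * (r * n%:R) ^+ 2) * grid_weight b n x y.
Proof.
move=> b01 r0 n0 nN rn1 K2000; have /andP[b0 b1] := b01; have b'0 := ltW b0.
have nR : 0 < n%:R :> R by rewrite ltr0n.
have rn0 : 0 < r * n%:R by rewrite mulr_gt0.
have K1 : 1 <= K by lra.
have [_ nN1 nN2 _] := double_le_facts n0 nN.
rewrite !product_kernel -rmorphB normc_real.
pose u i := half_angle R (x i) (y i).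
pose e := K * (r * n%:R) ^+ 2.
have K0 : 0 <= K by lra.
have w0 i : 0 <= bump_weight b n (chord R (x i) (y i)) by exact: bump_weight_ge0.
have e0 : 0 <= e by rewrite mulr_ge0 ?sqr_ge0.
have diff i : `|even_kernel (trapezoid R n) N (u i) -
     even_kernel (fun j => trapezoid R n j * gauss r j) N (u i)| <=
     e * bump_weight b n (chord R (x i) (y i)).
  rewrite -even_kernelB.
  have -> : (fun k => trapezoid R n k - trapezoid R n k * gauss r k) =
    (fun k => 2 * (triangle R (2 * n) k * (1 - gauss r k)) -
              triangle R n k * (1 - gauss r k)).
    by apply/funext => k; rewrite /trapezoid; ring.
  rewrite (even_kernelB (fun k => 2 * (triangle R (2 * n) k * (1 - gauss r k)))).
  rewrite (even_kernelZ 2 (fun k => triangle R (2 * n) k * (1 - gauss r k))).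
  rewrite (le_trans (ler_normB _ _))// normrM ger0_norm//.
  have h1 := @triangle_gauss_kernel R r b n N (u i) r0 b01 nN1 ltac:(lra).
  have h2 := @triangle_gauss_kernel R r b (2 * n) N (u i) r0 b01 nN2
    ltac:(rewrite natrM; lra).
  have h3 := @bump_weight_double R b n `|sin (u i)| b'0 (normr_ge0 _).
  have h4 : 92 * (r * (2 * n)%:R) ^+ 2 * bump_weight b (2 * n) `|sin (u i)| <=
      92 * (r * (2 * n)%:R) ^+ 2 * (2 * bump_weight b n `|sin (u i)|).
    by rewrite ler_wpM2l// mulr_ge0 ?sqr_ge0.
  have h5 : 20 * 100 * ((r * n%:R) ^+ 2 * bump_weight b n `|sin (u i)|) <=
      K * ((r * n%:R) ^+ 2 * bump_weight b n `|sin (u i)|).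
    by apply: ler_wpM2r => //; rewrite mulr_ge0 ?sqr_ge0 ?bump_weight_ge0.
  have h6 : 0 <= (r * n%:R) ^+ 2 * bump_weight b n `|sin (u i)|.
    by rewrite mulr_ge0 ?sqr_ge0 ?bump_weight_ge0.
  have sq2 : (r * (2 * n)%:R) ^+ 2 = 4 * (r * n%:R) ^+ 2 by rewrite natrM; ring.
  rewrite sq2 in h2 h4; rewrite /e /chord -/(u i) -mulrA.
  apply: le_trans h5.
  move: h1 h2 h4 h6; set B := bump_weight b n _; set B2 := bump_weight b (2 * n) _.
  move: ((r * n%:R) ^+ 2) => q.
  clear -b0; move: `|even_kernel _ _ _| `|even_kernel _ _ _| => E1 E2; lra.
have trap i : `|even_kernel (trapezoid R n) N (u i)| <=
    (2 * K) * bump_weight b n (chord R (x i) (y i)).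
  apply: (le_trans (trapezoid_kernel_bound _ b01 n0 nN)).
  by apply: ler_wpM2r; [exact: w0|lra].
have eK : e <= K by rewrite /e ler_piMr// exprn_ile1// ltW.
have trapg i : `|even_kernel (fun j => trapezoid R n j * gauss r j) N (u i)| <=
    (2 * K) * bump_weight b n (chord R (x i) (y i)).
  have := diff i; have := trapezoid_kernel_bound (u i) b01 n0 nN.
  set a := even_kernel (trapezoid R n) _ _; set a' := even_kernel _ _ _.
  have := ler_normB a (a - a'); rewrite subKr -/(chord R (x i) (y i)).
  have h1 := ler_wpM2r (w0 i) eK; have h2 := w0 i.
  have h3 : 240 * bump_weight b n (chord R (x i) (y i)) <=
    K * bump_weight b n (chord R (x i) (y i)) by rewrite ler_wpM2r//; lra.
  move: h1 h2 h3; move: (bump_weight _ _ _) => w.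
  move: (240 * w) (e * w) => w1 w2; lra.
have M1 : 1 <= 2 * K by lra.
have := @prod_perturbation R _ (enum 'I_d) _ _ _ _ _ M1 e0 w0 trap trapg diff.
by rewrite size_enum_ord !big_enum /= -/(grid_weight b n x y).
Qed.

(** The defect [1 - gauss] is of second order at low frequencies, hence the gain
    when [r n <= 1]; for [r n > 1] no cancellation is needed. *)
Lemma gauss_defect d b : 0 < b <= 1 ->
  exists2 C, 0 <= C & forall N n r (x y : grid d N),
    0 < r -> (0 < n)%N -> (2 * n <= N)%N -> b * d%:R < 1 ->
    normc (kernel (fun k => @trapezoid_multiplier R d N n k *
        (1 - gauss_multiplier r k)) x y) <=
    C * (r * n%:R) `^ (b * d%:R) * grid_weight b n x y.
Proof.
move=> b01; have /andP[b0 b1] := b01; have b'0 := ltW b0.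
have bd0 : 0 <= b * d%:R by rewrite mulr_ge0.
have [K K2000] : exists K : R, 20 * 100 <= K by exists (20 * 100).
have K0 : 0 <= K by lra.
pose C1 : R := d%:R * (2 * K) ^+ d * K.
pose C2 : R := K ^+ d + K ^+ d * K ^+ d * (16 * (1 + b^-1)) ^+ d.
have bV : 0 <= 1 + b^-1 by rewrite addr_ge0 ?invr_ge0.
have C10 : 0 <= C1 by rewrite !mulr_ge0 ?exprn_ge0 ?mulr_ge0.
have C20 : 0 <= C2 by rewrite addr_ge0 ?mulr_ge0 ?exprn_ge0// mulr_ge0.
exists (C1 + C2); first exact: addr_ge0.
move=> N n r x y r0 n0 nN bd; set W := grid_weight b n x y.
have W0 : 0 <= W by exact: grid_weight_ge0.
have nR : 0 < n%:R :> R by rewrite ltr0n.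
have rn0 : 0 < r * n%:R by rewrite mulr_gt0.
have P0 : 0 <= (r * n%:R) `^ (b * d%:R) by exact: powR_ge0.
have [N0 _ _ nL] := double_le_facts n0 nN.
have VE (k : grid d N) : trapezoid_multiplier R n k * gauss_multiplier r k =
    product_multiplier (fun=> fun j => trapezoid R n j * gauss r j) k.
  by rewrite /trapezoid_multiplier /product_multiplier -big_split.
have kE : kernel (fun k => @trapezoid_multiplier R d N n k *
        (1 - gauss_multiplier r k)) x y =
    kernel (@trapezoid_multiplier R d N n) x y -
    kernel (fun k => trapezoid_multiplier R n k * gauss_multiplier r k) x y.
  rewrite /kernel -sumrB; apply: eq_bigr => k _.
  by rewrite mulrBr mulr1 rmorphB mulrBl.
have powK (c : R) : 0 <= c -> c <= K -> c ^+ d <= K ^+ d.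
  by move=> c0 cK; rewrite lerXn2r.
rewrite kE; have [rn1|rn1] := leP (r * n%:R) 1; last first.
  have P1 : 1 <= (r * n%:R) `^ (b * d%:R).
    by rewrite -[leLHS](powRr0 (r * n%:R)) ler_powR// ltW.
  rewrite (le_trans (normcB _ _))//.
  have h1 (x' y' : grid d N) : normc (kernel (trapezoid_multiplier R n) x' y') <=
      K ^+ d * grid_weight b n x' y'.
    apply: (le_trans (trapezoid_multiplier_kernel x' y' b01 n0 nN)).
    by apply: ler_wpM2r; [exact: grid_weight_ge0|apply: powK; lra].
  have h2 (x' y' : grid d N) : normc (kernel (gauss_multiplier r) x' y') <=
      K ^+ d * (r * n%:R) `^ (b * d%:R) * grid_weight b n x' y'.
    apply: (le_trans (gauss_multiplier_kernel x' y' r0 b01 n0 N0)).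
    rewrite ler_wpM2r ?grid_weight_ge0// -powR_exprn -exprMn.
    have q1 : 1 <= (r * n%:R) `^ b by rewrite -[leLHS](powRr0 (r * n%:R)) ler_powR// ltW.
    have q2 : (r * n%:R)^-1 <= 1 by rewrite invf_le1// ltW.
    have q3 : 0 <= (r * n%:R)^-1 by rewrite invr_ge0 ltW.
    have q4 : 20 * 100 * (r * n%:R) `^ b <= K * (r * n%:R) `^ b by rewrite ler_wpM2r//; lra.
    apply: lerXn2r; rewrite ?nnegrE.
    - by rewrite mulr_ge0// addr_ge0// powR_ge0.
    - by rewrite mulr_ge0// powR_ge0.
    apply: le_trans q4; clear -q1 q2 q3.
    by move: (_ `^ _) q1 (_^-1) q2 q3 => s q1 s' q2 q3; lra.
  have h3 := @kernelM_le d N b n _ _ _ _ x y b01 nL (exprn_ge0 d K0)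
    (mulr_ge0 (exprn_ge0 d K0) P0) h1 h2.
  apply: (le_trans (lerD (h1 x y) h3)); rewrite -/W -[leLHS]mulrDl.
  apply: ler_wpM2r => //; rewrite [leRHS]mulrDl; apply: ler_wpDl.
    exact: mulr_ge0.
  rewrite /C2.
  rewrite [leRHS]mulrDl; apply: lerD; first by rewrite ler_peMr ?exprn_ge0.
  by rewrite mulrA [leLHS]mulrAC.
have -> : kernel (fun k => trapezoid_multiplier R n k * gauss_multiplier r k) x y =
    kernel (product_multiplier (fun=> fun j => trapezoid R n j * gauss r j)) x y.
  by apply: eq_bigr => k _; rewrite VE.
apply: (le_trans (gauss_defect_small x y b01 r0 n0 nN rn1 K2000)).
rewrite ler_wpM2r//.
rewrite mulrA -/C1 [leRHS]mulrDl ler_wpDr ?mulr_ge0// ler_wpM2l//.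
rewrite -powR_mulrn ?(ltW rn0)// ger_powR ?rn0//; lra.
Qed.

(** Low frequencies are almost preserved by a Poisson average at a time much
    smaller than the inverse frequency: this is the absorbing factor [e] of the
    bootstrap argument. *)
Lemma poisson_defect d b : 0 < b <= 1 -> b * d%:R < 1 ->
  exists2 C, 0 <= C & forall N n e (x y : grid d N),
    0 < e -> (0 < n)%N -> (2 * n <= N)%N ->
    normc (kernel (fun k => @trapezoid_multiplier R d N n k *
        (1 - poisson_multiplier (e / n%:R) k)) x y) <=
    C * e `^ (b * d%:R) * grid_weight b n x y.
Proof.
move=> b01 bd; have b0 : 0 <= b by case/andP: b01 => /ltW.
have bd0 : 0 <= b * d%:R by rewrite mulr_ge0.
have [C C0 HC] := @subordination R d (b * d%:R) bd0 bd.
have [D D0 HD] := gauss_defect d b01.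
exists (C * D); first exact: mulr_ge0.
move=> N n e x y e0 n0 nN; set W := grid_weight b n x y.
have W0 : 0 <= W by exact: grid_weight_ge0.
have P0 : 0 <= e `^ (b * d%:R) by exact: powR_ge0.
have nR : 0 < n%:R :> R by rewrite ltr0n.
have en0 : 0 < e / n%:R by exact: divr_gt0.
have fn0 (k : grid d N) : 0 <= freq_norm R k by exact: sqrtr_ge0.
pose V k := @trapezoid_multiplier R d N n k.
have VE (m : grid d N -> R) : kernel (fun k => V k * (1 - m k)) x y =
    kernel V x y + \sum_k (m k)%:C * (- ((V k)%:C * phase R k x y)).
  rewrite /kernel -big_split; apply: eq_bigr => k _.
  by rewrite mulrBr mulr1 rmorphB rmorphM mulrBl /= mulrN; congr (_ - _); ring.
have := HC _ (fun k => e / n%:R / 2 * freq_norm R k)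
  (fun k => - ((V k)%:C * phase R k x y)) (kernel V x y) (D * e `^ (b * d%:R) * W).
move=> H; rewrite -!mulrA; move: H; rewrite -!mulrA => H; apply: le_trans (H _ _ _).
- rewrite VE le_eqVlt; apply/orP; left; apply/eqP; congr (normc (_ + _)).
  apply: eq_bigr => k _; congr ((expR _)%:C * _); congr (- _).
  by rewrite !mulrA; congr (_ * _); field; rewrite gt_eqF.
- by move=> k; rewrite !mulr_ge0// ltW// ?invr_gt0.
- by rewrite !mulr_ge0.
move=> v v0; have v'0 := ltW v0.
pose r := e / n%:R / 2 / v.
have r0 : 0 < r by rewrite !divr_gt0.
have rn : r * n%:R = e * (2 * v)^-1 by rewrite /r; field; rewrite !gt_eqF.
have := HD N n r x y r0 n0 nN bd; rewrite VE rn => h.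
apply: le_trans (le_trans _ h) _.
  rewrite le_eqVlt; apply/orP; left; apply/eqP; congr (normc (_ + _)).
  apply: eq_bigr => k _; rewrite gauss_multiplierE; congr ((expR (- _ ^+ 2))%:C * _).
  by rewrite /r; field; rewrite !gt_eqF.
rewrite -/W -!mulrA; apply: ler_wpM2l => //.
rewrite [X in _ <= _ * X]mulrC [leRHS]mulrA; apply: ler_wpM2r => //.
rewrite powRM ?invr_ge0 ?mulr_ge0// ?(ltW e0)//; apply: ler_wpM2l => //.
rewrite ler_wpDl ?exprn_ge0//.
rewrite -(powR_inv1 (mulr_ge0 _ v'0))// -powRrM mulN1r !powRN.
rewrite lef_pV2 ?posrE ?powR_gt0 ?mulr_gt0//.
apply: ge0_ler_powR; rewrite ?nnegrE ?mulr_ge0//; lra.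
Qed.

End PoissonDefect.

(** * The pointwise estimate on the grid *)

Section Absorption.
Variable R : realType.
Implicit Types (r K M m : R).

(** Since [F] takes finitely many values, its largest one may be used as the
    bound [m]; a positive power of it can then be divided out. *)
Lemma absorb_power (I : finType) (F : I -> R) r K : 0 < r -> 0 <= K ->
  (forall i, 0 <= F i) ->
  (forall m, (forall i, F i <= m) -> forall i, F i <= K * m `^ (1 - r)) ->
  forall i, F i `^ r <= K.
Proof.
move=> r0 K0 F0 H i; set m := \big[Order.max/0]_i F i.
have Fm j : F j <= m by exact: le_bigmax.
have mK : m <= K * m `^ (1 - r).
  by apply: bigmax_le; [rewrite mulr_ge0 ?powR_ge0|move=> j _; exact: H].
have m0 : 0 <= m by exact: le_trans (F0 i) _.
apply: (@le_trans _ _ (m `^ r)); first by rewrite ge0_ler_powR ?nnegrE// ltW.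
move: m0; rewrite le_eqVlt => /orP[/eqP <-|m0]; first by rewrite powR0 ?gt_eqF.
rewrite -(ler_pM2r (powR_gt0 (1 - r) m0)) -powRD ?(gt_eqF m0) ?implybT//.
by rewrite addrC subrK powRr1// ltW.
Qed.

(** The largest value is finite, so half of it can be absorbed. *)
Lemma absorb_half (I : finType) (F : I -> R) M : 0 <= M -> (forall i, 0 <= F i) ->
  (forall m, (forall i, F i <= m) -> forall i, F i <= M + m / 2) ->
  forall i, F i <= 2 * M.
Proof.
move=> M0 F0 H i; set m := \big[Order.max/0]_i F i.
have Fm j : F j <= m by exact: le_bigmax.
have m0 : 0 <= m by exact: le_trans (F0 i) _.
have : m <= M + m / 2.
  by apply: bigmax_le; [rewrite addr_ge0 ?divr_ge0|move=> j _; exact: H].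
by have := Fm i; lra.
Qed.

Lemma powR_bigprod (I : Type) (s : seq I) (F : I -> R) r : (forall i, 0 <= F i) ->
  (\prod_(i <- s) F i) `^ r = \prod_(i <- s) F i `^ r.
Proof.
move=> F0; elim: s => [|i s IH]; first by rewrite !big_nil powR1.
by rewrite !big_cons powRM ?IH// prodr_ge0.
Qed.

End Absorption.

Section GridDecay.
Variables (R : realType) (d N : nat).
Local Open Scope complex_scope.
Local Notation L := (2 * N).+1.
Local Notation X := {ffun 'I_d -> 'I_L}.
Local Notation normc := (@Normc.normc R).
Implicit Types (x y z k : X) (b r l : R) (n m j J : nat) (c : X -> R[i]).

Definition grid_decay b n x y : R := \prod_i decay b n (chord R (x i) (y i)).

Lemma grid_decay_ge0 b n x y : 0 <= grid_decay b n x y.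
Proof. by apply: prodr_ge0 => i _; exact: decay_ge0. Qed.

Lemma grid_weightE b n x y : grid_weight b n x y = n%:R ^+ d * grid_decay b n x y.
Proof.
have -> : n%:R ^+ d = \prod_(i < d) n%:R :> R by rewrite prodr_const card_ord.
by rewrite -big_split.
Qed.

Lemma grid_decay_compare b n m x y l : 0 <= b <= 1 -> 1 <= l ->
  m%:R <= l * n%:R -> grid_decay b n x y <= (l ^+ 2) ^+ d * grid_decay b m x y.
Proof.
move=> b01 l1 ml.
have -> : (l ^+ 2) ^+ d = \prod_(i < d) l ^+ 2 by rewrite prodr_const card_ord.
rewrite /grid_decay -big_split; apply: ler_prod => i _.
by rewrite decay_ge0 decay_compare ?chord_ge0.
Qed.

Lemma grid_weight_compare b n m x y l : 0 <= b <= 1 -> 1 <= l -> (n <= m)%N ->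
  m%:R <= l * n%:R -> grid_weight b n x y <= (l ^+ 2) ^+ d * grid_weight b m x y.
Proof.
move=> b01 l1 nm ml; rewrite !grid_weightE mulrCA.
by rewrite ler_pM ?grid_decay_ge0 ?exprn_ge0// ?grid_decay_compare// lerXn2r ?nnegrE ?ler_nat.
Qed.

Lemma grid_decay_submul b n x y z : 0 <= b ->
  grid_decay b n x y * grid_decay b n y z <= grid_decay b n x z.
Proof.
move=> b0; rewrite /grid_decay -big_split; apply: ler_prod => i _.
rewrite mulr_ge0 ?decay_ge0//=.
apply: (le_trans (decay_submul _ b0 (chord_ge0 _ _ _) (chord_ge0 _ _ _))).
by apply: decay_homo; rewrite ?chord_ge0 ?chord_triangle.
Qed.

(** The power [r] of a weight of exponent [1 + b] has exponent [r (1 + b)],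
    which is admissible when it exceeds one. *)
Lemma grid_decay_powR b n x y r :
  n%:R ^+ d * grid_decay b n x y `^ r = grid_weight (r * (1 + b) - 1) n x y.
Proof.
rewrite powR_bigprod; last by move=> i; exact: decay_ge0.
have -> : n%:R ^+ d = \prod_(i < d) n%:R :> R by rewrite prodr_const card_ord.
rewrite -big_split /=.
apply: eq_bigr => i _; rewrite /bump_weight /decay -powRrM; congr (_ * _ `^ _).
ring.
Qed.

Lemma multiplierM_leZ (a a' : X -> R) c x (W : X -> X -> R) C :
  (forall x y, normc (kernel a x y) <= C * W x y) ->
  normc (multiplier (fun k => a k * a' k) c x) <=
  C * average (fun y => W x y * normc (multiplier a' c y)).
Proof.
move=> aW; rewrite -averageZ.
apply: (le_trans (multiplierM_le _ _ _ (W := fun x y => C * W x y) aW)).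
by apply: average_le => y; rewrite mulrA.
Qed.

Definition poisson_level c j z : R :=
  normc (multiplier (@poisson_multiplier R d N (2 ^ j)%:R^-1) c z).

Definition low_pass c j z : R :=
  normc (multiplier (trapezoid_multiplier R (2 ^ j)) c z).

Definition band_limited c m :=
  forall k, c k != 0 -> forall i, (absfreq (k i) <= m)%N.

Lemma poisson_multiplierS j k :
  @poisson_multiplier R d N (2 ^ j)%:R^-1 k =
  poisson_multiplier (2 ^ j.+1)%:R^-1 k * poisson_multiplier (2 ^ j.+1)%:R^-1 k.
Proof.
rewrite /poisson_multiplier -expRD; congr expR.
have : (2 ^ j)%:R != 0 :> R by rewrite pnatr_eq0 expn_eq0.
by rewrite expnS natrM => h; field.
Qed.

Lemma trapezoid_multiplier1 n k : (0 < n)%N ->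
  (forall i, (absfreq (k i) <= n)%N) -> trapezoid_multiplier R n k = 1.
Proof.
move=> n0 kn; rewrite /trapezoid_multiplier /product_multiplier big1// => i _.
exact: trapezoid1.
Qed.

Lemma trapezoid_multiplier0 n k i : (0 < n)%N ->
  (2 * n <= absfreq (k i))%N -> trapezoid_multiplier R n k = 0.
Proof.
move=> n0 kn; rewrite /trapezoid_multiplier /product_multiplier (bigD1 i)//=.
by rewrite trapezoid0// mul0r.
Qed.

End GridDecay.

Section Pointwise.
Variable R : realType.
Local Open Scope complex_scope.
Local Notation normc := (@Normc.normc R).
Local Notation grid d N := {ffun 'I_d -> 'I_(2 * N).+1}.

Lemma dyadic_le j J N : (j <= J)%N -> (2 * 2 ^ J <= N)%N ->
  (0 < 2 ^ j <= (2 * N).+1)%N.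
Proof.
move=> jJ JN; rewrite expn_gt0 /=; have : (2 ^ j <= 2 ^ J)%N by rewrite leq_exp2l.
by move: (2 ^ j)%N (2 ^ J)%N JN => a a'; lia.
Qed.

Lemma trapezoid_kernel_constant d b : 0 < b <= 1 ->
  exists2 T, 0 <= T & forall N n (x y : grid d N), (0 < n)%N -> (2 * n <= N)%N ->
    normc (kernel (trapezoid_multiplier R n) x y) <= T * grid_weight b n x y.
Proof.
move=> b01; exists (240 ^+ d); first by apply: exprn_ge0; exact: ler0n.
move=> N n x y; exact: trapezoid_multiplier_kernel.
Qed.

(** The semigroup property bounds a Poisson average by an average of Poisson
    averages at half the time; at the last level the band limitation replaces
    the semigroup property. *)
Lemma poisson_level_step d b : 0 < b <= 1 -> b * d%:R < 1 ->
  exists2 C, 0 <= C & forall N J j (c : grid d N -> R[i]) y,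
    (2 * 2 ^ J <= N)%N -> band_limited c (2 ^ J) -> (j <= J)%N ->
    exists2 j', (j <= j' <= minn j.+1 J)%N &
      poisson_level c j y <=
      C * average (fun z => grid_weight b (2 ^ j') y z * poisson_level c j' z).
Proof.
move=> b01 bd; have [P P0 HP] := poisson_kernel_bound b01 bd.
have [T T0 HT] := trapezoid_kernel_constant d b01.
exists (P + T); first exact: addr_ge0.
move=> N J j c y JN cJ; have N0 : (0 < N)%N.
  by rewrite (leq_trans _ JN)// muln_gt0 expn_gt0.
have avg0 j' : 0 <= average (fun z => grid_weight b (2 ^ j') y z * poisson_level c j' z).
  rewrite /average mulr_ge0 ?invr_ge0 ?exprn_ge0// sumr_ge0// => z _.
  by rewrite mulr_ge0 ?grid_weight_ge0 ?normc_ge0.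
rewrite leq_eqVlt => /predU1P[->|jJ].
  exists J; first by rewrite leqnn leq_min leqnn leqnSn.
  rewrite mulrDl; apply: ler_wpDl; first exact: (mulr_ge0 P0 (avg0 _)).
  rewrite /poisson_level (@eq_multiplier _ _ _ _ (fun k => trapezoid_multiplier R (2 ^ J) k *
      poisson_multiplier (2 ^ J)%:R^-1 k)); last first.
    by move=> k /cJ kJ; rewrite trapezoid_multiplier1 ?mul1r// expn_gt0.
  by apply: multiplierM_leZ => x' y'; apply: HT; rewrite ?expn_gt0.
exists j.+1; first by rewrite leqnSn leq_min leqnn.
rewrite mulrDl; apply: ler_wpDr; first exact: (mulr_ge0 T0 (avg0 _)).
rewrite /poisson_level (@eq_multiplier _ _ _ _ (fun k =>
    poisson_multiplier (2 ^ j.+1)%:R^-1 k * poisson_multiplier (2 ^ j.+1)%:R^-1 k)).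
  by apply: multiplierM_leZ => x' y'; apply: HP; rewrite ?expn_gt0.
by move=> k _; exact: poisson_multiplierS.
Qed.

(** A Poisson average anywhere, damped by the distance, is controlled by the
    maximal function of a power less than one: this is the substitute for
    subharmonicity that makes exponents [p <= 1] accessible. *)
Lemma poisson_level_tangential d b r : 0 < b <= 1 -> b * d%:R < 1 ->
  0 < r -> r < 1 -> 0 < r * (1 + b) - 1 ->
  exists2 C, 0 <= C & forall N J j (c : grid d N -> R[i]) (U : grid d N -> R) x y,
    (2 * 2 ^ J <= N)%N -> band_limited c (2 ^ J) ->
    (forall i z, (i <= J)%N -> poisson_level c i z <= U z) -> (j <= J)%N ->
    (grid_decay b (2 ^ j) x y * poisson_level c j y) `^ r <=
    C * strong_max (enum 'I_d) (fun z => U z `^ r) x.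
Proof.
move=> b01 bd r0 r1 e0; have b0 : 0 <= b by case/andP: b01 => /ltW.
have b01' : 0 <= b <= 1 by rewrite b0; case/andP: b01.
have [P P0 HP] := poisson_level_step b01 bd.
set e := r * (1 + b) - 1 in e0.
exists (((2 ^+ 2) ^+ d * P) * (1 + e^-1) ^+ d).
  by rewrite !mulr_ge0// exprn_ge0// addr_ge0// invr_ge0 ltW.
move=> N J j c U x y JN cJ cU jJ.
have U0 z : 0 <= U z `^ r by exact: powR_ge0.
set M := strong_max _ _ _; have M0 : 0 <= M by exact: strong_max_ge0.
pose F (jy : 'I_J.+1 * grid d N) := grid_decay b (2 ^ jy.1) x jy.2 * poisson_level c jy.1 jy.2.
have F0 jy : 0 <= F jy by rewrite mulr_ge0 ?grid_decay_ge0 ?normc_ge0.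
rewrite -ltnS in jJ; apply: (@absorb_power _ _ F r _ r0 _ F0 _ (Ordinal jJ, y)).
  by rewrite !mulr_ge0// exprn_ge0// addr_ge0// invr_ge0 ltW.
move=> m Fm [i z] {y j jJ}; rewrite /F /=.
have [i' /andP[ii' i'i] le_i] := HP N J i c z JN cJ (ltn_ord i).
have i'J : (i' <= J)%N by rewrite (leq_trans i'i)// geq_minr.
have gd : grid_decay b (2 ^ i) x z <= (2 ^+ 2) ^+ d * grid_decay b (2 ^ i') x z.
  apply: grid_decay_compare => //; first by rewrite ler1n.
  by rewrite -natrM -expnS ler_nat leq_exp2l// (leq_trans i'i)// geq_minl.
apply: (@le_trans _ _ (((2 ^+ 2) ^+ d * grid_decay b (2 ^ i') x z) * (P *
    average (fun v => grid_weight b (2 ^ i') z v * poisson_level c i' v)))).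
  by apply: ler_pM; rewrite ?grid_decay_ge0 ?normc_ge0.
rewrite (_ : _ * (P * _) = (2 ^+ 2) ^+ d * P * (grid_decay b (2 ^ i') x z *
    average (fun v => grid_weight b (2 ^ i') z v * poisson_level c i' v))); last by ring.
rewrite -[leRHS]mulrA -[leRHS]mulrA; apply: ler_wpM2l; first by rewrite mulr_ge0// exprn_ge0.
have nL := dyadic_le i'J JN.
have h := grid_average_le_strong_max x e0 nL U0.
rewrite mulrA [leRHS]mulrC; apply: le_trans (ler_wpM2l (powR_ge0 _ _) h).
rewrite -!averageZ; apply: average_le => v.
rewrite -(grid_decay_powR b _ x v r) grid_weightE.
set D := grid_decay b (2 ^ i') x z; set D' := grid_decay _ _ z v.
set u := poisson_level c i' v; set D'' := grid_decay b _ x v.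
have D''0 : 0 <= D'' by exact: grid_decay_ge0.
have u0 : 0 <= u by exact: normc_ge0.
have DD : D * D' <= D'' by exact: grid_decay_submul.
have uU : u <= U v by exact: cU.
(* The part [D'' * u] of the average is bounded by [m ^ (1 - r)] times its
   power [r], and only the latter is averaged. *)
have um : D'' * u <= m.
  by rewrite -ltnS in i'J; exact: Fm (Ordinal i'J, v).
set n := (2 ^ i')%:R ^+ d; have n0 : 0 <= n by exact: exprn_ge0.
rewrite (_ : D * _ = n * (D * D' * u)); last by ring.
rewrite (_ : _ * (n * _ * _) = n * (m `^ (1 - r) * (D'' `^ r * U v `^ r))); last by ring.
apply: ler_wpM2l => //; apply: (@le_trans _ _ (D'' * u)); first by rewrite ler_wpM2r.
have Du0 : 0 <= D'' * u by exact: mulr_ge0.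
rewrite -[leLHS]powRr1// -[X in _ `^ X <= _](subrK r 1) powRD; last first.
  by rewrite subrK oner_eq0.
apply: ler_pM; rewrite ?powR_ge0//.
  by apply: ge0_ler_powR; rewrite ?nnegrE ?subr_ge0 ?(ltW r1)// (le_trans Du0).
rewrite powRM// ler_wpM2l ?powR_ge0//.
by apply: ge0_ler_powR; rewrite ?nnegrE ?(ltW r0)// (le_trans u0).
Qed.

(** Inside the average, the power [1 - r] of the damped value is bounded by the
    tangential estimate and the power [r] is averaged. *)
Lemma poisson_level_average d b r : 0 < b <= 1 -> b * d%:R < 1 ->
  0 < r -> r < 1 -> 0 < r * (1 + b) - 1 ->
  exists2 C, 0 <= C & forall N J j (c : grid d N -> R[i]) (U : grid d N -> R) x,
    (2 * 2 ^ J <= N)%N -> band_limited c (2 ^ J) ->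
    (forall i z, (i <= J)%N -> poisson_level c i z <= U z) -> (j <= J)%N ->
    average (fun y => grid_weight b (2 ^ j) x y * poisson_level c j y) <=
    C * strong_max (enum 'I_d) (fun z => U z `^ r) x `^ r^-1.
Proof.
move=> b01 bd r0 r1 e0; have b0 : 0 <= b by case/andP: b01 => /ltW.
have [C C0 HC] := poisson_level_tangential b01 bd r0 r1 e0.
set e := r * (1 + b) - 1 in e0.
have E0 : 0 <= 1 + e^-1 by rewrite addr_ge0// invr_ge0 ltW.
(* [M ^ (1 / r)] is [M ^ ((1 - r) / r)], from the tangential estimate, times [M],
   from the average. *)
exists (C `^ ((1 - r) / r) * (1 + e^-1) ^+ d); first by rewrite mulr_ge0 ?powR_ge0 ?exprn_ge0.
move=> N J j c U x JN cJ cU jJ.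
have U0 z : 0 <= U z `^ r by exact: powR_ge0.
set M := strong_max _ _ _; have M0 : 0 <= M by exact: strong_max_ge0.
have nL := dyadic_le jJ JN.
have h := grid_average_le_strong_max x e0 nL U0; rewrite -/M in h.
have -> : M `^ r^-1 = M `^ ((1 - r) / r) * M.
  have rE : r^-1 = (1 - r) / r + 1 by field; rewrite gt_eqF.
  by rewrite {1}rE powRD ?powRr1// -rE invr_eq0 gt_eqF.
rewrite mulrACA -powRM//; apply: le_trans (ler_wpM2l (powR_ge0 _ _) h).
rewrite -averageZ; apply: average_le => v.
rewrite -(grid_decay_powR b _ x v r) grid_weightE.
set D := grid_decay b _ x v; set u := poisson_level c j v.
have D0 : 0 <= D by exact: grid_decay_ge0.
have u0 : 0 <= u by exact: normc_ge0.
have Du0 : 0 <= D * u by exact: mulr_ge0.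
set n := (2 ^ j)%:R ^+ d; have n0 : 0 <= n by exact: exprn_ge0.
rewrite (_ : _ * (n * _ * _) = n * ((C * M) `^ ((1 - r) / r) * (D `^ r * U v `^ r))); last by ring.
rewrite -mulrA; apply: ler_wpM2l => //.
rewrite -[leLHS]powRr1// -[X in _ `^ X <= _](subrK r 1) powRD; last first.
  by rewrite subrK oner_eq0.
apply: ler_pM; rewrite ?powR_ge0//.
  have rE : 1 - r = r * ((1 - r) / r) by field; rewrite gt_eqF.
  rewrite [X in _ `^ X <= _]rE [leLHS]powRrM; apply: ge0_ler_powR; rewrite ?nnegrE ?powR_ge0 ?mulr_ge0//.
  - by rewrite subr_ge0 ltW.
  - by rewrite invr_ge0 ltW.
  exact: HC cU jJ.
rewrite powRM// ler_wpM2l ?powR_ge0//.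
by apply: ge0_ler_powR; rewrite ?nnegrE ?(ltW r0) ?cU// (le_trans u0) ?cU.
Qed.

End Pointwise.

Section LowPass.
Variable R : realType.
Local Open Scope complex_scope.
Local Notation normc := (@Normc.normc R).
Local Notation grid d N := {ffun 'I_d -> 'I_(2 * N).+1}.

Lemma average_ge0 d N (F : grid d N -> R) : (forall y, 0 <= F y) -> 0 <= average F.
Proof. by move=> F0; rewrite /average mulr_ge0 ?invr_ge0 ?exprn_ge0// sumr_ge0. Qed.

Lemma averageD d N (F G : grid d N -> R) :
  average (fun y => F y + G y) = average F + average G.
Proof. by rewrite /average big_split mulrDr. Qed.

(** Averaging twice against a weight costs a constant, since weights are stable
    under convolution. *)
Lemma average_weight_twice d N b n x (G : grid d N -> R) :
  0 < b <= 1 -> (0 < n <= (2 * N).+1)%N -> (forall z, 0 <= G z) ->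
  average (fun v => grid_weight b n x v * average (fun z => grid_weight b n v z * G z)) <=
  (16 * (1 + b^-1)) ^+ d * average (fun z => grid_weight b n x z * G z).
Proof.
move=> b01 nL G0.
rewrite (_ : average _ = average (fun z =>
    average (fun v => grid_weight b n x v * grid_weight b n v z) * G z)); last first.
  transitivity (average (fun v : grid d N =>
      average (fun z => grid_weight b n x v * grid_weight b n v z * G z))).
    by congr average; apply/funext => v; rewrite -averageZ; congr average;
      apply/funext => z; rewrite mulrA.
  rewrite average_exchange; congr average; apply/funext => z.
  rewrite mulrC -averageZ; congr average; apply/funext => v; exact: mulrC.
rewrite -averageZ; apply: average_le => z; rewrite mulrA ler_wpM2r//.
exact: grid_weight_convolution.
Qed.

(** A trapezoid multiplier splits into a Poisson average at a much smaller time
    and a small multiple of the next trapezoid multiplier. *)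
Lemma low_pass_step d b : 0 < b <= 1 -> b * d%:R < 1 ->
  exists2 C, 0 <= C & forall s N J j (c : grid d N -> R[i]),
    (2 * 2 ^ (J + s) <= N)%N -> band_limited c (2 ^ J) -> (j <= J)%N ->
    exists2 j', (j <= j' <= minn j.+1 J)%N & forall v,
      low_pass c j v <=
      C * average (fun z => grid_weight b (2 ^ j) v z * poisson_level c (j + s) z) +
      C * (2 ^ s)%:R^-1 `^ (b * d%:R) *
        average (fun z => grid_weight b (2 ^ j) v z * low_pass c j' z).
Proof.
move=> b01 bd; have [P P0 HP] := poisson_defect b01 bd.
have [T T0 HT] := @trapezoid_kernel_constant R d b b01.
exists (P + T); first exact: addr_ge0.
move=> s N J j c JN cJ jJ.
have jN : (2 * 2 ^ j <= N)%N.
  by rewrite (leq_trans _ JN)// leq_mul2l leq_exp2l// (leq_trans jJ)// leq_addr.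
have n0 i : (0 < 2 ^ i)%N by rewrite expn_gt0.
have avg0 v (G : grid d N -> R) : (forall z, 0 <= G z) ->
    0 <= average (fun z => grid_weight b (2 ^ j) v z * G z).
  by move=> G0; apply: average_ge0 => z; rewrite mulr_ge0 ?grid_weight_ge0.
pose e : R := (2 ^ s)%:R^-1; have e0 : 0 < e by rewrite invr_gt0 ltr0n.
pose p (k : grid d N) := poisson_multiplier (e / (2 ^ j)%:R) k.
have pE : p = @poisson_multiplier R d N (2 ^ (j + s))%:R^-1.
  by rewrite /p /e expnD natrM invfM mulrC.
pose V i (k : grid d N) := trapezoid_multiplier R (2 ^ i) k.
have split j' : (forall k, c k != 0 -> V j k = V j k * V j' k) ->
      forall v, low_pass c j v <=
      (P + T) * average (fun z => grid_weight b (2 ^ j) v z * poisson_level c (j + s) z) +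
      (P + T) * e `^ (b * d%:R) *
        average (fun z => grid_weight b (2 ^ j) v z * low_pass c j' z).
  move=> VV v; have Vp k : c k != 0 ->
      V j k = V j k * p k + (V j k * (1 - p k)) * V j' k.
    by move=> /VV Vk; rewrite mulrAC -Vk; ring.
  rewrite /low_pass (eq_multiplier _ Vp) multiplierD.
  rewrite (le_trans (le_normcD _ _))// lerD//.
    rewrite mulrDl; apply: ler_wpDl; first by rewrite mulr_ge0// avg0// => z; exact: normc_ge0.
    by rewrite /poisson_level -pE; apply: multiplierM_leZ => x y; exact: HT.
  rewrite -mulrA mulrDl; apply: ler_wpDr.
    rewrite mulr_ge0// mulr_ge0 ?powR_ge0//; apply: avg0 => z; exact: normc_ge0.
  rewrite mulrA; apply: multiplierM_leZ => x y; exact: HP.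
move: jJ; rewrite leq_eqVlt => /predU1P[jJ|jJ].
  exists j; first by rewrite leqnn leq_min leqnSn jJ leqnn.
  apply: split => k /cJ kJ; rewrite jJ [V J k]trapezoid_multiplier1 ?mulr1//.
exists j.+1; first by rewrite leqnSn leq_min leqnn.
apply: split => k _.
have [kj|] := pselect (forall i, (absfreq (k i) <= 2 ^ j.+1)%N).
  by rewrite [V j.+1 k]trapezoid_multiplier1 ?mulr1.
move=> /existsNP[i /negP]; rewrite -ltnNge expnS => /ltnW ki.
by rewrite [V j k](trapezoid_multiplier0 _ _ ki)// mul0r.
Qed.

Lemma exists_small_power (a e : R) : 0 < a -> 0 < e ->
  exists s : nat, (2 ^ s)%:R^-1 `^ a <= e :> R.
Proof.
move=> a0 e0; pose x := e^-1 `^ a^-1; exists (Num.truncn x).+1.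
have x0 : 0 < x by rewrite powR_gt0// invr_gt0.
have h : x <= (2 ^ (Num.truncn x).+1)%:R.
  rewrite (le_trans (ltW (truncnS_gt x)))// ler_nat ltnW// ltn_expl//.
have n0 : 0 < (2 ^ (Num.truncn x).+1)%:R :> R by exact: lt_le_trans h.
rewrite -(powR_inv1 (ltW n0)) -powRrM mulN1r powRN.
rewrite -[leRHS]invrK lef_pV2 ?posrE ?powR_gt0 ?invr_gt0//.
have -> : e^-1 = x `^ a by rewrite /x -powRrM mulVf ?gt_eqF// powRr1// invr_ge0 ltW.
by apply: ge0_ler_powR => //; rewrite ?nnegrE ltW.
Qed.

(** The averages of the low-pass projections bound themselves with a factor
    smaller than one, up to averages of Poisson means. *)
Lemma low_pass_average d b r : (0 < d)%N -> 0 < b <= 1 -> b * d%:R < 1 ->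
  0 < r -> r < 1 -> 0 < r * (1 + b) - 1 ->
  exists s, exists2 C, 0 <= C &
  forall N J j (c : grid d N -> R[i]) (U : grid d N -> R) x,
    (2 * 2 ^ (J + s) <= N)%N -> band_limited c (2 ^ J) ->
    (forall i z, (i <= J + s)%N -> poisson_level c i z <= U z) -> (j <= J)%N ->
    average (fun y => grid_weight b (2 ^ j) x y * low_pass c j y) <=
    C * strong_max (enum 'I_d) (fun z => U z `^ r) x `^ r^-1.
Proof.
move=> d0 b01 bd r0 r1 e0; have b0 : 0 < b by case/andP: b01.
have b01' : 0 <= b <= 1 by rewrite ltW//; case/andP: b01.
have [C C0 HC] := low_pass_step b01 bd.
have [C' C'0 HC'] := poisson_level_average b01 bd r0 r1 e0.
have [K K0 HK] : exists2 K : R, 0 <= K & forall N n x (G : grid d N -> R),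
   (0 < n <= (2 * N).+1)%N -> (forall z, 0 <= G z) ->
   average (fun v => grid_weight b n x v * average (fun z => grid_weight b n v z * G z)) <=
   K * average (fun z => grid_weight b n x z * G z).
  exists ((16 * (1 + b^-1)) ^+ d).
    by rewrite exprn_ge0// mulr_ge0 ?ler0n// addr_ge0// invr_ge0 ltW.
  by move=> N n x G nL G0; exact: average_weight_twice.
have bd0 : 0 < b * d%:R by rewrite mulr_gt0 ?ltr0n.
pose F : R := (2 ^+ 2) ^+ d; have F0 : 0 <= F by exact: exprn_ge0.
have CKF : 0 <= C * K * F by rewrite !mulr_ge0.
have q0 : 0 < (2 * (C * K * F + 1))^-1.
  by rewrite invr_gt0 mulr_gt0// ltr_wpDl.
(* [s] makes the coefficient of the next projection at most one half, constants
   of comparison between the weights at consecutive scales included. *)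
have [s Hs] := exists_small_power bd0 q0; exists s.
pose E : R := ((2 ^ s)%:R ^+ 2) ^+ d; have E0 : 0 <= E by rewrite !exprn_ge0.
exists (2 * (C * K * E * C')); first by rewrite !mulr_ge0.
move=> N J j c U x JN cJ cU jJ.
set M := strong_max _ _ _ `^ _; have M0 : 0 <= M by exact: powR_ge0.
pose G (i : 'I_J.+1) := average (fun y => grid_weight b (2 ^ i) x y * low_pass c i y).
have G0 i : 0 <= G i.
  by apply: average_ge0 => y; rewrite mulr_ge0 ?grid_weight_ge0 ?normc_ge0.
rewrite -ltnS in jJ; rewrite -mulrA; apply: (@absorb_half _ _ G _ _ G0 _ (Ordinal jJ)).
  by rewrite !mulr_ge0.
move=> m Gm [i iJ] {j jJ}; rewrite /G /=; rewrite ltnS in iJ.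
have sJ : (J <= J + s)%N by exact: leq_addr.
have isJ : (i + s <= J + s)%N by rewrite leq_add2r.
have nL := dyadic_le (leq_trans iJ sJ) JN.
pose theta : R := (2 ^ s)%:R^-1 `^ (b * d%:R).
have th0 : 0 <= theta by exact: powR_ge0.
have m0 : 0 <= m by exact: le_trans (G0 (Ordinal (ltn0Sn J))) (Gm _).
have [j' /andP[ij' j'i] step] := HC s N J i c JN cJ iJ.
have j'J : (j' <= J)%N by rewrite (leq_trans j'i)// geq_minr.
apply: (@le_trans _ _ (
    C * average (fun v => grid_weight b (2 ^ i) x v *
      average (fun z => grid_weight b (2 ^ i) v z * poisson_level c (i + s) z)) +
    C * theta * average (fun v => grid_weight b (2 ^ i) x v *
      average (fun z => grid_weight b (2 ^ i) v z * low_pass c j' z)))).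
  rewrite -!averageZ -averageD; apply: average_le => v.
  rewrite mulrCA [X in _ <= _ + X]mulrCA -mulrDr.
  by apply: ler_wpM2l; [exact: grid_weight_ge0|exact: step].
apply: lerD.
  rewrite -!mulrA; apply: ler_wpM2l => //.
  apply: (le_trans (HK _ _ _ _ nL _)); first by move=> z; exact: normc_ge0.
  apply: ler_wpM2l => //; apply: le_trans (ler_wpM2l E0 (HC' _ _ _ _ _ _ JN _ cU isJ)).
    rewrite -averageZ; apply: average_le => z; rewrite mulrA ler_wpM2r ?normc_ge0//.
    by apply: grid_weight_compare => //; rewrite ?ler1n ?expn_gt0// ?leq_exp2l ?leq_addr// -natrM -expnD addnC.
  by move=> k /cJ kJ t; rewrite (leq_trans (kJ t))// leq_exp2l.
rewrite -mulrA mulrCA.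
apply: (@le_trans _ _ (theta * (C * (K * (F * m))))).
  apply: ler_wpM2l => //; apply: ler_wpM2l => //.
  apply: (le_trans (HK _ _ _ _ nL _)); first by move=> z; exact: normc_ge0.
  apply: ler_wpM2l => //; rewrite -ltnS in j'J.
  apply: le_trans (ler_wpM2l F0 (Gm (Ordinal j'J))).
  rewrite -averageZ; apply: average_le => z; rewrite mulrA ler_wpM2r ?normc_ge0//.
  apply: grid_weight_compare => //; rewrite ?ler1n ?leq_exp2l//.
  by rewrite -natrM -expnS ler_nat leq_exp2l// (leq_trans j'i)// geq_minl.
rewrite (_ : _ * (C * _) = (theta * (C * K * F)) * m); last by ring.
rewrite mulrC; apply: ler_wpM2l => //.
apply: (le_trans (ler_wpM2r CKF Hs)).
rewrite ler_pdivrMl; last by rewrite mulr_gt0// ltr_wpDl.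
by move: (C * K * F) CKF => q q'; lra.
Qed.

(** In the cone all the [n i] are comparable, hence comparable to one power of
    two; the least power above all of them is the right one. *)
Lemma exists_dyadic_scale d (tau : R) J (n : 'I_d -> nat) : 1 <= tau ->
  cone tau n -> (forall i, (n i <= 2 ^ J)%N) ->
  exists2 j, (j <= J)%N & forall i, (n i <= 2 ^ j)%N /\ (2 ^ j)%:R <= 2 * tau * (n i)%:R.
Proof.
move=> t1 [n1 nt] nJ; pose P j := [forall i, (n i <= 2 ^ j)%N].
have PJ : exists j, P j by exists J; apply/forallP.
case: (ex_minnP PJ) => j /forallP jP jmin; exists j; first by apply: jmin; apply/forallP.
move=> i; split=> //; have t0 : 0 < tau by lra.
have nt' l : (n l)%:R <= tau * (n i)%:R :> R.
  by have /andP[_] := nt l i; rewrite ler_pdivrMr// ltr0n n1.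
case: j jP jmin => [|j] jP jmin.
  have := nt' i; have : 1 <= (n i)%:R :> R by rewrite ler1n n1.
  move: ((n i)%:R : R) => m m1 _; have := mulr_ge0 (ltW t0) (_ : 0 <= m); rewrite expn0; nra.
have /forallPn[l] : ~~ P j by apply/negP => /jmin; rewrite ltnn.
rewrite -ltnNge expnS natrM => /ltnW lj.
have := nt' l; rewrite -(ler_nat R) in lj; lra.
Qed.

(** The Riesz multiplier is unchanged when multiplied by the trapezoid that
    equals one on its support, so a Riesz mean is an average, against the Riesz
    kernel, of a low-pass projection at the same scale. *)
Lemma riesz_pointwise d (b r gamma alpha tau : R) : (0 < d)%N -> 0 < b <= 1 -> b * d%:R < 1 ->
  0 < r -> r < 1 -> 0 < r * (1 + b) - 1 ->
  1 <= gamma -> b <= alpha -> 1 <= tau ->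
  exists s, exists2 C, 0 <= C &
  forall N J (c : grid d N -> R[i]) (U : grid d N -> R) n x,
    (2 * 2 ^ (J + s) <= N)%N -> band_limited c (2 ^ J) ->
    (forall i z, (i <= J + s)%N -> poisson_level c i z <= U z) ->
    cone tau n -> (forall i, (n i <= 2 ^ J)%N) ->
    normc (multiplier (riesz_multiplier gamma alpha n) c x) <=
    C * strong_max (enum 'I_d) (fun z => U z `^ r) x `^ r^-1.
Proof.
move=> d0 b01 bd r0 r1 e0 g1 ba t1; have /andP[b0 b1] := b01.
have [s [C C0 HC]] := low_pass_average d0 b01 bd r0 r1 e0.
have T1 : 1 <= 2 * tau by lra.
have [D D0 HD] : exists2 D : R, 0 <= D & forall N (n : 'I_d -> nat) m (x y : grid d N),
   (forall i, (0 < n i <= N)%N) -> (forall i, (n i <= m)%N) ->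
   (forall i, m%:R <= 2 * tau * (n i)%:R) ->
   normc (kernel (riesz_multiplier gamma alpha n) x y) <= D * grid_weight b m x y.
  exists ((96 * (gamma * (alpha + 1)) * (2 * tau) ^+ 2) ^+ d).
    rewrite exprn_ge0// mulr_ge0 ?exprn_ge0//; last by lra.
    by rewrite !mulr_ge0 ?ler0n//; lra.
  by move=> N n m x y nN nm mn; exact: riesz_multiplier_kernel.
exists s, (D * C); first exact: mulr_ge0.
move=> N J c U n x JN cJ cU nc nJ.
have [j jJ nj] := exists_dyadic_scale t1 nc nJ.
rewrite -mulrA; apply: le_trans (ler_wpM2l D0 (HC N J j c U x JN cJ cU jJ)).
have n1 i : (0 < n i)%N by case: nc.
have -> : multiplier (riesz_multiplier gamma alpha n) c x =
   multiplier (fun k => riesz_multiplier gamma alpha n k * trapezoid_multiplier R (2 ^ j) k) c x.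
  apply: eq_multiplier => k _.
  have [kj|] := pselect (forall i, (absfreq (k i) <= 2 ^ j)%N).
    by rewrite trapezoid_multiplier1 ?mulr1// expn_gt0.
  move=> /existsNP[i /negP]; rewrite -ltnNge => ki.
  suff -> : riesz_multiplier gamma alpha n k = 0 by rewrite mul0r.
  rewrite /riesz_multiplier /product_multiplier (bigD1 i)//= /riesz_weight.
  rewrite riesz_base_out ?n1 ?powR0 ?mul0r//; [by rewrite gt_eqF//; lra|by lra|].
  by rewrite (leq_trans (nj i).1)// ltnW.
apply: multiplierM_leZ => u v; apply: HD => i; rewrite ?n1 /=; [|by case: (nj i)..].
by rewrite (leq_trans (nJ i))// (leq_trans _ JN)// (@leq_trans (2 ^ (J + s)))// ?leq_exp2l ?leq_addr// leq_pmull.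
Qed.

(** Summing the pointwise estimate: the exponent [p / r] exceeds one, so the
    strong maximal operator is bounded.  For [p] infinite, a constant majorant
    is preserved by the maximal operator up to a factor. *)
Lemma riesz_grid_bound d (b r gamma alpha tau : R) : (0 < d)%N -> 0 < b <= 1 -> b * d%:R < 1 ->
  0 < r -> r < 1 -> 0 < r * (1 + b) - 1 ->
  1 <= gamma -> b <= alpha -> 1 <= tau ->
  exists s,
  (forall p, r < p -> exists2 C, 0 <= C &
    forall N J (c : grid d N -> R[i]) (U : grid d N -> R),
    (2 * 2 ^ (J + s) <= N)%N -> band_limited c (2 ^ J) ->
    (forall i z, (i <= J + s)%N -> poisson_level c i z <= U z) ->
    forall Q : grid d N -> R, (forall x, exists n, [/\ cone tau n,
      (forall i, (n i <= 2 ^ J)%N) &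
      Q x <= normc (multiplier (riesz_multiplier gamma alpha n) c x)]) ->
    (forall x, 0 <= Q x) ->
    \sum_x Q x `^ p <= C * \sum_x U x `^ p) /\
  exists2 C, 0 <= C &
    forall N J (c : grid d N -> R[i]) A,
    (2 * 2 ^ (J + s) <= N)%N -> band_limited c (2 ^ J) ->
    (forall i z, (i <= J + s)%N -> poisson_level c i z <= A) ->
    forall n x, cone tau n -> (forall i, (n i <= 2 ^ J)%N) ->
      normc (multiplier (riesz_multiplier gamma alpha n) c x) <= C * A.
Proof.
move=> d0 b01 bd r0 r1 e0 g1 ba t1.
have [s [C C0 HC]] := riesz_pointwise d0 b01 bd r0 r1 e0 g1 ba t1.
exists s; split.
  move=> p rp; have p0 : 0 < p by exact: lt_trans rp.
  have q1 : 1 < p / r by rewrite ltr_pdivlMr// mul1r.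
  exists (C `^ p * (2 `^ (p / r) * (2 * strong_type_const (p / r))) ^+ d).
    rewrite mulr_ge0 ?powR_ge0// exprn_ge0// mulr_ge0 ?powR_ge0// mulr_ge0//.
    exact: strong_type_const_ge0.
  move=> N J c U JN cJ cU Q HQ Q0.
  have Us0 z : 0 <= U z by rewrite (le_trans (normc_ge0 _) (cU 0%N z _)).
  have U0 z : 0 <= U z `^ r by exact: powR_ge0.
  have := strong_max_strong (enum 'I_d) q1 U0; rewrite size_enum_ord => h.
  have UE : \sum_x (U x `^ r) `^ (p / r) = \sum_x U x `^ p.
    apply: eq_bigr => x _; rewrite -powRrM; congr (_ `^ _).
    by field; rewrite gt_eqF.
  rewrite UE in h; rewrite -mulrA; apply: le_trans (ler_wpM2l (powR_ge0 C p) h).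
  rewrite mulr_sumr; apply: ler_sum => x _.
  have M0 : 0 <= strong_max (enum 'I_d) (fun z => U z `^ r) x by exact: strong_max_ge0.
  have -> : p / r = r^-1 * p by rewrite mulrC.
  rewrite powRrM -powRM ?powR_ge0//.
  apply: ge0_ler_powR; rewrite ?nnegrE ?Q0 ?mulr_ge0 ?powR_ge0 ?(ltW p0)//.
  by have [n [nc nJ /le_trans]] := HQ x; apply; exact: HC cU nc nJ.
exists (C * (2 ^+ d) `^ r^-1); first by rewrite mulr_ge0 ?powR_ge0.
move=> N J c A JN cJ cA n x nc nJ.
have A0 : 0 <= A by rewrite (le_trans (normc_ge0 _) (cA 0%N x _)).
apply: (le_trans (HC N J c (fun=> A) n x JN cJ cA nc nJ)).
rewrite -mulrA; apply: ler_wpM2l => //.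
have := @strong_max_le R d N (enum 'I_d) (fun=> A `^ r) _ x (powR_ge0 A r) (fun=> lexx _).
rewrite size_enum_ord => h.
have -> : A = (A `^ r) `^ r^-1 by rewrite -powRrM divff ?gt_eqF// powRr1.
rewrite -powRM ?powR_ge0 ?exprn_ge0//.
apply: ge0_ler_powR; rewrite ?nnegrE ?invr_ge0 ?(ltW r0)//.
- by apply: strong_max_ge0 => y; exact: powR_ge0.
- by rewrite mulr_ge0 ?powR_ge0// exprn_ge0.
by rewrite -(powRrM A) divff ?gt_eqF// powRr1.
Qed.

End LowPass.

(** * Rapidly decaying trigonometric series *)

Section FrequencyBoxes.
Variable d : nat.
Local Notation K := 'rV[int]_d.
Implicit Types (k : K) (N : nat).

Definition box_point N (q : {ffun 'I_d -> 'I_(2 * N).+1}) : K :=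
  \row_i ((q i)%:Z - N%:Z).

Definition box N : seq K :=
  [seq box_point q | q <- enum {ffun 'I_d -> 'I_(2 * N).+1}].

Lemma mem_box N k : (k \in box N) = [forall i, (absz (k ord0 i) <= N)%N].
Proof.
apply/mapP/forallP => [[q _ ->] i|kN].
  by rewrite mxE; have := ltn_ord (q i); move: (nat_of_ord (q i)) => m; lia.
have kb i : (absz (k ord0 i + N%:Z)%R < (2 * N).+1)%N by have := kN i; lia.
exists [ffun i => Ordinal (kb i)]; first by rewrite mem_enum.
apply/rowP => i; rewrite mxE ffunE /=; have := kN i.
by rewrite -[k 0 i]/(k ord0 i); move: (k ord0 i) => z; lia.
Qed.

Lemma box_point_inj N : injective (@box_point N).
Proof.
move=> q q' /rowP qq'; apply/ffunP => i; apply: val_inj => /=.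
by have := qq' i; rewrite !mxE; lia.
Qed.

Lemma box_uniq N : uniq (box N).
Proof. by rewrite map_inj_uniq ?enum_uniq//; exact: box_point_inj. Qed.

Lemma sum_box (V : nmodType) N (F : K -> V) :
  \sum_(k <- box N) F k = \sum_q F (@box_point N q).
Proof. by rewrite big_map big_enum. Qed.

Lemma freq_boxE N : freq_box (fun=> N) = [set` box N].
Proof.
by apply/seteqP; split => k /=; rewrite /freq_box /= mem_box => /forallP.
Qed.

Lemma fsum_box (V : nmodType) N (F : K -> V) :
  \sum_(k \in freq_box (fun=> N)) F k = \sum_(k <- box N) F k.
Proof. by rewrite freq_boxE -fsbig_seq// box_uniq. Qed.

Lemma fsum_freq_box (V : nmodType) N n (F : K -> V) : (forall i, (n i <= N)%N) ->
  \sum_(k \in freq_box n) F k =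
  \sum_(k <- box N | [forall i, (absz (k ord0 i) <= n i)%N]) F k.
Proof.
move=> nN; rewrite [RHS]bigfs ?box_uniq//.
  by apply: eq_fsbigl; apply/seteqP; split => k /=; rewrite /freq_box /= => /forallP.
move=> k /forallP kn /negP[]; rewrite mem_box; apply/forallP => i.
exact: leq_trans (kn i) (nN i).
Qed.

Lemma sum_box_widen (V : nmodType) M N (F : K -> V) : (M <= N)%N ->
  \sum_(k <- box M) F k = \sum_(k <- box N | k \in box M) F k.
Proof.
move=> MN; rewrite -[RHS]big_filter; apply: perm_big; apply: uniq_perm.
- exact: box_uniq.
- by rewrite filter_uniq// box_uniq.
move=> k; rewrite mem_filter; case: (boolP (k \in box M)) => //=.
rewrite !mem_box => /forallP kM; apply/esym/forallP => i.
exact: leq_trans (kM i) MN.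
Qed.

End FrequencyBoxes.

Section Decay.
Variables (R : realType) (d : nat).
Local Notation K := 'rV[int]_d.
Local Notation norm2 := (@l2norm R d).
Implicit Types (k : K) (A F G : K -> R) (s B : R).

Lemma l2norm_ge0 k : 0 <= norm2 k. Proof. exact: sqrtr_ge0. Qed.

Lemma le_l2norm k i : `|(k 0 i)%:~R : R| <= norm2 k.
Proof.
rewrite -sqrtr_sqr /l2norm ler_sqrt; last by apply: sumr_ge0 => j _; exact: sqr_ge0.
by rewrite (bigD1 i)//= lerDl sumr_ge0// => j _; exact: sqr_ge0.
Qed.

Lemma geometric_sum (q : R) N : 0 <= q < 1 ->
  \sum_(p < (2 * N).+1) q ^+ absz (p%:Z - N%:Z) <= 2 / (1 - q).
Proof.
move=> /andP[q0 q1]; have q'0 : 0 < 1 - q by rewrite subr_gt0.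
rewrite ler_pdivlMr//.
suff : (\sum_(p < (2 * N).+1) q ^+ absz (p%:Z - N%:Z)) * (1 - q) <= 2 - 2 * q ^+ N.+1.
  by move=> /le_trans; apply; rewrite gerBl mulr_ge0// exprn_ge0.
elim: N => [|N IH]; first by rewrite big_ord1 expr0 expr1; lra.
rewrite mulnS !addSn add0n big_ord_recl big_ord_recr /=.
rewrite subn0.
have -> : absz ((bump 0 (2 * N).+1)%:Z - N.+1%:Z) = N.+1 by rewrite /bump; lia.
rewrite (eq_bigr (fun p : 'I_(2 * N).+1 => q ^+ absz (p%:Z - N%:Z))); last first.
  by move=> p _; congr (q ^+ _); rewrite /bump /=; lia.
move: IH; rewrite (exprS q N.+1); move: (\sum_(p < _) _) (q ^+ N.+1) => S t; lra.
Qed.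

(** In each coordinate the exponential is dominated by a geometric sequence. *)
Lemma sum_box_expR s : 0 < s ->
  exists2 B, 0 <= B & forall N, \sum_(k <- box d N) expR (- (s * norm2 k)) <= B.
Proof.
move=> s0; pose q := expR (- (s / d%:R)).
exists ((2 / (1 - q)) ^+ d).
  have [d0|d0] := posnP d; first by rewrite d0 expr0.
  rewrite exprn_ge0// divr_ge0// subr_ge0 ltW// expR_lt1 oppr_lt0 divr_gt0// ltr0n//.
move=> N; rewrite sum_box.
apply: (@le_trans _ _ (\sum_(p : {ffun 'I_d -> 'I_(2 * N).+1}) \prod_i
    q ^+ absz ((p i)%:Z - N%:Z))).
  apply: ler_sum => p _; have [d0|d0] := posnP d.
    rewrite [X in _ <= X]big1; last first.
      by move=> i; have := ltn_ord i; rewrite [X in (_ < X)%N]d0.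
    by rewrite expR_le1 oppr_le0 mulr_ge0 ?l2norm_ge0// ltW.
  under eq_bigr do rewrite -expRM_natl.
  rewrite -expR_sum ler_expR -mulr_suml mulrN lerN2.
  rewrite mulrCA ler_wpM2l ?(ltW s0)// ler_pdivrMr ?ltr0n//.
  rewrite mulr_natr -[X in _ *+ X](card_ord d) -sumr_const; apply: ler_sum => i _.
  by have := le_l2norm (box_point p) i; rewrite mxE -intr_norm -natr_absz.
rewrite -(bigA_distr_bigA (fun i (p : 'I_(2 * N).+1) => q ^+ absz (p%:Z - N%:Z))) /=.
have [d0|d0] := posnP d.
  rewrite [X in X <= _]big1; last first.
    by move=> i; have := ltn_ord i; rewrite [X in (_ < X)%N]d0.
  by rewrite d0 expr0.
have -> : (2 / (1 - q)) ^+ d = \prod_(i < d) (2 / (1 - q)).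
  by rewrite prodr_const card_ord.
apply: ler_prod => i _; rewrite sumr_ge0 => [|p _]; last by rewrite exprn_ge0// expR_ge0.
apply: geometric_sum; rewrite expR_ge0 /= expR_lt1 oppr_lt0 divr_gt0// ltr0n//.
Qed.

Definition exp_decay A := exists s, 0 < s /\
  exists2 C, 0 <= C & forall k, `|A k| <= C * expR (- (s * norm2 k)).

Lemma exp_decay_le A F : exp_decay A -> (forall k, `|F k| <= `|A k|) -> exp_decay F.
Proof.
move=> [s [s0 [C C0 HA]]] FA; exists s; split=> //; exists C => // k.
exact: le_trans (FA k) (HA k).
Qed.

Lemma exp_decayM A F B : exp_decay A -> (forall k, `|F k| <= B) ->
  exp_decay (fun k => A k * F k).
Proof.
move=> [s [s0 [C C0 HA]]] FB; exists s; split=> //.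
have B0 : 0 <= B by exact: le_trans (FB 0).
exists (C * B) => [|k]; first exact: mulr_ge0.
by rewrite normrM mulrAC ler_pM.
Qed.

Lemma exp_decayD A F : exp_decay A -> exp_decay F -> exp_decay (fun k => A k + F k).
Proof.
move=> [s [s0 [C C0 HA]]] [s' [s'0 [C' C'0 HF]]]; exists (Num.min s s').
split; first by rewrite lt_min s0.
exists (C + C') => [|k]; first exact: addr_ge0.
rewrite mulrDl (le_trans (ler_normD _ _))// lerD//.
  apply: (le_trans (HA k)); rewrite ler_wpM2l// ler_expR lerN2.
  by rewrite ler_wpM2r ?l2norm_ge0// ge_min lexx.
apply: (le_trans (HF k)); rewrite ler_wpM2l// ler_expR lerN2.
by rewrite ler_wpM2r ?l2norm_ge0// ge_min lexx orbT.
Qed.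

(** A frequency is absorbed by half of the decay rate, so that all derivatives
    of a series with decaying coefficients have the same form. *)
Lemma exp_decay_freq A i : exp_decay A -> exp_decay (fun k => A k * (k 0 i)%:~R).
Proof.
move=> [s [s0 [C C0 HA]]]; have s2 : 0 < s / 2 by rewrite divr_gt0.
exists (s / 2); split=> //; exists (C * (s / 2)^-1).
  by rewrite mulr_ge0 ?invr_ge0// ltW.
move=> k; rewrite normrM.
have h1 : `|(k 0 i)%:~R : R| <= (s / 2)^-1 * expR (s / 2 * norm2 k).
  rewrite mulrC ler_pdivlMr// mulrC.
  apply: le_trans (ler_wpM2l (ltW s2) (le_l2norm k i)) _.
  by rewrite (le_trans _ (expR_ge1Dx _))// lerDr.
apply: (le_trans (ler_pM (normr_ge0 _) (normr_ge0 _) (HA k) h1)).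
rewrite mulrACA -expRD; apply: ler_wpM2l.
  by rewrite mulr_ge0 ?invr_ge0// ltW.
by rewrite ler_expR; move: (norm2 k) => n; lra.
Qed.

Lemma exp_decay_summable A : exp_decay A ->
  exists2 B, 0 <= B & forall N, \sum_(k <- box d N) `|A k| <= B.
Proof.
move=> [s [s0 [C C0 HA]]]; have [B B0 HB] := sum_box_expR s0.
exists (C * B) => [|N]; first exact: mulr_ge0.
apply: le_trans (ler_wpM2l C0 (HB N)); rewrite mulr_sumr.
by apply: ler_sum => k _; exact: HA.
Qed.

Lemma notin_box_l2norm k m : k \notin box d m -> m%:R <= norm2 k.
Proof.
rewrite leNgt => /negP km; apply/negP => mk; apply: km; rewrite mem_box.
apply/forallP => i; rewrite leqNgt; apply/negP => mi; move: mk; apply/negP.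
by rewrite -leNgt (le_trans _ (le_l2norm k i))// -intr_norm -natr_absz ler_nat ltnW.
Qed.

Lemma exp_decay_tail A : exp_decay A -> exists2 u : nat -> R, u @ \oo --> 0 &
  forall m N, \sum_(k <- box d N | k \notin box d m) `|A k| <= u m.
Proof.
move=> [s [s0 [C C0 HA]]]; have s2 : 0 < s / 2 by rewrite divr_gt0.
have [B B0 HB] := sum_box_expR s2.
exists (fun m => C * B * expR (- (s / 2)) ^+ m).
  rewrite -[X in _ --> X](mulr0 (C * B)); apply: cvgMl_tmp.
  by apply: cvg_expr; rewrite ger0_norm ?expR_ge0// expR_lt1 oppr_lt0.
move=> m N; rewrite mulrAC.
have E0 : 0 <= C * expR (- (s / 2)) ^+ m by rewrite mulr_ge0// exprn_ge0// expR_ge0.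
apply: le_trans (ler_wpM2l E0 (HB N)); rewrite mulr_sumr big_mkcond.
apply: ler_sum => k _; case: ifPn => [km|_]; last by rewrite mulr_ge0 ?expR_ge0.
apply: (le_trans (HA k)); rewrite -[leRHS]mulrA ler_wpM2l// -expRM_natl -expRD ler_expR.
have := ler_wpM2l (ltW s2) (notin_box_l2norm km).
by rewrite -mulr_natl; move: (norm2 k) (m%:R : R) => n t; lra.
Qed.

Definition box_lim F : R := limn (fun N => \sum_(k <- box d N) F k).

(** Absolute convergence: the partial sums of [F + |F|] and of [|F|] are
    monotone and bounded. *)
Lemma box_lim_cvg F : exp_decay F ->
  (fun N => \sum_(k <- box d N) F k) @ \oo --> box_lim F.
Proof.
move=> dF; have [B B0 HB] := exp_decay_summable dF.
have pos G : (forall k, 0 <= G k <= 2 * `|F k|) ->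
    cvgn (fun N => \sum_(k <- box d N) G k).
  move=> HG; apply: nondecreasing_is_cvgn.
    move=> M N MN; rewrite (sum_box_widen _ MN) [leRHS](bigID (mem (box d M)))/=.
    by rewrite lerDl sumr_ge0// => k _; case/andP: (HG k).
  exists (2 * B) => _ [N _ <-]; apply: le_trans (ler_wpM2l _ (HB N)) => //.
  by rewrite mulr_sumr; apply: ler_sum => k _; case/andP: (HG k).
have := is_cvgB (pos (fun k => F k + `|F k|) _) (pos (fun k => `|F k|) _).
rewrite (_ : _ - _ = (fun N => \sum_(k <- box d N) F k)).
  apply => k; last by rewrite normr_ge0 ler_peMl// ler1n.
  by have := ler_norm (F k); have := ler_norm (- F k); rewrite normrN; lra.
by apply/funext => N; rewrite !fctE -sumrB; apply: eq_bigr => k _; rewrite addrK.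
Qed.

Lemma box_limE F (l : R) : (fun N => \sum_(k <- box d N) F k) @ \oo --> l ->
  box_lim F = l.
Proof. exact: cvg_lim. Qed.

Lemma box_limD F G : exp_decay F -> exp_decay G ->
  box_lim (fun k => F k + G k) = box_lim F + box_lim G.
Proof.
move=> dF dG; apply: box_limE.
under eq_fun do rewrite big_split.
by apply: cvgD; exact: box_lim_cvg.
Qed.

Lemma box_limZ F (a : R) : exp_decay F -> box_lim (fun k => a * F k) = a * box_lim F.
Proof.
move=> dF; apply: box_limE.
under eq_fun do rewrite -mulr_sumr.
by apply: cvgMl_tmp; exact: box_lim_cvg.
Qed.

Lemma box_lim_le F (B : R) : exp_decay F ->
  (forall N, \sum_(k <- box d N) `|F k| <= B) -> `|box_lim F| <= B.
Proof.
move=> dF HB; have h : `|\sum_(k <- box d N) F k| @[N --> \oo] --> `|box_lim F|.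
  exact: cvg_norm (box_lim_cvg dF).
apply: (cvgr_to_le h); apply: nearW => N.
by rewrite (le_trans (ler_norm_sum _ _ _)).
Qed.

Lemma box_lim_finite F N : (forall k, k \notin box d N -> F k = 0) ->
  box_lim F = \sum_(k <- box d N) F k.
Proof.
move=> F0; apply: box_limE; apply: cvg_near_cst; near=> M.
have NM : (N <= M)%N by near: M; exact: nbhs_infty_ge.
rewrite (sum_box_widen _ NM) (bigID (mem (box d N)))/= [X in _ + X]big1 ?addr0//.
Unshelve. all: by end_near.
Qed.

End Decay.

Section CosineEstimates.
Variable R : realType.

Lemma cos_lipschitz (u v : R) : `|cos u - cos v| <= `|u - v|.
Proof.
wlog uv : u v / v <= u.
  move=> H; have [vu|/ltW uv] := leP v u; first exact: H.
  by rewrite distrC [leRHS]distrC; exact: H.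
rewrite [leRHS]ger0_norm ?subr_ge0//; apply/ler_normlP; split.
  have := @le_increment R (fun x => - cos x) id sin (fun=> 1) v u uv.
  rewrite opprK [- _ + _]addrC opprB; apply => t _; last exact: sin_le1.
  by rewrite -[sin t]opprK; exact: is_deriveN (is_derive_cos t).
have := @le_increment R cos id (fun x => - sin x) (fun=> 1) v u uv.
by apply => t _; rewrite lerNl; exact: sin_geN1.
Qed.

(** The error of the linear approximation is uniform in [u]; this is what allows
    a series to be differentiated term by term. *)
Lemma cos_taylor (u v : R) : `|cos (u + v) - cos u + v * sin u| <= v ^+ 2.
Proof.
wlog v0 : u v / 0 <= v.
  move=> H; have [v0|/ltW v0] := leP 0 v; first exact: H.
  have := H (- u) (- v); rewrite oppr_ge0 => /(_ v0).
  by rewrite -opprD !cosN sinN mulrNN sqrrN.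
have Dc (t : R) : is_derive t 1 (fun t => cos (u + t)) (- sin (u + t)).
  have h : is_derive t 1 (fun t => u + t) 1.
    by have := is_deriveD (is_derive_cst u t 1) (is_derive_id t 1); rewrite add0r.
  by have := is_derive1_comp (is_derive_cos (u + t)) h; rewrite mulr1.
have Df (t : R) : is_derive t 1 (fun t => cos (u + t) + t * sin u) (sin u - sin (u + t)).
  have h : is_derive t 1 (fun t : R => t * sin u) (sin u).
    have := is_deriveM (is_derive_id t 1) (is_derive_cst (sin u) t 1).
    by rewrite scaler0 add0r /GRing.scale /= mulr1.
  by have := is_deriveD (Dc t) h; rewrite [- sin _ + _]addrC.
have sinc (t : R) : 0 <= t <= v -> `|sin u - sin (u + t)| <= v.
  move=> /andP[t0 tv]; rewrite -!cosBpihalf.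
  by rewrite (le_trans (cos_lipschitz _ _))// opprB addrA subrK opprD addrA subrr add0r normrN ger0_norm.
have Dg (t : R) : is_derive t 1 (fun t : R => v * t) v.
  have := is_deriveZ v (is_derive_id t 1).
  by rewrite /GRing.scale /= mulr1.
have Dn (t : R) : is_derive t 1 (fun t => - (cos (u + t) + t * sin u)) (- (sin u - sin (u + t))).
  exact: is_deriveN (Df t).
apply/ler_normlP; split.
  have := le_increment v0 (fun t _ => Dn t) (fun t _ => Dg t)
    (fun t tv => (ler_normlP _ _ (sinc t tv)).1).
  rewrite addr0 mul0r addr0 mulr0 subr0 -expr2; lra.
have := le_increment v0 (fun t _ => Df t) (fun t _ => Dg t)
  (fun t tv => (ler_normlP _ _ (sinc t tv)).2).
by rewrite addr0 mul0r addr0 mulr0 subr0 -expr2; lra.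
Qed.

End CosineEstimates.

Section TrigSeries.
Variables (R : realType) (d : nat).
Local Notation K := 'rV[int]_d.
Local Notation norm2 := (@l2norm R d).
Implicit Types (k : K) (A th : K -> R) (x y : 'rV[R]_d) (s : seq 'I_d).

Definition dot k x : R := \sum_i (k 0 i)%:~R * x 0 i.

(** [cos_series A th] is [\sum_k A k cos (k . x + th k)]: partial derivatives
    multiply the coefficients by a frequency and advance the phases by a
    quarter turn. *)
Definition cos_term A th x k : R := A k * cos (dot k x + th k).

Definition cos_series A th x : R := box_lim (cos_term A th x).

Lemma cos_term_decay A th x : exp_decay A -> exp_decay (cos_term A th x).
Proof. by move=> dA; apply: (exp_decayM dA) => k; exact: cos_max. Qed.

Lemma cos_series_le A th x B : exp_decay A ->
  (forall N, \sum_(k <- box d N) `|A k| <= B) -> `|cos_series A th x| <= B.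
Proof.
move=> dA AB; apply: box_lim_le; first exact: cos_term_decay.
move=> N; apply: le_trans (AB N); apply: ler_sum => k _.
by rewrite normrM ler_piMr// cos_max.
Qed.

Lemma cos_seriesB A A' th x : exp_decay A -> exp_decay A' ->
  cos_series A th x - cos_series A' th x = cos_series (fun k => A k - A' k) th x.
Proof.
move=> dA dA'; have dN : exp_decay (fun k => - A' k).
  by apply: (exp_decay_le dA') => k; rewrite normrN.
rewrite /cos_series -mulN1r -box_limZ; last exact: cos_term_decay.
rewrite -box_limD; [|exact: cos_term_decay|]; last first.
  by apply: (exp_decay_le (cos_term_decay th x dA')) => k; rewrite mulN1r normrN.
by congr box_lim; apply/funext => k; rewrite /cos_term; ring.
Qed.

Lemma dotD k x y : dot k (x + y) = dot k x + dot k y.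
Proof. by rewrite /dot -big_split; apply: eq_bigr => i _; rewrite mxE mulrDr. Qed.

Lemma dot_delta k h i : dot k (h *: delta_mx 0 i) = (k 0 i)%:~R * h.
Proof.
rewrite /dot (bigD1 i)//= big1 ?addr0 => [|j ji]; rewrite !mxE ?eqxx ?mulr1//.
by rewrite (negbTE ji) andbF !mulr0.
Qed.

Lemma exp_decayZ A (a : R) : exp_decay A -> exp_decay (fun k => a * A k).
Proof.
by move=> dA; under eq_fun do rewrite mulrC; apply: (exp_decayM dA) => k; exact: lexx.
Qed.

Lemma near_coord x (h : R) : 0 < h ->
  nbhs x (fun y : 'rV[R]_d => forall i, `|x 0 i - y 0 i| <= h).
Proof.
move=> h0; apply: (@filter_forall _ _ _ (nbhs x) (nbhs_filter x)) => i.
by have /cvgrPdist_le/(_ _ h0) := @coord_continuous R 1 d 0 i x.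
Qed.

Lemma cos_series_continuous A th : exp_decay A -> continuous (cos_series A th).
Proof.
move=> dA x.
have [B B0 HB] : exists2 B, 0 <= B & forall i N,
    \sum_(k <- box d N) `|A k * (k 0 i)%:~R| <= B.
  have /choice[b Hb] : forall i, exists b, forall N,
      \sum_(k <- box d N) `|A k * (k 0 i)%:~R| <= b.
    by move=> i; have [b _ Hb] := exp_decay_summable (exp_decay_freq i dA); exists b.
  have b0 i : 0 <= b i by apply: le_trans (Hb i 0%N); apply: sumr_ge0.
  exists (\sum_i b i) => [|i N]; first by apply: sumr_ge0.
  by rewrite (le_trans (Hb i N))// (bigD1 i)//= lerDl sumr_ge0.
have lip y : `|cos_series A th x - cos_series A th y| <= \sum_i B * `|x 0 i - y 0 i|.
  have dx := cos_term_decay th x dA; have dy := cos_term_decay th y dA.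
  have -> : cos_series A th x - cos_series A th y =
      box_lim (fun k => cos_term A th x k - cos_term A th y k).
    rewrite /cos_series -mulN1r -box_limZ// -box_limD//.
      by congr box_lim; apply/funext => k; rewrite mulN1r.
    by apply: (exp_decay_le dy) => k; rewrite mulN1r normrN.
  apply: box_lim_le.
    apply: exp_decayD => //; apply: (exp_decay_le dy) => k; by rewrite normrN.
  move=> N; apply: (@le_trans _ _ (\sum_(k <- box d N) \sum_i
      `|A k * (k 0 i)%:~R| * `|x 0 i - y 0 i|)).
    apply: ler_sum => k _; rewrite /cos_term -mulrBr normrM.
    apply: le_trans (ler_wpM2l (normr_ge0 _) (cos_lipschitz _ _)) _.
    rewrite (_ : dot k x + th k - _ = \sum_i (k 0 i)%:~R * (x 0 i - y 0 i)); last first.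
      rewrite opprD addrACA subrr addr0 /dot -sumrB.
      by apply: eq_bigr => i _; rewrite mulrBr.
    apply: le_trans (ler_wpM2l (normr_ge0 _) (ler_norm_sum _ _ _)) _.
    by rewrite mulr_sumr; apply: ler_sum => i _; rewrite !normrM mulrA.
  rewrite exchange_big; apply: ler_sum => i _ /=.
  by rewrite -mulr_suml ler_wpM2r.
apply/(@cvgrPdist_le _ _ _ (nbhs x) (nbhs_filter x)) => e e0.
pose h := e / (B * d%:R + 1).
have D0 : 0 < B * d%:R + 1 by rewrite ltr_wpDl// mulr_ge0.
have h0 : 0 < h by rewrite divr_gt0.
apply: (@filterS _ (nbhs x) (nbhs_filter x) _ _ _ (near_coord x h0)) => y xy; apply: (le_trans (lip y)).
apply: (@le_trans _ _ (\sum_(i < d) B * h)).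
  by apply: ler_sum => i _; rewrite ler_wpM2l.
rewrite sumr_const card_ord -mulr_natr mulrAC /h mulrA ler_pdivrMr//.
by rewrite mulrC ler_wpM2l ?(ltW e0)// lerDl.
Qed.

(** Each difference quotient differs from the derivative by at most [|h|] times
    the squared frequency, which the decay of the coefficients makes
    summable. *)
Lemma cos_series_derive A th x i : exp_decay A ->
  is_derive x (delta_mx 0 i) (cos_series A th)
    (cos_series (fun k => A k * (k 0 i)%:~R) (fun k => th k + pi / 2) x).
Proof.
move=> dA; have dA1 := exp_decay_freq i dA; have dA2 := exp_decay_freq i dA1.
have [B B0 HB] := exp_decay_summable dA2.
set D := cos_series _ _ x.
have H : (fun h => h^-1 *: ((cos_series A th \o shift x) (h *: delta_mx 0 i) -
    cos_series A th x)) @ 0^' --> D.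
  apply/cvgrPdist_le => e e0.
  have D0 : 0 < B + 1 by rewrite ltr_wpDl.
  near=> h; have h0 : h != 0 by near: h; exact: nbhs_dnbhs_neq.
  have he : `|h| <= e / (B + 1).
    near: h; apply: dnbhs0_le; exact: divr_gt0.
  rewrite /= [h *: _ + x]addrC /D /cos_series.
  have d1 := cos_term_decay (fun k => th k + pi / 2) x dA1.
  have d2 := cos_term_decay th x dA.
  have d3 := cos_term_decay th (x + h *: delta_mx 0 i) dA.
  have d4 : exp_decay (fun k => - h^-1 * cos_term A th (x + h *: delta_mx 0 i) k).
    exact: exp_decayZ.
  have d5 : exp_decay (fun k => h^-1 * cos_term A th x k).
    exact: exp_decayZ.
  rewrite (_ : _ - h^-1 *: _ = box_lim (fun k => cos_term (fun k => A k * (k 0 i)%:~R)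
      (fun k => th k + pi / 2) x k + (- h^-1 * cos_term A th (x + h *: delta_mx 0 i) k +
      h^-1 * cos_term A th x k))); last first.
    rewrite box_limD//; last exact: exp_decayD.
    rewrite box_limD// !box_limZ//; congr (_ + _).
    by rewrite /GRing.scale /=; ring.
  apply: (@le_trans _ _ (`|h| * B)); last first.
    apply: (@le_trans _ _ (`|h| * (B + 1))); first by rewrite ler_wpM2l// lerDl.
    by rewrite -ler_pdivlMr.
  apply: box_lim_le; first by apply: exp_decayD => //; exact: exp_decayD.
  move=> N; apply: le_trans (ler_wpM2l (normr_ge0 h) (HB N)).
  rewrite mulr_sumr; apply: ler_sum => k _.
  rewrite /cos_term dotD dot_delta.
  set u := dot k x + th k; set n := (k 0 i)%:~R.
  rewrite [dot k x + (_ + pi / 2)]addrA cosDpihalf -/u [dot k x + _ + _]addrAC -/u.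
  have := cos_taylor u (n * h); set T := cos _ - _ + _ => hT.
  rewrite (_ : _ + _ = - (h^-1 * (A k * T))); last by rewrite /T; field.
  rewrite normrN !normrM normfV mulrCA [leRHS]mulrCA -!mulrA; apply: ler_wpM2l => //.
  rewrite ler_pdivrMl ?normr_gt0//; apply: (le_trans hT).
  rewrite exprMn -(real_normK (num_real n)) -(real_normK (num_real h)) !expr2.
  by rewrite le_eqVlt; apply/orP; left; apply/eqP; ring.
have C : derivable (cos_series A th) x (delta_mx 0 i) by apply/cvg_ex; exists D.
by split => //; exact: cvg_lim H.
Unshelve. all: by end_near.
Qed.

End TrigSeries.

(** * Distributions and their Poisson integrals *)

Section TestFunctions.
Variables (R : realType) (d : nat).
Local Open Scope complex_scope.
Local Notation K := 'rV[int]_d.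
Local Notation norm2 := (@l2norm R d).
Local Notation normc := (@Normc.normc R).
Implicit Types (k : K) (A th : K -> R) (x y : 'rV[R]_d) (s : seq 'I_d).

(** The series [\sum_k A k exp (- i (k . y + th k))]. *)
Definition exp_series A th y : R[i] :=
  cos_series A th y +i* cos_series A (fun k => th k + pi / 2) y.

Definition freq_prod s k : R := \prod_(i <- s) (k 0 i)%:~R.

Lemma freq_prod_decay A s : exp_decay A -> exp_decay (fun k => A k * freq_prod s k).
Proof.
move=> dA; elim: s => [|i s IH].
  by under eq_fun do rewrite /freq_prod big_nil mulr1.
by under eq_fun do rewrite /freq_prod big_cons mulrCA mulrC; exact: exp_decay_freq.
Qed.

Lemma iterated_cos_series A th s : exp_decay A ->
  iterated_partial s (cos_series A th) =
  cos_series (fun k => A k * freq_prod s k) (fun k => th k + pi / 2 *+ size s).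
Proof.
move=> dA; elim: s => [|i s IH] /=.
  congr cos_series; apply/funext => k; first by rewrite /freq_prod big_nil mulr1.
  by rewrite mulr0n addr0.
rewrite IH; apply/funext => x.
rewrite (@derive_val _ _ _ _ _ _ _ (cos_series_derive _ x i (freq_prod_decay s dA))).
congr (cos_series _ _ x); apply/funext => k.
  by rewrite /freq_prod big_cons mulrA mulrAC.
by rewrite (mulrSr (pi / 2)) addrA.
Qed.

Lemma smooth_cos_series A th : exp_decay A -> smooth (cos_series A th).
Proof.
move=> dA s; rewrite iterated_cos_series//; have dAs := freq_prod_decay s dA.
by split=> [|i x]; [exact: cos_series_continuous|apply: (@ex_derive _ _ _ _ _ _ _ (cos_series_derive _ x i dAs))].
Qed.

Lemma cos_series_periodic A th x i :
  cos_series A th (x + (2 * pi) *: delta_mx 0 i) = cos_series A th x.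
Proof.
congr box_lim; apply/funext => k; rewrite /cos_term dotD dot_delta; congr (_ * _).
rewrite addrAC; move: (dot k x + th k) => u.
have -> : (2 * pi : R) = pi *+ 2 by rewrite mulr_natl.
case: (k 0 i) => n.
  by rewrite mulr_natl (periodicn (@cosD2pi R)).
rewrite NegzE mulrNz mulNr mulr_natl -[in RHS](subrK (pi *+ 2 *+ n.+1) u).
by rewrite (periodicn (@cosD2pi R)).
Qed.

Lemma test_exp_series A th : exp_decay A -> test_function (exp_series A th).
Proof.
move=> dA; split; [move=> x i|exact: smooth_cos_series..].
by rewrite /exp_series !cos_series_periodic.
Qed.

Lemma cpartial_exp_series A th s : exp_decay A -> cpartial s (exp_series A th) =
  exp_series (fun k => A k * freq_prod s k) (fun k => th k + pi / 2 *+ size s).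
Proof.
move=> dA; apply/funext => x; rewrite /cpartial /=.
rewrite (_ : (fun y => complex.Re (exp_series A th y)) = cos_series A th)//.
rewrite (_ : (fun y => complex.Im (exp_series A th y)) =
  cos_series A (fun k => th k + pi / 2))// !iterated_cos_series//.
congr (_ +i* cos_series _ _ _); apply/funext => k; exact: addrAC.
Qed.

Lemma exp_seriesB A A' th y : exp_decay A -> exp_decay A' ->
  exp_series A th y - exp_series A' th y = exp_series (fun k => A k - A' k) th y.
Proof.
by move=> dA dA'; rewrite /exp_series -!cos_seriesB.
Qed.

Lemma exp_series_le A th y B : exp_decay A ->
  (forall N, \sum_(k <- box d N) `|A k| <= B) -> normc (exp_series A th y) <= 2 * B.
Proof.
move=> dA AB; apply: (le_trans (normc_le_ReIm _)) => /=.
have h1 := cos_series_le th y dA AB.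
have h2 := cos_series_le (fun k => th k + pi / 2) y dA AB.
lra.
Qed.

(** Convergence of the coefficients in [l_1], weighted by any product of
    frequencies, is convergence of test functions. *)
Lemma test_cvg_exp_series (A_ : nat -> K -> R) A th : exp_decay A ->
  (forall m, exp_decay (A_ m)) ->
  (forall s, exists2 u : nat -> R, u @ \oo --> 0 &
    forall m N, \sum_(k <- box d N) `|(A_ m k - A k) * freq_prod s k| <= u m) ->
  test_cvg (fun m => exp_series (A_ m) th) (exp_series A th).
Proof.
move=> dA dA_ H s e e0; have [u u0 Hu] := H s.
have e2 : 0 < e / 2 by rewrite divr_gt0.
move/cvgrPdist_lt : u0 => /(_ _ e2); apply: filterS => m um x.
rewrite !cpartial_exp_series// exp_seriesB; [|exact: freq_prod_decay..].
have dAA : exp_decay (fun k => A_ m k * freq_prod s k - A k * freq_prod s k).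
  apply: exp_decayD; first exact: freq_prod_decay.
  by apply: (exp_decay_le (freq_prod_decay s dA)) => k; rewrite normrN.
apply: (@le_lt_trans _ _ (2 * u m)).
  apply: exp_series_le => // N.
  by under eq_bigr do rewrite -mulrBl; exact: Hu.
have um0 : 0 <= u m by apply: le_trans (Hu m 0%N); exact: sumr_ge0.
by move: um; rewrite sub0r normrN ger0_norm//; lra.
Qed.

Lemma single_decay k (a : R) : exp_decay (fun l => (l == k)%:R * a).
Proof.
exists 1; split=> //; exists (`|a| * expR (norm2 k)); first by rewrite mulr_ge0 ?expR_ge0.
move=> l; rewrite mul1r -mulrA -expRD; have [->|_] := eqVneq l k.
  by rewrite mul1r subrr expR0 mulr1.
by rewrite mul0r normr0 mulr_ge0 ?expR_ge0.
Qed.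

Lemma single_series k (a : R) th y :
  exp_series (fun l => (l == k)%:R * a) th y =
  a%:C * cis (- th k) * expi_dot (- k) y.
Proof.
pose N := \max_i absz (k ord0 i).
have kN : k \in box d N by rewrite mem_box; apply/forallP => i; exact: leq_bigmax.
have S t : cos_series (fun l => (l == k)%:R * a) t y = a * cos (dot k y + t k).
  rewrite /cos_series (@box_lim_finite _ _ _ N); last first.
    move=> l lN; rewrite /cos_term; case: eqP => [lk|_]; last by rewrite !mul0r.
    by rewrite lk kN in lN.
  rewrite (bigD1_seq k) ?box_uniq//= big1 => [|l lk].
    by rewrite /cos_term eqxx mul1r addr0.
  by rewrite /cos_term (negbTE lk) !mul0r.
rewrite /exp_series !S addrA cosDpihalf.
have -> : expi_dot (- k) y = cis (- dot k y).
  rewrite /expi_dot /cis (_ : \sum_(i < d) _ = - dot k y)//.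
  by rewrite /dot -sumrN; apply: eq_bigr => i _; rewrite mxE mulrNz mulNr.
rewrite -mulrA -cisD -opprD /cis cosN sinN [th k + _]addrC.
by apply/eqP; rewrite eq_complex /= !mul0r subr0 addr0 !eqxx.
Qed.

End TestFunctions.

Section Distributions.
Variables (R : realType) (d : nat).
Local Open Scope complex_scope.
Local Notation K := 'rV[int]_d.
Local Notation norm2 := (@l2norm R d).
Local Notation normc := (@Normc.normc R).
Local Notation distribution := (@Defs.distribution R d).
Variable f : ('rV[R]_d -> R[i]) -> R[i].
Implicit Types (k : K) (A th : K -> R) (x y : 'rV[R]_d).

Lemma exp_series0 th : exp_series (fun _ : K => 0 : R) th = fun=> 0.
Proof.
have S t y : cos_series (fun _ : K => 0 : R) t y = 0.
  by rewrite /cos_series (@box_lim_finite _ _ _ 0) ?big1//= => k *; rewrite /cos_term mul0r.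
by apply/funext => y; rewrite /exp_series !S.
Qed.

Lemma zero_decay : exp_decay (fun _ : K => 0 : R).
Proof. by have := single_decay (0 : K) (0 : R); under eq_fun do rewrite mulr0. Qed.

Lemma distribution0 : distribution f -> f (fun=> 0) = 0.
Proof.
move=> [lin _]; have t0 : test_function (fun _ : 'rV[R]_d => 0 : R[i]).
  by rewrite -(exp_series0 (fun=> 0)); apply: test_exp_series; exact: zero_decay.
have := lin 1 _ _ t0 t0; under eq_fun do rewrite mulr0 addr0.
by rewrite mul1r => h; apply: (@addrI _ (f (fun=> 0))); rewrite addr0 -h.
Qed.

Lemma distribution_single k (a : R) th : distribution f ->
  f (exp_series (fun l => (l == k)%:R * a) th) =
  a%:C * cis (- th k) * fourier_coef f k.
Proof.
move=> df; have [lin _] := df.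
have t1 : test_function (expi_dot (- k) : 'rV[R]_d -> R[i]).
  rewrite (_ : expi_dot (- k) = exp_series (fun l => (l == k)%:R * 1) (fun=> 0)).
    by apply: test_exp_series; exact: single_decay.
  by apply/funext => y; rewrite single_series mul1r oppr0 cis0 mul1r.
have t0 : test_function (fun _ : 'rV[R]_d => 0 : R[i]).
  by rewrite -(exp_series0 (fun=> 0)); apply: test_exp_series; exact: zero_decay.
have := lin (a%:C * cis (- th k)) _ _ t1 t0; rewrite distribution0// addr0 => <-.
by congr f; apply/funext => y; rewrite addr0 single_series.
Qed.

Lemma distribution_finite (s : seq K) A th : distribution f -> exp_decay A -> uniq s ->
  f (exp_series (fun k => A k * (k \in s)%:R) th) =
  \sum_(k <- s) (A k)%:C * cis (- th k) * fourier_coef f k.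
Proof.
move=> df dA; have [lin _] := df.
have dAs t : exp_decay (fun k => A k * (k \in t)%:R).
  apply: (exp_decay_le dA) => k.
  by case: (k \in t); rewrite ?mulr1// mulr0 normr0.
elim: s => [_|k s IH /andP[ks us]].
  rewrite big_nil; under eq_fun do rewrite in_nil mulr0.
  by rewrite exp_series0 distribution0.
rewrite big_cons -IH// -distribution_single// -[f (exp_series _ th) in RHS]mul1r -lin; last 2 first.
- by apply: test_exp_series; exact: single_decay.
- exact: test_exp_series.
congr f; apply/funext => y; rewrite mul1r; apply/eqP; rewrite -subr_eq; apply/eqP.
rewrite exp_seriesB//; congr (exp_series _ _ y); apply/funext => l.
rewrite inE; have [->|lk] := eqVneq l k; last by rewrite subrr mul0r.
by rewrite (negbTE ks) mulr0 subr0 mulr1 mul1r.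
Qed.

(** A violation along a sequence [km m] of frequencies would make
    [exp (- i km m . y) / ((m + 1) exp (s |km m|))] tend to zero as test
    functions, while [f] stays larger than one on them. *)
Lemma fourier_coef_growth s : distribution f -> 0 < s ->
  exists2 C, 0 <= C & forall k, normc (fourier_coef f k) <= C * expR (s * norm2 k).
Proof.
move=> df s0; apply: contrapT => /forall2NP H.
have /choice[km Hkm] (m : nat) :
    exists k, m.+1%:R * expR (s * norm2 k) < normc (fourier_coef f k).
  have [//|/existsNP[k /negP]] := H m.+1%:R.
  by rewrite -ltNge; exists k.
pose a m : R := (m.+1%:R * expR (s * norm2 (km m)))^-1.
have a0 m : 0 < a m by rewrite invr_gt0 mulr_gt0// expR_gt0.
pose phi m := exp_series (fun l => (l == km m)%:R * a m) (fun=> 0 : R).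
have phi1 m : 1 < normc (f (phi m)).
  rewrite distribution_single// oppr0 cis0 mulr1 Normc.normcM normc_real gtr0_norm//.
  by rewrite mulrC ltr_pdivlMr ?mul1r// mulr_gt0// expR_gt0.
have [_ cont] := df.
have h : normc (f (phi m) - f (fun=> 0)) @[m --> \oo] --> (0 : R).
  apply: cont.
  - by move=> m; apply: test_exp_series; exact: single_decay.
  - by rewrite -(exp_series0 (fun=> 0)); apply: test_exp_series; exact: zero_decay.
  - rewrite -(exp_series0 (fun=> 0)); apply: test_cvg_exp_series.
    + exact: zero_decay.
    + by move=> m; exact: single_decay.
    move=> t.
    have [s' [s'0 [C C0 HC]]] : exp_decay (fun k => expR (- (s * norm2 k)) * freq_prod R t k).
      apply: freq_prod_decay; exists s; split=> //; exists 1 => // k.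
      by rewrite mul1r ger0_norm// expR_ge0.
    exists (fun m => C * m.+1%:R^-1).
      by rewrite -[X in _ --> X](mulr0 C); apply: cvgMl_tmp; exact: cvg_harmonic.
    move=> m N; apply: (@le_trans _ _ (\sum_(k <- box d N | k == km m) C * m.+1%:R^-1)).
      rewrite [leRHS]big_mkcond; apply: ler_sum => k _; rewrite subr0.
      case: eqP => [->|_]; last by rewrite !mul0r normr0.
      rewrite mul1r /a invfM -mulrA normrM [`|_^-1|]ger0_norm ?invr_ge0// mulrC.
      rewrite ler_wpM2r ?invr_ge0// -expRN (le_trans (HC _))// ler_piMr//.
      by rewrite expR_le1 oppr_le0 mulr_ge0 ?l2norm_ge0// ltW.
    rewrite -big_filter; have : (size [seq k <- box d N | k == km m] <= 1)%N.
      by rewrite size_filter; have := count_uniq_mem (km m) (box_uniq d N); move=> ->; case: (_ \in _).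
    case: [seq k <- _ | _] => [|k [|]]//= _; first by rewrite big_nil mulr_ge0 ?invr_ge0.
    by rewrite big_seq1.
move/cvgrPdist_lt : h => /(_ _ ltr01) [m _ /(_ m (leqnn m))] /=.
rewrite distribution0// subr0 sub0r normrN ger0_norm ?normc_ge0// => /(lt_trans (phi1 m)).
by rewrite ltxx.
Qed.

Definition poisson_sum (t : R) N x : R[i] :=
  \sum_(k <- box d N) (expR (- (t * norm2 k)))%:C * fourier_coef f k * expi_dot k x.

Lemma poisson_decay (t : R) : 0 < t -> exp_decay (fun k => expR (- (t * norm2 k))).
Proof.
move=> t0; exists t; split=> //; exists 1 => // k.
by rewrite mul1r ger0_norm// expR_ge0.
Qed.

Lemma poisson_kernelE (t : R) x y : 0 < t -> poisson_kernel t (x - y) =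
  exp_series (fun k => expR (- (t * norm2 k))) (fun k => - dot k x) y.
Proof.
move=> t0; rewrite /poisson_kernel /sum_Zd /exp_series /cos_series /box_lim.
have dotB k : dot k y + - dot k x = - dot k (x - y).
  by rewrite /dot -!sumrN -big_split; apply: eq_bigr => i _; rewrite !mxE /=; ring.
congr (_ +i* _); congr (limn _); apply/funext => N; rewrite fsum_box raddf_sum.
  apply: eq_bigr => k _; rewrite /cos_term dotB cosN /= !mul0r subr0.
  by rewrite mulNr.
apply: eq_bigr => k _; rewrite /cos_term addrA dotB cosDpihalf sinN opprK /=.
by rewrite mul0r addr0 mulNr.
Qed.

(** The truncated Poisson kernels converge as test functions. *)
Lemma poisson_sum_cvg (t : R) x : distribution f -> 0 < t ->
  normc (poisson_sum t N x - convolution f (poisson_kernel t) x) @[N --> \oo] --> (0 : R).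
Proof.
move=> df t0; have [_ cont] := df; have dA := poisson_decay t0.
pose A k := expR (- (t * norm2 k)); pose th k := - dot k x.
have dAb N : exp_decay (fun k => A k * (k \in box d N)%:R).
  apply: (exp_decay_le dA) => k.
  by case: (k \in box d N); rewrite ?mulr1// mulr0 normr0.
have E : (fun y => poisson_kernel t (x - y)) = exp_series A th.
  by apply/funext => y; exact: poisson_kernelE.
rewrite /convolution E.
rewrite (_ : (fun N => normc _) = fun N =>
   normc (f (exp_series (fun k => A k * (k \in box d N)%:R) th) - f (exp_series A th))).
  apply: cont; [by move=> N; exact: test_exp_series|exact: test_exp_series|].
  apply: test_cvg_exp_series => // s.
  have [u u0 Hu] := exp_decay_tail (freq_prod_decay s dA).
  exists u => // m N; apply: le_trans (Hu m N); rewrite [leRHS]big_mkcond.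
  apply: ler_sum => k _; case: (boolP (k \in box d m)) => km /=.
    by rewrite mulr1 subrr mul0r normr0.
  by rewrite mulr0 sub0r mulNr normrN.
apply/funext => N; rewrite distribution_finite ?box_uniq//; congr (normc (_ - _)).
by apply: eq_bigr => k _; rewrite /th opprK mulrAC.
Qed.

(** The growth of the coefficients is offset by half of the decay of the kernel
    at time [e], so the remainder is uniform in the point and in the times
    beyond [e]. *)
Lemma poisson_sum_tail (e : R) : distribution f -> 0 < e ->
  exists2 u : nat -> R, u @ \oo --> 0 & forall N t x, e <= t ->
    normc (poisson_sum t N x) <=
    normc (convolution f (poisson_kernel t) x) + u N.
Proof.
move=> df e0; have e2 : 0 < e / 2 by rewrite divr_gt0.
have [C C0 HC] := fourier_coef_growth df e2.
have dA : exp_decay (fun k => expR (- (e * norm2 k)) * normc (fourier_coef f k)).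
  exists (e / 2); split=> //; exists C => // k.
  rewrite ger0_norm; last by rewrite mulr_ge0 ?expR_ge0 ?normc_ge0.
  rewrite mulrC; apply: (le_trans (ler_wpM2r (expR_ge0 _) (HC k))).
  by rewrite -[leLHS]mulrA -expRD ler_wpM2l// ler_expR; move: (norm2 k) => n; lra.
have [u u0 Hu] := exp_decay_tail dA; exists u => // N t x et.
have t0 : 0 < t by exact: lt_le_trans et.
have h (M : nat) : (N <= M)%N -> normc (poisson_sum t N x) <=
    u N + normc (poisson_sum t M x - convolution f (poisson_kernel t) x) +
    normc (convolution f (poisson_kernel t) x).
  move=> NM; set c := convolution _ _ _.
  have hN : normc (poisson_sum t M x - poisson_sum t N x) <= u N.
    rewrite /poisson_sum [X in _ - X](sum_box_widen _ NM).
    rewrite (bigID (mem (box d N)))/= [X in X - _]addrC addrK.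
    apply: (le_trans (normc_sum _ _ _)); apply: le_trans (Hu N M).
    apply: ler_sum => k _; rewrite !Normc.normcM normc_real.
    rewrite [normc (expi_dot k x)]normc_cis mulr1 normrM.
    rewrite (ger0_norm (normc_ge0 _)) ler_wpM2r ?normc_ge0//.
    by rewrite !ger0_norm ?expR_ge0// ler_expR lerN2 ler_wpM2r// l2norm_ge0.
  have -> : poisson_sum t N x =
      c - ((poisson_sum t M x - poisson_sum t N x) - (poisson_sum t M x - c)).
    by ring.
  have h1 := normcB c ((poisson_sum t M x - poisson_sum t N x) - (poisson_sum t M x - c)).
  have h2 := normcB (poisson_sum t M x - poisson_sum t N x) (poisson_sum t M x - c).
  lra.
have h0 := poisson_sum_cvg x df t0.
rewrite addrC; apply/ler_addgt0Pr => z z0.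
move/cvgrPdist_lt : h0 => /(_ _ z0) [M _ HM].
have := HM (maxn M N) (leq_maxl _ _); rewrite /= sub0r normrN ger0_norm ?normc_ge0// => hM.
have := h (maxn M N) (leq_maxr _ _); lra.
Qed.

End Distributions.

(** * Transference from the grid to the torus *)

Section CircleShift.
Variable R : realType.
Local Notation mR := (measurableTypeR R).
Local Notation lambda := (@lebesgue_measure R).

Lemma measurable_shift (a : R) : measurable_fun [set: mR] (fun t : mR => t + a : mR).
Proof. by apply: measurable_funD => //; exact: measurable_cst. Qed.

Lemma lebesgue_shift (a : R) (A : set mR) : measurable A ->
  lambda [set t | A (t + a)] = lambda A.
Proof.
move=> mA.
pose phi : mR -> mR := fun t => t + a.
have H := @lebesgue_measure_unique R (pushforward lambda phi) _ A mA.
apply/esym; apply: (H (measurable_shift a)) => _ [[x y] _ <-] /=.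
rewrite /pushforward; have -> : phi @^-1` `]x, y] = `]x - a, y - a]%classic.
  by apply/seteqP; split => t /=; rewrite !in_itv /= ltrBlDr lerBrDr.
rewrite !lebesgue_measure_itv /= !lte_fin ltrD2r; case: ifP => // _.
by rewrite -!EFinB; congr EFin; ring.
Qed.

Lemma circleE (A : set mR) : measurable A ->
  lebesgue_circle A = lambda (A `&` `]- pi, pi]).
Proof.
move=> mA; rewrite /lebesgue_circle /= /mfrestr /mrestr.
have ppi : - pi <= pi :> R by rewrite -subr_ge0 opprK addr_ge0// pi_ge0.
rewrite -(setU1itv false) ?bnd_simp//; rewrite setIUr setUC measureU //.
- rewrite [X in (_ + X)%E](_ : _ = 0%E) ?adde0//.
    apply: (@subset_measure0 _ _ _ lambda _ [set - pi]) => //.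
    + by apply: measurableI => //; exact: measurable_set1.
    + exact: lebesgue_measure_set1.
- exact: measurableI.
- by apply: measurableI => //; exact: measurable_set1.
by apply/seteqP; split => // t [[_ /=]] + [_ /= te]; rewrite te in_itv /= ltxx.
Qed.

(** The rotation of the circle by [a], written on a fundamental interval. *)
Definition rotation (a t : R) : R := if t + a <= pi then t + a else t + a - 2 * pi.

Lemma measurable_rotation a : measurable_fun [set: mR] (rotation a : mR -> mR).
Proof.
apply: measurable_fun_ifT.
- apply: measurable_fun_ler; [exact: measurable_shift|exact: measurable_cst].
- exact: measurable_shift.
- have -> : (fun t => t + a - 2 * pi) = (fun t : mR => t + (a - 2 * pi) : mR).
    by apply/funext => t; rewrite addrA.
  exact: measurable_shift.
Qed.

Lemma lebesgue_circle_rotation (a : R) (A : set mR) : 0 <= a < 2 * pi -> measurable A ->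
  lebesgue_circle (rotation a @^-1` A) = lebesgue_circle A.
Proof.
move=> /andP[a0 a2] mA; have p0 := @pi_gt0 R.
have mr : measurable (rotation a @^-1` A : set mR).
  by rewrite -[X in measurable X]setTI; exact: measurable_rotation.
rewrite !circleE//.
have m1 : measurable (A `&` `]a - pi, pi] : set mR) by exact: measurableI.
have m2 : measurable (A `&` `]- pi, a - pi] : set mR) by exact: measurableI.
have sh b (B : set mR) : measurable B -> measurable ([set t | B (t + b)] : set mR).
  by move=> mB; rewrite -[X in measurable X]setTI; exact: measurable_shift.
have -> : rotation a @^-1` A `&` `]- pi, pi] =
    [set t | (A `&` `]a - pi, pi]) (t + a)] `|`
    [set t | (A `&` `]- pi, a - pi]) (t + (a - 2 * pi))].
  apply/seteqP; split => t /=; rewrite /rotation !in_itv /=.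
    by case: ifPn => [ta [At /andP[t1 t2]]|]; [left; split=> //; lra|
      rewrite -ltNge addrA => ta [At /andP[t1 t2]]; right; split=> //; lra].
  case=> -[At /andP[t1 t2]].
    by rewrite t2; split=> //; lra.
  by rewrite ifF; [rewrite addrA in At; split=> //; lra|apply/negbTE; rewrite -ltNge; lra].
have -> : A `&` `]- pi, pi] = (A `&` `]a - pi, pi]) `|` (A `&` `]- pi, a - pi]).
  rewrite -setIUr; congr (_ `&` _); apply/seteqP; split => t /=; rewrite !in_itv /=.
    by move=> /andP[t1 t2]; have [h|h] := ltP (a - pi) t; [left|right]; lra.
  by case=> /andP[t1 t2]; lra.
rewrite !measureU//; last 4 first.
- by apply/seteqP; split => // t /=; rewrite !in_itv /= => -[[_ h1] [_ h2]]; lra.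
- exact: sh.
- exact: sh.
- by apply/seteqP; split => // t /=; rewrite !in_itv /= => -[[_ h1] [_ h2]]; lra.
by congr (_ + _)%E; exact: lebesgue_shift.
Qed.

Local Open Scope ereal_scope.

Lemma circle_integral_shift (h : mR -> \bar R) (a : R) : (0 <= a < 2 * pi)%R ->
  measurable_fun [set: _] h -> (forall t, 0 <= h t) ->
  (forall t, h (t + 2 * pi)%R = h t) ->
  \int[lebesgue_circle]_t h (t + a)%R = \int[lebesgue_circle]_t h t.
Proof.
move=> a02 mh h0 hper.
have := @ge0_integral_pushforward _ _ mR mR R (rotation a) (measurable_rotation a)
  lebesgue_circle [set: _] h measurableT mh (fun t _ => h0 t).
rewrite preimage_setT => H.
transitivity (\int[lebesgue_circle]_t (h \o rotation a) t).
  apply: eq_integral => t _ /=; rewrite /rotation; case: ifP => // _.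
  by rewrite -[in RHS](hper) subrK.
rewrite -[LHS]H.
apply: eq_measure_integral; first exact: measurable_rotation.
by move=> mr A mA _; exact: (lebesgue_circle_rotation a02 mA).
Qed.

End CircleShift.

Section TorusShift.
Variable R : realType.
Local Notation mR := (measurableTypeR R).
Local Notation tup d := (d.-tuple mR).
Local Open Scope ereal_scope.

Definition torus_shift d (v : 'I_d -> R) (y : tup d) : tup d :=
  [tuple (tnth y i + v i)%R | i < d].

Lemma measurable_torus_shift d v : measurable_fun [set: _] (@torus_shift d v).
Proof.
apply/measurable_fun_tnthP => i.
rewrite (_ : _ \o _ = (fun y : tup d => (tnth y i + v i)%R : mR)); last first.
  by apply/funext => y /=; rewrite tnth_mktuple.
apply: (measurableT_comp (measurable_shift (v i))); exact: measurable_tnth.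
Qed.

Lemma torus_shift_cons d (v : 'I_d.+1 -> R) (t : R) (y : tup d) :
  torus_shift v [tuple of t :: y] =
  [tuple of (t + v ord0)%R :: torus_shift (fun i => v (lift ord0 i)) y].
Proof.
apply: eq_from_tnth => i; rewrite tnth_mktuple.
by case: (unliftP ord0 i) => [j|] ->; rewrite ?tnthS ?tnth0// tnth_mktuple.
Qed.

Lemma torus_integral_cons d (h : tup d.+1 -> \bar R) : measurable_fun [set: _] h ->
  (forall y, 0 <= h y) ->
  \int[lebesgue_torus d.+1]_y h y =
  \int[lebesgue_circle \x lebesgue_torus d]_z h [tuple of z.1 :: z.2].
Proof.
move=> mh h0.
have mc : measurable_fun [set: mR * tup d]
   (fun y : mR * tup d => [tuple of y.1 :: y.2]) by apply: measurable_cons.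
have := @ge0_integral_pushforward _ _ _ _ R _ mc (lebesgue_circle \x lebesgue_torus d)
  [set: _] h measurableT mh (fun t _ => h0 t).
by rewrite preimage_setT.
Qed.

(** Tonelli's theorem and induction reduce a translation of the torus to a
    rotation in each coordinate. *)
Lemma torus_integral_shift d (h : tup d -> \bar R) (v : 'I_d -> R) :
  (forall i, (0 <= v i < 2 * pi)%R) ->
  measurable_fun [set: _] h -> (forall y, 0 <= h y) ->
  (forall y i, h (torus_shift (fun j => if j == i then (2 * pi)%R else 0%R) y) = h y) ->
  \int[lebesgue_torus d]_y h (torus_shift v y) = \int[lebesgue_torus d]_y h y.
Proof.
elim: d h v => [|d IH] h v v02 mh h0 hper.
  by apply: eq_integral => y _; rewrite [torus_shift v y]tuple0 [y in RHS]tuple0.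
have mc : measurable_fun [set: mR * tup d]
   (fun y : mR * tup d => [tuple of y.1 :: y.2]) by apply: measurable_cons.
rewrite torus_integral_cons//; last first.
  by apply: measurableT_comp => //; exact: measurable_torus_shift.
rewrite torus_integral_cons//.
pose v' i := v (lift ord0 i).
pose F (z : mR * tup d) := h [tuple of z.1 :: z.2].
have mF : measurable_fun [set: _] F by exact: measurableT_comp.
have mF1 : measurable_fun [set: _] (fun z : mR * tup d => F ((z.1 + v ord0)%R, z.2)).
  apply: (measurableT_comp mF); apply: measurable_fun_pair => //.
  by apply: (measurableT_comp (measurable_shift _)).
have mF2 : measurable_fun [set: _] (fun z : mR * tup d => F ((z.1 + v ord0)%R, torus_shift v' z.2)).
  apply: (measurableT_comp mF); apply: measurable_fun_pair => //.
    by apply: (measurableT_comp (measurable_shift _)).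
  by apply: (measurableT_comp (measurable_torus_shift _)).
under eq_integral do rewrite torus_shift_cons.
rewrite (_ : \int[_]_z _ = \int[lebesgue_circle \x lebesgue_torus d]_z
   F ((z.1 + v ord0)%R, torus_shift v' z.2))//.
rewrite -/F (@fubini_tonelli1 _ _ _ _ _ _ _ _ mF2); last by move=> z; exact: h0.
transitivity (\int[lebesgue_circle]_t \int[lebesgue_torus d]_y F ((t + v ord0)%R, y)).
  apply: eq_integral => t _; rewrite /fubini_F /=.
  apply: (IH (fun y => F ((t + v ord0)%R, y)) v') => //.
  - by move=> i; exact: v02.
  - exact: (@measurableT_comp _ _ _ _ _ _ F _ (pair (t + v ord0)%R) mF (pair1_measurable _)).
  - by move=> y; exact: h0.
  - move=> y i; rewrite /F /= -(hper [tuple of (t + v ord0)%R :: y] (lift ord0 i)).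
    by rewrite torus_shift_cons /= addr0; congr (h _); apply: eq_from_tnth => j;
      case: (unliftP ord0 j) => [j'|] ->; rewrite ?tnthS ?tnth0// !tnth_mktuple (inj_eq lift_inj).
transitivity (\int[lebesgue_circle \x lebesgue_torus d]_z F ((z.1 + v ord0)%R, z.2)).
  by rewrite (@fubini_tonelli1 _ _ _ _ _ _ _ _ mF1) => [//|z]; exact: h0.
rewrite (@fubini_tonelli2 _ _ _ _ _ _ _ _ mF1); last by move=> z; exact: h0.
rewrite -[RHS]/(\int[lebesgue_circle \x lebesgue_torus d]_z F z).
rewrite (@fubini_tonelli2 _ _ _ _ _ _ _ _ mF); last by move=> z; exact: h0.
apply: eq_integral => y _; rewrite /fubini_G /=.
apply: (circle_integral_shift (h := fun t => F (t, y))) => //.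
- exact: (@measurableT_comp _ _ _ _ _ _ F _ (pair^~ y) mF (pair2_measurable _)).
- by move=> t; exact: h0.
- move=> t; rewrite /F /= -(hper [tuple of t :: y] ord0).
  rewrite torus_shift_cons /=; congr (h _); apply: eq_from_tnth => j.
  by case: (unliftP ord0 j) => [j'|] ->; rewrite ?tnthS ?tnth0// !tnth_mktuple addr0.
Qed.

End TorusShift.

Section GridTransfer.
Variables (R : realType) (d : nat).
Local Notation mR := (measurableTypeR R).
Local Notation tup := (d.-tuple mR).
Implicit Types (x : 'rV[R]_d) (h F G : 'rV[R]_d -> R).

Definition torus_row (y : tup) : 'rV[R]_d := \row_i tnth y i.

Definition torus_integral h : \bar R :=
  (\int[lebesgue_torus d]_y (h (torus_row y))%:E)%E.

(** The functions to which translation invariance applies. *)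
Record torus_function h : Prop := TorusFunction {
  torus_function_ge0 : forall x, 0 <= h x ;
  torus_function_measurable : measurable_fun [set: tup] (h \o torus_row) ;
  torus_function_periodic :
    forall x i, h (x + (2 * pi) *: delta_mx 0 i) = h x }.

Lemma torus_function_max h h' : torus_function h -> torus_function h' ->
  torus_function (fun x => Num.max (h x) (h' x)).
Proof.
move=> [h0 mh hp] [h'0 mh' h'p]; split=> [x||x i]; last by rewrite hp h'p.
  by rewrite le_max h0.
exact: measurable_maxr.
Qed.

Lemma torus_function_cst (c : R) : 0 <= c -> torus_function (fun=> c).
Proof. by move=> c0; split=> //; exact: measurable_cst. Qed.

Lemma torus_function_bigmax (I : Type) (s : seq I) (P : pred I) (H : I -> 'rV[R]_d -> R) :
  (forall i, torus_function (H i)) ->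
  torus_function (fun x => \big[Num.max/0]_(i <- s | P i) H i x).
Proof.
move=> Hi; elim: s => [|i s IH].
  by under eq_fun do rewrite big_nil; exact: torus_function_cst.
under eq_fun do rewrite big_cons.
by case: (P i) => //; exact: torus_function_max.
Qed.

Lemma torus_function_powR h (p : R) : torus_function h ->
  torus_function (fun x => h x `^ p).
Proof.
move=> [h0 mh hp]; split=> [x||x i]; [exact: powR_ge0| |by rewrite hp].
exact: (measurableT_comp (measurable_powR p) mh).
Qed.

Lemma torus_function_excess h (c : R) : torus_function h ->
  torus_function (fun x => Num.max (h x - c) 0).
Proof.
move=> [h0 mh hp]; split=> [x||x i]; [by rewrite le_max lexx orbT| |by rewrite hp].
apply: measurable_maxr; last exact: measurable_cst.
by apply: measurable_funB => //; exact: measurable_cst.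
Qed.

Lemma torus_row_shift v y : torus_row (torus_shift v y) = torus_row y + \row_i v i.
Proof. by apply/rowP => i; rewrite !mxE tnth_mktuple. Qed.

Lemma torus_integral_translate h (v : 'I_d -> R) : torus_function h ->
  (forall i, 0 <= v i < 2 * pi) ->
  torus_integral (fun x => h (x + \row_i v i)) = torus_integral h.
Proof.
move=> [h0 mh hp] v02; rewrite /torus_integral.
rewrite -(@torus_integral_shift R d (fun y => (h (torus_row y))%:E) v)//.
- by apply: eq_integral => y _; rewrite torus_row_shift.
- exact/measurable_EFinP.
- by move=> y; rewrite lee_fin.
move=> y i; rewrite torus_row_shift -[in RHS](hp _ i); congr (h _)%:E; congr (_ + _).
apply/rowP => j; rewrite !mxE /=.
by case: eqP => _; rewrite ?mulr1 ?mulr0.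
Qed.

(** Integrating the inequality at [x] over the torus gives each translate of [F]
    and of [G] the same integral, so the number of grid points cancels and the
    constant is kept. *)
Lemma grid_transfer N F G (C : R) : 0 <= C -> torus_function F -> torus_function G ->
  let v (m : {ffun 'I_d -> 'I_(2 * N).+1}) : 'rV[R]_d :=
    \row_i (2 * (pi * (m i)%:R / (2 * N).+1%:R)) in
  (forall x, \sum_m F (x + v m) <= C * \sum_m G (x + v m)) ->
  (torus_integral F <= C%:E * torus_integral G)%E.
Proof.
move=> C0 gF gG v FG; have [F0 mF _] := gF; have [G0 mG _] := gG.
set L := (2 * N).+1; pose X := {ffun 'I_d -> 'I_L}.
have L0 : 0 < L%:R :> R by rewrite ltr0n.
have v02 (m : X) i : 0 <= 2 * (pi * (m i)%:R / L%:R : R) < 2 * pi.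
  have p0 := @pi_gt0 R; rewrite !mulr_ge0 ?invr_ge0 ?pi_ge0//=.
  rewrite ltr_pM2l// ltr_pdivrMr// ltr_pM2l// ltr_nat; exact: ltn_ord.
have mS h : torus_function h -> forall m : X,
    measurable_fun [set: tup] (fun y => (h (torus_row y + v m))%:E).
  move=> [h0 mh _] m; apply/measurable_EFinP.
  rewrite (_ : (fun y => _) = (h \o torus_row) \o
     torus_shift (fun i => 2 * (pi * (m i)%:R / L%:R))).
    by apply: (measurableT_comp mh); exact: measurable_torus_shift.
  by apply/funext => y /=; rewrite torus_row_shift.
have mSum h : torus_function h ->
    measurable_fun [set: tup] (fun y => \sum_(m : X) (h (torus_row y + v m))%:E)%E.
  by move=> gh; apply: (emeasurable_sum _) => m; exact: mS.
have sum h : torus_function h ->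
    (\int[lebesgue_torus d]_y \sum_(m : X) (h (torus_row y + v m))%:E)%E =
    (#|X|%:R%:E * torus_integral h)%E.
  move=> gh; have [h0 _ _] := gh; rewrite ge0_integral_sum//; last 2 first.
  - by move=> m; exact: mS.
  - by move=> m y _; rewrite lee_fin.
  rewrite (eq_bigr (fun=> torus_integral h)) => [|m _].
    rewrite big_const -[X in iter X]/(#|X|); elim: #|X| => [|n IH]; first by rewrite mul0e.
    by rewrite iterS IH -natr1 EFinD ge0_muleDl ?lee_fin// mul1e addeC.
  by rewrite -(torus_integral_translate gh (v02 m)).
have X0 : 0 < #|X|%:R :> R by rewrite ltr0n; apply/card_gt0P; exists [ffun=> ord0].
rewrite -(lee_pmul2l _ (_ : 0 < #|X|%:R%:E)%E)//= muleCA -!sum//.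
rewrite -ge0_integralZl//; last 2 first.
- exact: (mSum _ gG).
- by move=> y _; apply: sume_ge0 => m _; rewrite lee_fin.
apply: ge0_le_integral => //.
- by move=> y _; apply: sume_ge0 => m _; rewrite lee_fin.
- exact: (mSum _ gF).
- by apply: measurable_funeM; exact: (mSum _ gG).
by move=> y _; rewrite !sumEFin -EFinM lee_fin.
Qed.

End GridTransfer.

Section GridSampling.
Variables (R : realType) (d : nat).
Local Open Scope complex_scope.
Local Notation K := 'rV[int]_d.
Local Notation norm2 := (@l2norm R d).
Local Notation normc := (@Normc.normc R).
Local Notation mR := (measurableTypeR R).
Implicit Types (k : K) (x : 'rV[R]_d) (w : K -> R[i]).

Definition trig_poly M w x : R[i] := \sum_(k <- box d M) w k * expi_dot k x.

Lemma expi_dotE k x : expi_dot k x = cis (dot k x). Proof. by []. Qed.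

Lemma expi_dot_periodic k x i :
  expi_dot k (x + (2 * pi) *: delta_mx 0 i) = expi_dot k x.
Proof.
rewrite !expi_dotE dotD dot_delta cisD.
have -> : (2 * pi : R) = pi *+ 2 by rewrite mulr_natl.
have per m : cis ((pi *+ 2) *+ m) = 1 :> R[i].
  by rewrite cis_mulrn /cis cos2pi sin2pi expr1n.
case: (k 0 i) => n; first by rewrite mulr_natl per mulr1.
by rewrite NegzE mulrNz mulNr mulr_natl -cis_inv per invr1 mulr1.
Qed.

Lemma torus_function_trig_poly M w : torus_function (fun x => normc (trig_poly M w x)).
Proof.
split=> [x||x i]; first exact: normc_ge0; last first.
  by congr normc; apply: eq_bigr => k _; rewrite expi_dot_periodic.
have mdot k : measurable_fun [set: d.-tuple mR] (fun y : d.-tuple mR => dot k (torus_row y)).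
  rewrite /dot; apply: measurable_sum => i; apply: measurable_funM.
    exact: measurable_cst.
  under eq_fun do rewrite mxE; exact: measurable_tnth.
have mcos k : measurable_fun [set: d.-tuple mR] (fun y : d.-tuple mR => cos (dot k (torus_row y))).
  apply: (measurableT_comp _ (mdot k)); apply: continuous_measurable_fun.
  exact: continuous_cos.
have msin k : measurable_fun [set: d.-tuple mR] (fun y : d.-tuple mR => sin (dot k (torus_row y))).
  apply: (measurableT_comp _ (mdot k)); apply: continuous_measurable_fun.
  exact: continuous_sin.
have E (y : d.-tuple mR) : normc (trig_poly M w (torus_row y)) = Num.sqrt
    ((\sum_(k <- box d M) (complex.Re (w k) * cos (dot k (torus_row y)) -
        complex.Im (w k) * sin (dot k (torus_row y)))) ^+ 2 +
     (\sum_(k <- box d M) (complex.Re (w k) * sin (dot k (torus_row y)) +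
        complex.Im (w k) * cos (dot k (torus_row y)))) ^+ 2).
  have nE z : normc z = Num.sqrt (complex.Re z ^+ 2 + complex.Im z ^+ 2) by case: z.
  rewrite nE /trig_poly !raddf_sum; congr (Num.sqrt (_ ^+ 2 + _ ^+ 2));
    by apply: eq_bigr => k _; case: (w k) => u v /=; rewrite ?[v * _ + _]addrC.
have -> : (fun x => normc (trig_poly M w x)) \o @torus_row R d = _ := funext E.
have msum : measurable_fun [set: d.-tuple mR] (fun y : d.-tuple mR =>
    (\sum_(k <- box d M) (complex.Re (w k) * cos (dot k (torus_row y)) -
        complex.Im (w k) * sin (dot k (torus_row y)))) ^+ 2 +
     (\sum_(k <- box d M) (complex.Re (w k) * sin (dot k (torus_row y)) +
        complex.Im (w k) * cos (dot k (torus_row y)))) ^+ 2).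
  apply: measurable_funD; apply: measurable_funX; apply: measurable_sum => k.
    by apply: measurable_funB; apply: measurable_funM => //; exact: measurable_cst.
  by apply: measurable_funD; apply: measurable_funM => //; exact: measurable_cst.
apply: (measurableT_comp _ msum); apply: continuous_measurable_fun.
exact: sqrt_continuous.
Qed.

Definition grid_point N (m : {ffun 'I_d -> 'I_(2 * N).+1}) : 'rV[R]_d :=
  \row_i (2 * (pi * (m i)%:R / (2 * N).+1%:R)).

Lemma freq_box_point N (q : {ffun 'I_d -> 'I_(2 * N).+1}) i :
  freq R (q i) = (box_point q 0 i)%:~R.
Proof. by rewrite mxE /freq rmorphB. Qed.

Lemma absfreq_box_point N (q : {ffun 'I_d -> 'I_(2 * N).+1}) i :
  absfreq (q i) = absz (box_point q 0 i).
Proof.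
apply/eqP; rewrite -(eqr_nat R) (absfreqE R) freq_box_point.
by rewrite natr_absz intr_norm.
Qed.

Lemma freq_norm_box_point N (q : {ffun 'I_d -> 'I_(2 * N).+1}) :
  freq_norm R q = norm2 (box_point q).
Proof.
congr Num.sqrt; apply: eq_bigr => i _.
by rewrite (absfreqE R) freq_box_point real_normK// num_real.
Qed.

Lemma mode_grid_point N (q m : {ffun 'I_d -> 'I_(2 * N).+1}) :
  mode R q m = expi_dot (box_point q) (grid_point m).
Proof.
rewrite expi_dotE; congr cis; apply: eq_bigr => i _.
by rewrite freq_box_point !mxE.
Qed.

(** The grid data whose transform is the restriction of a trigonometric
    polynomial to the translate of the grid by [x]. *)
Definition sample N M w x (q : {ffun 'I_d -> 'I_(2 * N).+1}) : R[i] :=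
  if box_point q \in box d M then w (box_point q) * expi_dot (box_point q) x else 0.
Arguments sample : clear implicits.

Lemma multiplier_sample N M w x (A : K -> R) (a : {ffun 'I_d -> 'I_(2 * N).+1} -> R) m :
  (M <= N)%N -> (forall q, a q = A (box_point q)) ->
  multiplier a (sample N M w x) m =
  trig_poly M (fun k => (A k)%:C * w k) (x + grid_point m).
Proof.
move=> MN aA; rewrite /trig_poly (sum_box_widen _ MN) big_mkcond sum_box.
apply: eq_bigr => q _; rewrite aA /sample mode_grid_point.
case: ifP => _; last by rewrite mulr0 mul0r.
by rewrite !expi_dotE dotD cisD !mulrA.
Qed.

Lemma band_limited_sample N M w x : band_limited (sample N M w x) M.
Proof.
move=> q; rewrite /sample; case: ifP => [|_]; last by rewrite eqxx.
by rewrite mem_box => /forallP qM _ i; rewrite absfreq_box_point; exact: qM.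
Qed.

Definition riesz_symbol (gamma alpha : R) (n : 'I_d -> nat) k : R :=
  \prod_i riesz_weight gamma alpha (n i) (absz (k ord0 i)).

Lemma riesz_multiplier_box_point N gamma alpha n (q : {ffun 'I_d -> 'I_(2 * N).+1}) :
  riesz_multiplier gamma alpha n q = riesz_symbol gamma alpha n (box_point q).
Proof. by apply: eq_bigr => i _; rewrite absfreq_box_point. Qed.

Lemma riesz_symbol_out gamma alpha (n : 'I_d -> nat) M k : 0 < gamma -> 0 < alpha ->
  (forall i, (0 < n i <= M)%N) -> k \notin box d M -> riesz_symbol gamma alpha n k = 0.
Proof.
move=> g0 a0 nM kM; apply/eqP; apply: contraNT kM => /eqP k0.
rewrite mem_box; apply/forallP => i; rewrite leqNgt; apply/negP => ki; apply: k0.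
have /andP[n0 ni] := nM i.
rewrite /riesz_symbol (bigD1 i)//= /riesz_weight riesz_base_out ?powR0 ?mul0r//.
  by rewrite gt_eqF.
by rewrite (leq_trans ni)// ltnW.
Qed.

End GridSampling.
Arguments sample {R d} N M w x q.

Section DampedMeans.
Variables (R : realType) (d : nat).
Local Open Scope complex_scope.
Local Notation K := 'rV[int]_d.
Local Notation norm2 := (@l2norm R d).
Local Notation normc := (@Normc.normc R).
Implicit Types (f : ('rV[R]_d -> R[i]) -> R[i]) (x : 'rV[R]_d) (k : K)
  (n : 'I_d -> nat) (e gamma alpha tau : R).

(** The Fourier coefficients of the Poisson integral of [f] at time [e]. *)
Definition damped f e k : R[i] := (expR (- (e * norm2 k)))%:C * fourier_coef f k.

Definition riesz_damped gamma alpha f n e M x : R[i] :=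
  trig_poly M (fun k => (riesz_symbol gamma alpha n k)%:C * damped f e k) x.

Lemma riesz_meanE gamma alpha f n M x : 0 < gamma -> 0 < alpha ->
  (forall i, (0 < n i <= M)%N) ->
  riesz_mean gamma alpha n f x = riesz_damped gamma alpha f n 0 M x.
Proof.
move=> g0 a0 nM; rewrite /riesz_mean (@fsum_freq_box _ _ M); last by move=> i; case/andP: (nM i).
rewrite big_mkcond /riesz_damped /trig_poly; apply: eq_bigr => k _.
rewrite /damped mul0r oppr0 expR0 mul1r.
case: ifPn => [/forallP kn|].
  congr (_%:C * _ * _); apply: eq_bigr => i _.
  by rewrite /riesz_weight /riesz_base kn.
move=> kn; rewrite [riesz_symbol _ _ _ _](_ : _ = 0) ?mul0r//.
apply: contraNeq kn => k0; apply/forallP => i; rewrite leqNgt; apply/negP => ki.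
case/eqP: k0; rewrite /riesz_symbol (bigD1 i)//= /riesz_weight.
rewrite riesz_base_out ?powR0 ?mul0r ?(ltnW ki)//; first by rewrite gt_eqF.
by case/andP: (nM i).
Qed.

(** A Riesz mean is recovered from the damped ones, whatever the size of the
    boxes, as the damping disappears. *)
Lemma riesz_mean_le_damped gamma alpha f n M0 x : 0 < gamma -> 0 < alpha ->
  (forall i, (0 < n i <= M0)%N) ->
  exists2 B, 0 <= B & forall e M, 0 <= e -> (M0 <= M)%N ->
    normc (riesz_mean gamma alpha n f x) <=
    normc (riesz_damped gamma alpha f n e M x) + e * B.
Proof.
move=> g0 a0 nM.
pose B := \sum_(k <- box d M0) `|riesz_symbol gamma alpha n k| *
  (norm2 k * normc (fourier_coef f k)).
exists B.
  by apply: sumr_ge0 => k _; rewrite !mulr_ge0 ?l2norm_ge0 ?normc_ge0.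
move=> e M e0 MM; rewrite (riesz_meanE _ _ g0 a0 nM).
have -> : riesz_damped gamma alpha f n e M x = riesz_damped gamma alpha f n e M0 x.
  rewrite /riesz_damped /trig_poly (sum_box_widen _ MM) [LHS](bigID (mem (box d M0)))/=.
  rewrite [X in _ + X]big1 ?addr0// => k kM.
  by rewrite (riesz_symbol_out g0 a0 nM kM) !mul0r.
set z := riesz_damped _ _ _ _ 0 _ _; set z' := riesz_damped _ _ _ _ e _ _.
rewrite -[z in leLHS](subrK z') addrC (le_trans (le_normcD _ _))// lerD2l.
rewrite /z /z' /riesz_damped /trig_poly -sumrB (le_trans (normc_sum _ _ _))//.
rewrite /B mulr_sumr; apply: ler_sum => k _.
rewrite -mulrBl -mulrBr -mulrBl Normc.normcM normc_cis mulr1 Normc.normcM.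
rewrite normc_real mulrCA ler_wpM2l// Normc.normcM mulrA ler_wpM2r ?normc_ge0//.
rewrite mul0r oppr0 expR0 -rmorphB normc_real ger0_norm; last first.
  by rewrite subr_ge0 expR_le1 oppr_le0 mulr_ge0// l2norm_ge0.
by have := expR_ge1Dx (- (e * norm2 k)); lra.
Qed.

Definition damped_maximal gamma alpha tau f e m M x : R :=
  \big[Num.max/0]_(n : {ffun 'I_d -> 'I_m.+1} | `[< cone tau (fun i => n i : nat) >])
    normc (riesz_damped gamma alpha f (fun i => n i : nat) e M x).

(** The Poisson means of [f * P_e] at the dyadic times down to [2 ^ - (J + s)],
    after truncation to the frequencies up to [2 ^ J]. *)
Definition poisson_max f e J s x : R :=
  \big[Num.max/0]_(j < (J + s).+1) normc (poisson_sum f ((2 ^ j)%:R^-1 + e) (2 ^ J) x).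

Lemma torus_function_damped_maximal gamma alpha tau f e m M :
  torus_function (damped_maximal gamma alpha tau f e m M).
Proof. by apply: torus_function_bigmax => n; exact: torus_function_trig_poly. Qed.

Lemma torus_function_poisson_max f e J s : torus_function (poisson_max f e J s).
Proof. by apply: torus_function_bigmax => n; exact: torus_function_trig_poly. Qed.

(** The maximum over the cone is attained because the cone contains the index
    constantly equal to one. *)
Lemma damped_maximal_attained gamma alpha tau f e m M x : 1 <= tau -> (0 < m)%N ->
  exists n, [/\ cone tau n, (forall i, (n i <= m)%N) &
    damped_maximal gamma alpha tau f e m M x <=
    normc (riesz_damped gamma alpha f n e M x)].
Proof.
move=> t1 m0; apply: contrapT => /forallNP H.
have t0 : 0 < tau by lra.
have Hn n : cone tau n -> (forall i, (n i <= m)%N) ->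
    normc (riesz_damped gamma alpha f n e M x) < damped_maximal gamma alpha tau f e m M x.
  by move=> nc nm; rewrite ltNge; apply/negP => h; apply: (H n).
have c1 : @cone R d tau (fun=> 1%N).
  by split=> // i j; rewrite divr1 t1 andbT invf_le1.
have := Hn _ c1 (fun=> m0); rewrite ltNge => /negP; apply.
rewrite leNgt; apply/negP => h; have D0 : 0 < damped_maximal gamma alpha tau f e m M x.
  exact: le_lt_trans (normc_ge0 _) h.
have [D DE] : exists D, D = damped_maximal gamma alpha tau f e m M x by eexists.
rewrite -DE in Hn D0; suff : D < D by rewrite ltxx.
rewrite {1}DE; apply: bigmax_lt; first exact: D0.
by move=> n /asboolP nc; apply: Hn => // i; rewrite -ltnS.
Qed.

(** The grid inequality for the samples of the truncation of [f * P_e].  A bound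
    of [poisson_max] almost everywhere says nothing about a given translate of
    the grid, so the uniform estimate is put in integrated form: if the excesses of
    [poisson_max] over [l] add up to [S] on a translate, then [l + S] bounds it
    there.  The constant [C'] of the excesses may depend on [J], since it is
    used only when the right-hand side is zero. *)
Lemma riesz_damped_bound b r gamma alpha tau : (0 < d)%N -> 0 < b <= 1 ->
  b * d%:R < 1 -> 0 < r -> r < 1 -> 0 < r * (1 + b) - 1 ->
  1 <= gamma -> b <= alpha -> 1 <= tau ->
  exists s,
  (forall p, r < p -> exists2 C, 0 <= C & forall f e J m, (0 < m <= 2 ^ J)%N ->
    (torus_integral (fun x => (damped_maximal gamma alpha tau f e m (2 ^ J) x `^ p)%R) <=
     C%:E * torus_integral (fun x => (poisson_max f e J s x `^ p)%R))%E) /\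
  exists2 C, 0 <= C & forall J, exists2 C', 0 <= C' & forall f e m l,
    (0 < m <= 2 ^ J)%N -> 0 <= l ->
    (torus_integral (fun x =>
       (Num.max (damped_maximal gamma alpha tau f e m (2 ^ J) x - C * l) 0)%R) <=
     C'%:E * torus_integral (fun x => (Num.max (poisson_max f e J s x - l) 0)%R))%E.
Proof.
move=> d0 b01 bd r0 r1 e0 g1 ba t1.
have [s [Hp [C C0 HC]]] := riesz_grid_bound d0 b01 bd r0 r1 e0 g1 ba t1.
exists s.
have JN J : (2 ^ J <= 2 * 2 ^ (J + s))%N.
  by rewrite (@leq_trans (2 ^ (J + s)))// ?leq_exp2l ?leq_addr// leq_pmull.
have level f e J x i z : (i <= J + s)%N ->
    poisson_level (sample (2 * 2 ^ (J + s)) (2 ^ J) (damped f e) x) i z <=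
    poisson_max f e J s (x + grid_point R z).
  rewrite -ltnS => iJ; rewrite /poisson_level (@multiplier_sample _ _ _ _ _ _
    (fun k => expR (- ((2 ^ i)%:R^-1 * norm2 k))) _ _ (JN J)); last first.
    by move=> q; rewrite /poisson_multiplier freq_norm_box_point.
  apply: le_trans (le_bigmax _ _ (Ordinal iJ)) => /=.
  rewrite le_eqVlt; apply/orP; left; apply/eqP; congr normc; apply: eq_bigr => k _.
  by rewrite /damped mulrA -rmorphM -expRD mulrDl opprD.
have riesz f e J x n z : 
    multiplier (riesz_multiplier gamma alpha n)
      (sample (2 * 2 ^ (J + s)) (2 ^ J) (damped f e) x) z =
    riesz_damped gamma alpha f n e (2 ^ J) (x + grid_point R z).
  apply: multiplier_sample; first exact: JN.
  by move=> q; exact: riesz_multiplier_box_point.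
split.
  move=> p rp; have [Cp Cp0 HCp] := Hp p rp; exists Cp => // f e J m /andP[m0 mJ].
  apply: (@grid_transfer _ _ (2 * 2 ^ (J + s))); first exact: Cp0.
  - by apply: torus_function_powR; exact: torus_function_damped_maximal.
  - by apply: torus_function_powR; exact: torus_function_poisson_max.
  move=> x; pose c := sample (2 * 2 ^ (J + s)) (2 ^ J) (damped f e) x.
  apply: (HCp _ J c (fun z => poisson_max f e J s (x + grid_point R z)) (leqnn _)).
  - exact: band_limited_sample.
  - exact: level.
  - move=> z; have [n [nc nm le_n]] := damped_maximal_attained gamma alpha f e
      (2 ^ J) (x + grid_point R z) t1 m0.
    exists n; split=> [//|i|]; first by rewrite (leq_trans (nm i)).
    by rewrite riesz.
  - move=> z; exact: (torus_function_ge0 (torus_function_damped_maximal _ _ _ _ _ _ _)).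
exists C => // J.
pose X := {ffun 'I_d -> 'I_(2 * (2 * 2 ^ (J + s))).+1}.
exists (#|X|%:R * C) => [|f e m l /andP[m0 mJ] l0]; first by rewrite mulr_ge0.
apply: (@grid_transfer _ _ (2 * 2 ^ (J + s))); first by rewrite mulr_ge0.
- by apply: torus_function_excess; exact: torus_function_damped_maximal.
- by apply: torus_function_excess; exact: torus_function_poisson_max.
move=> x; pose c := sample (2 * 2 ^ (J + s)) (2 ^ J) (damped f e) x.
set S := \sum_m0 Num.max (poisson_max _ _ _ _ _ - l) 0.
have S0 : 0 <= S by apply: sumr_ge0 => z _; rewrite le_max lexx orbT.
have lS i z : (i <= J + s)%N -> poisson_level c i z <= l + S.
  move=> iJ; apply: (le_trans (level f e J x i z iJ)); rewrite -lerBlDl.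
  rewrite /S (bigD1 z)//= ler_wpDr//.
    by apply: sumr_ge0 => z' _; rewrite le_max lexx orbT.
  by rewrite le_max lexx.
rewrite -mulrA mulr_natl; apply: (@le_trans _ _ (\sum_(z : X) C * S)); last first.
  by rewrite sumr_const.
apply: ler_sum => z _.
rewrite ge_max mulr_ge0// andbT lerBlDl -mulrDr.
have [n [nc nm le_n]] := damped_maximal_attained gamma alpha f e
      (2 ^ J) (x + grid_point R z) t1 m0.
apply: (le_trans le_n); rewrite -riesz.
apply: (HC _ J c (l + S) (leqnn _)) => //; first exact: band_limited_sample.
by move=> i; rewrite (leq_trans (nm i)).
Qed.

End DampedMeans.

(** * The maximal inequality *)

Section Exponents.
Variable R : realType.

(** [r] is taken between the critical exponent and [min (q, 1)], and [b] between
    [1 / r - 1] and [min (alpha, 1, 1 / d)]. *)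
Lemma riesz_exponents d (alpha q : R) : (0 < d)%N -> 0 < alpha ->
  Num.max (d%:R / (d%:R + 1)) (1 / (Num.min alpha 1 + 1)) < q ->
  exists b r, [/\ 0 < b <= 1, b <= alpha, b * d%:R < 1, 0 < r < 1 &
    r < q /\ 0 < r * (1 + b) - 1].
Proof.
move=> d0 a0; set c := Num.max _ _ => cq.
have D0 : 0 < d%:R :> R by rewrite ltr0n.
have m0 : 0 < Num.min alpha 1 by rewrite lt_min a0 ltr01.
have c1 : c < 1.
  by rewrite gt_max; apply/andP; split; rewrite ltr_pdivrMr; lra.
have c0 : 0 < c by rewrite lt_max divr_gt0// addr_gt0.
pose q' := Num.min q 1.
have cq' : c < q' by rewrite lt_min cq.
(* Both bounds on [q] amount to upper bounds on [1 / r - 1]. *)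
pose r := (c + q') / 2.
have q'1 : q' <= 1 by rewrite ge_min lexx orbT.
have q'q : q' <= q by rewrite ge_min lexx.
have cr : c < r by rewrite /r; lra.
have r0 : 0 < r by lra.
have r1 : r < 1 by rewrite /r; lra.
have rq : r < q by rewrite /r; lra.
have h1 : r^-1 - 1 < d%:R^-1.
  have : d%:R / (d%:R + 1) < r by apply: le_lt_trans cr; rewrite le_max lexx.
  rewrite ltr_pdivrMr; last by lra.
  move=> h; rewrite -(ltr_pM2r r0) -(ltr_pM2r D0) mulrBl mulVf ?gt_eqF//.
  by rewrite [X in _ < X]mulrAC mulVf ?gt_eqF//; lra.
have h2 : r^-1 - 1 < Num.min alpha 1.
  have : 1 / (Num.min alpha 1 + 1) < r by apply: le_lt_trans cr; rewrite le_max lexx orbT.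
  rewrite ltr_pdivrMr; last by lra.
  by move=> h; rewrite -(ltr_pM2r r0) mulrBl mulVf ?gt_eqF//; lra.
pose m := Num.min (Num.min alpha 1) d%:R^-1.
have rm : r^-1 - 1 < m by rewrite lt_min h1 h2.
have ri : 0 < r^-1 - 1 by rewrite subr_gt0 invf_gt1.
pose b := (r^-1 - 1 + m) / 2; exists b, r.
have bm : b < m by rewrite /b; lra.
have : m <= Num.min alpha 1 by rewrite ge_min lexx.
rewrite le_min => /andP[ma m1].
have md : m <= d%:R^-1 by rewrite ge_min lexx orbT.
have rb : r^-1 < 1 + b by rewrite /b; lra.
split; [by rewrite /b; lra|lra| |by rewrite r0|split=> //].
  by rewrite -ltr_pdivlMr// div1r; lra.
by rewrite subr_gt0 -ltr_pdivrMl// mulr1.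
Qed.

End Exponents.

Section MonotoneIntegral.
Local Open Scope ereal_scope.
Context dd (T : measurableType dd) (R : realType).
Variable mu : {measure set T -> \bar R}.
Import HBNNSimple.

(** The integral of a nonnegative function is a supremum over the simple
    functions below it.  It is therefore monotone without measurability, which
    avoids any discussion of the uncountable suprema in the maximal
    functions. *)
Lemma ge0_integral_mono (f g : T -> \bar R) : (forall x, 0 <= f x) ->
  (forall x, f x <= g x) -> \int[mu]_x f x <= \int[mu]_x g x.
Proof.
move=> f0 fg; rewrite !ge0_integralTE//; last by move=> x; exact: le_trans (fg x).
apply: le_ereal_sup => _ [h hf <-]; exists h => // x; exact: le_trans (fg x).
Qed.

End MonotoneIntegral.

Lemma poweR_homo (R : realType) (x y : \bar R) (p : R) : 0 < p -> (0 <= x)%E ->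
  (x <= y)%E -> (x `^ p <= y `^ p)%E.
Proof.
move=> p0 x0 xy; apply: gt0_ler_poweR => //; first exact: ltW.
  by rewrite in_itv /= x0 leey.
by rewrite in_itv /= (le_trans x0 xy) leey.
Qed.

Section LimInf.
Local Open Scope ereal_scope.
Variable R : realType.
Implicit Types (u a : nat -> \bar R).

Lemma limn_einf_le u a l : (forall n, u n <= a n) -> a @ \oo --> l ->
  limn_einf u <= l.
Proof.
move=> ua al; rewrite limn_einf_lim -(cvg_lim _ al)//.
apply: lee_lim; [exact: is_cvg_einfs|by apply/cvg_ex; exists l|].
by apply: nearW => n; apply: le_trans (ua n); apply: ereal_inf_lbound; exists n => /=.
Qed.

Lemma limn_einf_ge u l N : (forall n, (N <= n)%N -> l <= u n) -> l <= limn_einf u.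
Proof.
move=> lu; rewrite limn_einf_lim (cvg_lim _ (@cvg_einfs_sup _ u))//.
apply: (@le_trans _ _ (einfs u N)); last by apply: ereal_sup_ubound; exists N.
by apply: le_ereal_inf_tmp => _ [n /= Nn <-]; exact: lu.
Qed.

End LimInf.

Section MaximalInequality.
Variables (R : realType) (d : nat).
Local Open Scope complex_scope.
Local Notation normc := (@Normc.normc R).
Local Notation distribution := (@Defs.distribution R d).
Local Notation mu := (lebesgue_torus d).
Local Notation row := (@torus_row R d).
Variable f : ('rV[R]_d -> R[i]) -> R[i].
Implicit Types (x : 'rV[R]_d) (gamma alpha tau e : R).

Let e_ (m : nat) : R := m.+1%:R^-1.
Let e_gt0 m : 0 < e_ m. Proof. by rewrite invr_gt0. Qed.

Lemma poisson_maximal_ge0 x : (0 <= poisson_maximal f x)%E.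
Proof.
apply: (@le_trans _ _ (normc (convolution f (poisson_kernel 1) x))%:E).
  by rewrite lee_fin normc_ge0.
by apply: ereal_sup_ubound; exists 1 => /=.
Qed.

Lemma riesz_maximal_ge0 gamma alpha tau x : 1 <= tau ->
  (0 <= riesz_maximal gamma alpha tau f x)%E.
Proof.
move=> t1; apply: (@le_trans _ _ (normc (riesz_mean gamma alpha (fun=> 1%N) f x))%:E).
  by rewrite lee_fin normc_ge0.
apply: ereal_sup_ubound; exists (fun=> 1%N) => //=.
by split=> // i j; rewrite divr1 t1 andbT invf_le1//; lra.
Qed.

(** Truncation scales at which the discretized Poisson integrals of damping
    [e_ m] exceed the true maximal function by at most [e_ m]. *)
Lemma truncation_scale s : distribution f ->
  exists J : nat -> nat, forall m, (m.+1 <= 2 ^ J m)%N /\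
    forall x, ((Num.max (poisson_max f (e_ m) (J m) s x - e_ m) 0)%:E <=
      poisson_maximal f x)%E.
Proof.
move=> df; suff /choice[J HJ] : forall m, exists J, (m.+1 <= 2 ^ J)%N /\ forall x,
  ((Num.max (poisson_max f (e_ m) J s x - e_ m) 0)%:E <= poisson_maximal f x)%E.
  by exists J.
move=> m.
have [u u0 Hu] := poisson_sum_tail df (e_gt0 m).
move/cvgrPdist_le : u0 => /(_ _ (e_gt0 m)) [N _ HN].
pose J := (maxn N m.+1); exists J.
have NJ : (maxn N m.+1 <= 2 ^ J)%N by rewrite ltnW// ltn_expl.
split=> [|x]; first by rewrite (leq_trans _ NJ)// leq_maxr.
have uJ : u (2 ^ J)%N <= e_ m.
  have := HN (2 ^ J)%N (leq_trans (leq_maxl _ _) NJ); rewrite sub0r normrN.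
  exact: le_trans (ler_norm _).
have [y|y|] := ltgtP (Num.max (poisson_max f (e_ m) J s x - e_ m) 0) 0.
- by rewrite (le_trans _ (poisson_maximal_ge0 x))// lee_fin ltW.
- rewrite leNgt; apply/negP => h.
  have PM : poisson_maximal f x \is a fin_num.
    by rewrite ge0_fin_numE ?poisson_maximal_ge0// (lt_le_trans h)// leey.
  have F0 : 0 <= fine (poisson_maximal f x) by rewrite fine_ge0// poisson_maximal_ge0.
  move: h; rewrite -(fineK PM) lte_fin lt_max => /orP[|]; last first.
    by apply/negP; rewrite -leNgt.
  rewrite ltrBrDr; apply/negP; rewrite -leNgt; apply: bigmax_le.
    by rewrite addr_ge0// ltW.
  move=> j _; apply: (le_trans (Hu _ _ x _)); first by rewrite lerDr.
  apply: lerD => //; rewrite -lee_fin fineK//; apply: ereal_sup_ubound.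
  by exists ((2 ^ j)%:R^-1 + e_ m) => //=; rewrite addr_gt0.
by move=> ->; exact: poisson_maximal_ge0.
Qed.

Lemma damped_maximal_ge gamma alpha tau e m M n x : cone tau n ->
  (forall i, (n i <= m)%N) ->
  normc (riesz_damped gamma alpha f n e M x) <= damped_maximal gamma alpha tau f e m M x.
Proof.
move=> nc nm; have nm' i : (n i < m.+1)%N by rewrite ltnS.
pose n' := [ffun i => Ordinal (nm' i)] : {ffun 'I_d -> 'I_m.+1}.
have -> : n = (fun i => n' i : nat) by apply/funext => i; rewrite ffunE.
rewrite /damped_maximal.
apply: (le_bigmax_cond 0 (fun n : {ffun 'I_d -> 'I_m.+1} =>
  normc (riesz_damped gamma alpha f (fun i => n i : nat) e M x))).
apply/asboolP; rewrite (_ : (fun i => _) = n)//.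
by apply/funext => i; rewrite ffunE.
Qed.

Lemma damping_cvg : e_ @ \oo --> 0. Proof. exact: cvg_harmonic. Qed.

(** Every index of the cone is eventually among those of [damped_maximal], and
    its mean is recovered as the damping disappears. *)
Lemma riesz_maximal_le_liminf gamma alpha tau (J : nat -> nat) (p : R) x :
  0 < gamma -> 0 < alpha -> 0 < p -> (forall m, (m.+1 <= 2 ^ J m)%N) -> 1 <= tau ->
  (riesz_maximal gamma alpha tau f x `^ p <= limn_einf (fun m =>
    ((damped_maximal gamma alpha tau f (e_ m) m.+1 (2 ^ J m) x `^ p)%R)%:E))%E.
Proof.
move=> g0 a0 p0 HJ t1; set u := (fun m => _); set l := limn_einf u.
have u0 m : (0 <= u m)%E by rewrite lee_fin powR_ge0.
have l0 : (0 <= l)%E by apply: (@limn_einf_ge _ _ _ 0).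
have p'0 : 0 < p^-1 by rewrite invr_gt0.
suff H : (riesz_maximal gamma alpha tau f x <= l `^ p^-1)%E.
  apply: (@le_trans _ _ ((l `^ p^-1) `^ p)%E).
    by apply: poweR_homo => //; exact: riesz_maximal_ge0.
  by rewrite -poweRrM mulVf ?gt_eqF// poweRe1.
apply: ge_ereal_sup => _ [n nc <-]; apply/lee_addgt0Pr => z z0.
pose M0 := \max_i n i.
have nM i : (0 < n i <= M0)%N by rewrite (leq_bigmax i) andbT; case: nc.
have [B B0 HB] := riesz_mean_le_damped f x g0 a0 nM.
have [|h0] := leP (normc (riesz_mean gamma alpha n f x)) z.
  by move=> h; rewrite (@le_trans _ _ z%:E) ?lee_fin// leeDr// poweR_ge0.
set a := normc _ in h0 *; have az : 0 <= a - z by rewrite subr_ge0 ltW.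
have : ((((a - z) `^ p)%R)%:E <= l)%E.
  have zB : 0 < z / (B + 1) by rewrite divr_gt0// ltr_wpDl.
  move/cvgrPdist_le : damping_cvg => /(_ _ zB) [N1 _ HN1].
  apply: (@limn_einf_ge _ _ _ (maxn N1 M0)) => m; rewrite geq_max => /andP[m1 m2].
  rewrite lee_fin; apply: ge0_ler_powR; rewrite ?nnegrE ?(ltW p0)//.
    by rewrite (le_trans _ (damped_maximal_ge _ _ _ _ _ nc _))// ?normc_ge0// => i;
      rewrite (leq_trans (proj2 (andP (nM i))))// (leq_trans m2).
  have em : e_ m * B <= z.
    have := HN1 m m1; rewrite sub0r normrN ger0_norm ?(ltW (e_gt0 m))// => h.
    rewrite (le_trans (ler_wpM2r B0 h))// -mulrAC ler_pdivrMr ?ltr_wpDl//.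
    by rewrite ler_wpM2l ?(ltW z0)// lerDl.
  rewrite lerBlDr; apply: (le_trans (HB (e_ m) (2 ^ J m)%N (ltW (e_gt0 m)) _)).
    by rewrite (leq_trans m2)// ltnW// (leq_trans _ (HJ m)).
  apply: lerD => //; apply: damped_maximal_ge => // i.
  by rewrite (leq_trans (proj2 (andP (nM i))))// (leq_trans m2).
move=> h; rewrite -leeBlDr// -EFinB.
rewrite (_ : (a - z)%:E = ((((a - z) `^ p)%R)%:E `^ p^-1)%E); last first.
  by rewrite poweR_EFin -powRrM mulfV ?gt_eqF// powRr1.
by apply: poweR_homo => //; rewrite lee_fin powR_ge0.
Qed.

(** The truncated Poisson maximum is measurable and at most [e_ m] plus its
    excess over [e_ m], which lies below the maximal function. *)
Lemma torus_integral_poisson_max s J m (p : R) : 0 < p ->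
  (forall x, ((Num.max (poisson_max f (e_ m) J s x - e_ m) 0)%:E <=
      poisson_maximal f x)%E) ->
  (torus_integral (fun x => (poisson_max f (e_ m) J s x `^ p)%R) <=
   (2 `^ p)%:E * (\int[mu]_y (`|poisson_maximal f (row y)| `^ p) +
                  ((e_ m `^ p)%R)%:E * mu [set: _]))%E.
Proof.
move=> p0 HP; pose W x := Num.max (poisson_max f (e_ m) J s x - e_ m) 0.
have W0 x : 0 <= W x by rewrite le_max lexx orbT.
have gW : torus_function W.
  by apply: torus_function_excess; exact: torus_function_poisson_max.
have gU := torus_function_poisson_max f (e_ m) J s.
have [_ mWp _] := torus_function_powR p gW.
have [_ mUp _] := torus_function_powR p gU.
have e0 := e_gt0 m; have p'0 := ltW p0.
apply: (@le_trans _ _ (\int[mu]_y ((2 `^ p)%:E * (((W (row y) `^ p)%R)%:E + ((e_ m `^ p)%R)%:E)))%E).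
  apply: ge0_integral_mono => y; first by rewrite lee_fin powR_ge0.
  rewrite -EFinD -EFinM lee_fin; set x := row y.
  have U0 := torus_function_ge0 gU x.
  have UW : poisson_max f (e_ m) J s x <= W x + e_ m by rewrite -lerBlDr le_max lexx.
  have Mx0 : 0 <= Num.max (W x) (e_ m) by rewrite (le_trans (W0 x))// le_max lexx.
  apply: (@le_trans _ _ ((2 * Num.max (W x) (e_ m)) `^ p)).
    apply: ge0_ler_powR => //; rewrite ?nnegrE; first by rewrite mulr_ge0.
    have : W x <= Num.max (W x) (e_ m) by rewrite le_max lexx.
    have : e_ m <= Num.max (W x) (e_ m) by rewrite le_max lexx orbT.
    move: UW; move: (Num.max (W x) (e_ m)) (W x) => M w; lra.
  rewrite powRM// ler_wpM2l ?powR_ge0//.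
  by case: (leP (W x) (e_ m)) => _; rewrite ?lerDl ?lerDr powR_ge0.
have mW : measurable_fun [set: _] (fun y => ((W (row y) `^ p)%R)%:E).
  exact/measurable_EFinP.
rewrite ge0_integralZl//; last 2 first.
- by apply: emeasurable_funD => //; exact: measurable_cst.
- by move=> y _; rewrite -EFinD lee_fin addr_ge0 ?powR_ge0.
apply: lee_wpmul2l; first by rewrite lee_fin powR_ge0.
rewrite ge0_integralD//; last by move=> y _; rewrite lee_fin powR_ge0.
rewrite integral_cst//; apply: leeD => //.
apply: ge0_integral_mono => y; first by rewrite lee_fin powR_ge0.
rewrite -poweR_EFin gee0_abs ?poisson_maximal_ge0//.
  by apply: poweR_homo => //; [rewrite lee_fin|exact: HP].
by move=> y _; rewrite lee_fin powR_ge0.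
Qed.

End MaximalInequality.

Section RieszMaximal.
Local Open Scope complex_scope.
Local Notation normc := (@Normc.normc _).

Lemma riesz_maximal_inequality_fin (R : realType) (d : nat) (b r gamma alpha tau p : R) :
  (0 < d)%N -> 0 < b <= 1 -> b * d%:R < 1 -> 0 < r -> r < 1 ->
  0 < r * (1 + b) - 1 -> 1 <= gamma -> b <= alpha -> 1 <= tau -> r < p ->
  exists C : R, forall f : ('rV[R]_d -> R[i]) -> R[i], hardy_space p%:E f ->
    (Lp_torus p%:E (riesz_maximal gamma alpha tau f) <= C%:E * hardy_norm p%:E f)%E.
Proof.
move=> d0 b01 bd r0 r1 rb g1 ba t1 rp.
have p0 : 0 < p by exact: lt_trans rp.
have a0 : 0 < alpha by case/andP: b01 => b0 _; exact: lt_le_trans ba.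
have [s [Hs _]] := riesz_damped_bound d0 b01 bd r0 r1 rb g1 ba t1.
have [C C0 HC] := Hs p rp.
exists ((C * 2 `^ p) `^ p^-1) => f [df _].
have [J HJ] := truncation_scale s df.
have J1 m : (m.+1 <= 2 ^ J m)%N by case: (HJ m).
pose P := (\int[lebesgue_torus d]_y (`|poisson_maximal f (torus_row y)| `^ p))%E.
pose T := lebesgue_torus d [set: d.-tuple (measurableTypeR R)].
have P0 : (0 <= P)%E by apply: integral_ge0 => y _; exact: poweR_ge0.
have K0 : 0 <= C * 2 `^ p by rewrite mulr_ge0 ?powR_ge0.
have Tfin : T \is a fin_num by exact: fin_num_measure.
rewrite /hardy_norm /Lp_torus !Lnorm.unlock -/P.
have main : (\int[lebesgue_torus d]_y (`|riesz_maximal gamma alpha tau f (torus_row y)| `^ p) <=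
    (C * 2 `^ p)%:E * P)%E.
  pose g m x := (damped_maximal gamma alpha tau f m.+1%:R^-1 m.+1 (2 ^ J m) x `^ p).
  have gP m x : 0 <= g m x by exact: powR_ge0.
  apply: (@le_trans _ _ (\int[lebesgue_torus d]_y limn_einf (fun m => (g m (torus_row y))%:E))%E).
    apply: ge0_integral_mono => y; first exact: poweR_ge0.
    rewrite gee0_abs ?riesz_maximal_ge0//.
    by apply: riesz_maximal_le_liminf => //; lra.
  apply: le_trans (fatou _ _ _ _) _ => //.
  - move=> m; apply/measurable_EFinP.
    exact: (torus_function_measurable (torus_function_powR p
      (torus_function_damped_maximal _ _ _ _ _ _ _))).
  - by move=> m y _; rewrite lee_fin.
  apply: (@limn_einf_le _ _ (fun m => (C * 2 `^ p)%:E * (P + ((m.+1%:R^-1 `^ p)%R)%:E * T))%E).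
    move=> m; apply: (@le_trans _ _ (C%:E * torus_integral (fun x =>
        (poisson_max f m.+1%:R^-1 (J m) s x `^ p)%R))%E).
      by apply: HC; rewrite /= J1.
    rewrite EFinM -muleA; apply: lee_wpmul2l; first by rewrite lee_fin.
    by apply: torus_integral_poisson_max => //; case: (HJ m).
  apply: cvgeZl => //; rewrite -[X in _ --> X]adde0; apply: cvgeD.
  - exact: fin_num_adde_defl.
  - exact: cvg_cst.
  rewrite (_ : (fun m => _) = (EFin \o (fun m => m.+1%:R^-1 `^ p * fine T))); last first.
    by apply/funext => m; rewrite /= EFinM fineK.
  apply/fine_cvgP; split; first exact: nearW.
  rewrite [X in X @ _ --> _](_ : _ = (fun m => m.+1%:R^-1 `^ p * fine T))//.
  rewrite -[X in _ --> X](mul0r (fine T)); apply: cvgMr_tmp.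
  apply/cvgrPdist_le => z z0; have zp : 0 < z `^ p^-1 by exact: powR_gt0.
  move/cvgrPdist_le : (@cvg_harmonic R) => /(_ _ zp); apply: filterS => m.
  rewrite !sub0r !normrN !ger0_norm ?powR_ge0 ?invr_ge0// => h.
  have -> : z = (z `^ p^-1) `^ p by rewrite -powRrM mulVf ?gt_eqF// powRr1// ltW.
  by apply: ge0_ler_powR; rewrite ?nnegrE ?powR_ge0 ?(ltW p0) ?invr_ge0.
apply: (@le_trans _ _ (((C * 2 `^ p)%:E * P) `^ p^-1)%E).
  apply: poweR_homo; rewrite ?invr_gt0//.
  by apply: integral_ge0 => y _; exact: poweR_ge0.
by rewrite poweRM ?lee_fin// poweR_EFin.
Qed.

(** The Poisson maxima do not exceed the essential supremum [l] by more than
    [e m], so the integral of their excess over [l + e m] vanishes; hence so does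
    that of the excess of the damped Riesz means over [C * (l + e m)], for all
    [m] at once outside a null set. *)
Lemma riesz_maximal_inequality_infty (R : realType) (d : nat) (b r gamma alpha tau : R) :
  (0 < d)%N -> 0 < b <= 1 -> b * d%:R < 1 -> 0 < r -> r < 1 ->
  0 < r * (1 + b) - 1 -> 1 <= gamma -> b <= alpha -> 1 <= tau ->
  exists C : R, forall f : ('rV[R]_d -> R[i]) -> R[i], hardy_space +oo%E f ->
    (Lp_torus +oo%E (riesz_maximal gamma alpha tau f) <= C%:E * hardy_norm +oo%E f)%E.
Proof.
move=> d0 b01 bd r0 r1 rb g1 ba t1.
have a0 : 0 < alpha by case/andP: b01 => b0 _; exact: lt_le_trans ba.
have g0 : 0 < gamma by lra.
have [s [_ [C C0 HC]]] := riesz_damped_bound d0 b01 bd r0 r1 rb g1 ba t1.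
exists C => f [df hf].
have [J HJ] := truncation_scale s df.
have J1 m : (m.+1 <= 2 ^ J m)%N by case: (HJ m).
move: hf; rewrite /hardy_norm /Lp_torus !Lnorm.unlock.
case: ifPn => [T0|_ _]; last by rewrite mule0.
set mu := lebesgue_torus d in T0 *; set PM := (fun y => _) : _ -> \bar R.
set L := ess_sup mu (abse \o PM).
have L0 : (0 <= L)%E.
  by apply: ess_sup_gee => //; apply: aeW => y /=; exact: abse_ge0.
move=> Loo; have Lfin : L \is a fin_num by rewrite ge0_fin_numE.
pose l := fine L; have l0 : 0 <= l by exact: fine_ge0.
have PMl : \forall y \ae mu, (PM y <= l%:E)%E.
  rewrite /l fineK//; apply: filterS (ess_sup_ge mu (abse \o PM)) => y /=.
  by apply: le_trans; exact: lee_abs.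
pose e m : R := m.+1%:R^-1; have e0 m : 0 < e m by rewrite invr_gt0.
pose g m x := damped_maximal gamma alpha tau f (e m) m.+1 (2 ^ J m) x.
pose U m x := poisson_max f (e m) (J m) s x.
have gU m : torus_function (U m) by exact: torus_function_poisson_max.
have gg m : torus_function (g m) by exact: torus_function_damped_maximal.
have key m : \forall y \ae mu, g m (torus_row y) <= C * (l + e m).
  have [C' C'0 HC'] := HC (J m).
  have le0 : 0 <= l + e m by rewrite addr_ge0// ltW.
  have gF := torus_function_excess (C * (l + e m)) (gg m).
  have gG := torus_function_excess (l + e m) (gU m).
  have G0 : torus_integral (fun x => Num.max (U m x - (l + e m)) 0) = 0%E.
    rewrite /torus_integral -[RHS](integral0 mu [set: _]).
    apply: ge0_ae_eq_integral => //.
    - by apply/measurable_EFinP; exact: (torus_function_measurable gG).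
    - by move=> y _; rewrite lee_fin; exact: (torus_function_ge0 gG).
    apply: filterS PMl => y yl _ /=; congr EFin; apply/max_idPr.
    have [_ /(_ (torus_row y))] := HJ m; move=> /le_trans/(_ yl).
    rewrite lee_fin ge_max => /andP[h _]; rewrite opprD addrA.
    by move: h; rewrite -/(e m) -/(U m (torus_row y)); lra.
  have F0 : torus_integral (fun x => Num.max (g m x - C * (l + e m)) 0) = 0%E.
    apply/eqP; rewrite eq_le; apply/andP; split; last first.
      by apply: integral_ge0 => y _; rewrite lee_fin; exact: (torus_function_ge0 gF).
    apply: (le_trans (HC' f (e m) m.+1 (l + e m) _ le0)); first by rewrite /= J1.
    by rewrite G0 mule0.
  have mF : measurable_fun [set: _] (fun y =>
      (Num.max (g m (torus_row y) - C * (l + e m)) 0)%:E).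
    by apply/measurable_EFinP; exact: (torus_function_measurable gF).
  have /(ae_eq_integral_abs mu measurableT mF) : (\int[mu]_y
      `| (Num.max (g m (torus_row y) - C * (l + e m)) 0)%:E | = 0)%E.
    rewrite -[RHS]F0; apply: eq_integral => y _; rewrite gee0_abs// lee_fin.
    exact: (torus_function_ge0 gF).
  apply: filterS => y /(_ I) [] h; rewrite -subr_le0 -h le_max lexx//.
rewrite -(fineK Lfin) -EFinM -/l; apply/ess_supP.
apply: filterS (ae_foralln key) => y gy /=.
rewrite gee0_abs ?riesz_maximal_ge0//; apply: ge_ereal_sup => _ [n nc <-].
rewrite lee_fin; apply/ler_addgt0Pr => z z0; set x := \row_i tnth y i.
pose M0 := \max_i n i.
have nM i : (0 < n i <= M0)%N by rewrite (leq_bigmax i) andbT; case: nc.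
have [B B0 HB] := riesz_mean_le_damped f x g0 a0 nM.
have D0 : 0 < C + B + 1 by rewrite ltr_wpDl// addr_ge0.
have zD : 0 < z / (C + B + 1) by exact: divr_gt0.
move/cvgrPdist_le : (@cvg_harmonic R) => /(_ _ zD) [N1 _ HN1].
pose m := maxn N1 M0; have := HN1 m (leq_maxl _ _).
rewrite sub0r normrN ger0_norm ?invr_ge0// -/(e m) ler_pdivlMr// => em'.
have em : e m * (C + B + 1) <= z := em'.
have M0m : (M0 <= m)%N by exact: leq_maxr.
have h1 : normc (riesz_mean gamma alpha n f x) <=
    normc (riesz_damped gamma alpha f n (e m) (2 ^ J m) x) + e m * B.
  apply: HB; first exact: ltW.
  by rewrite (leq_trans M0m)// ltnW// (leq_trans _ (J1 m)).
have h2 : normc (riesz_damped gamma alpha f n (e m) (2 ^ J m) x) <= g m x.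
  apply: damped_maximal_ge => // i.
  by rewrite (leq_trans (proj2 (andP (nM i))))// (leq_trans M0m).
have h3 : g m x <= C * (l + e m) by exact: gy.
by move: (ltW (e0 m)) em h1 h2 h3; clear; move: (e m) => t; lra.
Qed.

End RieszMaximal.

Theorem theorem14p1 (R : realType) (d : nat) (gamma tau alpha : R)
    (p : \bar R) :
  (1 <= d)%N -> 1 <= gamma -> 1 <= tau -> 0 < alpha ->
  ((Num.max (d%:R / (d%:R + 1)) (1 / (Num.min alpha 1 + 1)))%:E < p)%E ->
  (p <= +oo)%E ->
  exists C : R, forall f : ('rV[R]_d -> R[i]) -> R[i], hardy_space p f ->
    (Lp_torus p (riesz_maximal gamma alpha tau f) <= C%:E * hardy_norm p f)%E.
Proof.
move=> d0 g1 t1 a0 pc _; case: p pc => [p| |]; last by rewrite ltNge leNye.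
  rewrite lte_fin => /(riesz_exponents d0 a0)[b [r [b01 ba bd /andP[r0 r1] [rp rb]]]].
  exact: (riesz_maximal_inequality_fin d0 b01 bd r0 r1 rb g1 ba t1 rp).
move=> _; have [q qc] : exists q : R,
    Num.max (d%:R / (d%:R + 1)) (1 / (Num.min alpha 1 + 1)) < q.
  exists (Num.max (d%:R / (d%:R + 1)) (1 / (Num.min alpha 1 + 1)) + 1).
  by rewrite ltrDl ltr01.
have [b [r [b01 ba bd /andP[r0 r1] [_ rb]]]] := riesz_exponents d0 a0 qc.
exact: (riesz_maximal_inequality_infty d0 b01 bd r0 r1 rb g1 ba t1).
Qed.
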